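(* Let $G$ be an abelian group and let $\mathcal L$ be one of the real forms of type $B_r$ for $r\ge2$, namely, $\mathfrak{so}_{p,q}(\mathbb R)$ where $p+q=2r+1$, $p\ge q$. Then any $G$-grading on $\mathcal L$ is isomorphic to some $\Gamma_B(\kappa,\sigma)$ where $r=\frac12(|\kappa|-1)$ and $p-q=\big|\sum_{g\in G_{[2]}}\sigma(g)\big|$. Moreover, two such gradings, $\Gamma_B(\kappa,\sigma)$ and $\Gamma_B(\kappa',\sigma')$, are isomorphic if and only if $(\kappa,\sigma)$ and $(\kappa',\sigma')$ are in the same $G_{[2]}\times\{\pm1\}$-orbit.
   Context: $G$ is written multiplicatively, with identity $e$; $G_{[2]}=\{g\in G\mid g^2=e\}$. A $G$-grading on a real Lie algebra $\mathcal L$ is a decomposition $\mathcal L=\bigoplus_{g\in G}\mathcal L_g$ with $[\mathcal L_g,\mathcal L_h]\subseteq\mathcal L_{gh}$; two gradings on $\mathcal L$ are isomorphic if some automorphism of $\mathcal L$ maps each component of the first onto the component of the same degree of the second. Parameters: $\kappa:G\to\mathbb Z_{\ge0}$ has finite support, satisfies $\kappa(x^{-1})=\kappa(x)$ for all $x\in G$, and $|\kappa|=\sum_x\kappa(x)$ is odd; $\sigma:G\to\mathbb Z$ satisfies $\sigma(x)=0$ for $x\notin G_{[2]}$, and $|\sigma(x)|\le\kappa(x)$, $\sigma(x)\equiv\kappa(x)\pmod2$ for $x\in G_{[2]}$. The group $G_{[2]}\times\{\pm1\}$ acts on such pairs by $g\cdot(\kappa,\sigma)=(g\cdot\kappa,g\cdot\sigma)$,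 $(g\cdot\kappa)(x)=\kappa(g^{-1}x)$, $(g\cdot\sigma)(x)=\sigma(g^{-1}x)$, and $\epsilon\cdot(\kappa,\sigma)=(\kappa,\epsilon\sigma)$. Grading $\Gamma_B(\kappa,\sigma)$: let $g_1,\dots,g_s$ be the support of $\kappa$, ordered so that $g_1,\dots,g_m\in G_{[2]}$ and the others come in pairs with $g_{m+2j-1}g_{m+2j}=e$, $1\le j\le r'$, $m+2r'=s$. Put $k_i=\kappa(g_i)$, $n=|\kappa|$, and partition matrices in $\mathcal R=M_n(\mathbb R)$ into blocks according to $n=k_1+\dots+k_s$. Grade $\mathcal R$ by $\deg E=g_ig_j^{-1}$ for any matrix unit $E$ in the $(i,j)$ block, and let $\varphi(X)=\Phi^{-1}X^T\Phi$, where $\Phi=S_1\oplus\dots\oplus S_{m+r'}$ with $S_i=\mathrm{diag}(I_{p_i},-I_{q_i})$, $p_i=\frac12(\kappa(g_i)+\sigma(g_i))$, $q_i=\frac12(\kappa(g_i)-\sigma(g_i))$ for $i\le m$, and $S_{m+j}=\begin{pmatrix} 0 & I_{k_{m+2j}} \\ I_{k_{m+2j}} & 0 \end{pmatrix}$ for $1\le j\le r'$. $\Gamma_B(\kappa,\sigma)$ is the restriction of this grading to the Lie algebra $\mathrm{Skew}(\mathcal R,\varphi)=\{x\in\mathcal R\mid\varphi(x)=-x\}$, regarded as a grading on $\mathcal L$ via any isomorphism $\mathrm{Skew}(\mathcal R,\varphi)\cong\mathcal L$. *)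

(* Defs.v *)
From HB Require Import structures.
From mathcomp Require Import all_boot all_order all_algebra.
From mathcomp Require Import finmap.

Set Implicit Arguments.
Unset Strict Implicit.
Unset Printing Implicit Defensive.

Import GRing.Theory.

Local Open Scope ring_scope.

Section LieGradings.

Variable R : fieldType.

Definition lie_bracket n (X Y : 'M[R]_n) : 'M[R]_n := X *m Y - Y *m X.

(* Lie algebras occur as Lie subalgebras L of some 'M[R]_n, given by their
   underlying subspace.  A linear map L1 -> L2 is given by any linear extension
   psi of it to the whole matrix space: only the restriction of psi to L1 is
   constrained, and only that restriction is ever used. *)
Definition lie_iso m n (L1 : {vspace 'M[R]_m}) (L2 : {vspace 'M[R]_n})
    (psi : 'Hom('M[R]_m, 'M[R]_n)) : Prop :=
  [/\ (psi @: L1)%VS = L2,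
      {in L1 &, injective psi}
    & {in L1 &, forall X Y,
         psi (lie_bracket X Y) = lie_bracket (psi X) (psi Y)}].

(* The second and third conditions say that L is the direct sum of the
   subspaces Gam g; as G may be infinite, they range over finite families. *)
Definition is_grading (G : groupType) n (L : {vspace 'M[R]_n})
    (Gam : G -> {vspace 'M[R]_n}) : Prop :=
  [/\ forall g, (Gam g <= L)%VS,
      {in L, forall X, exists s : seq G, X \in (\sum_(g <- s) Gam g)%VS},
      forall (s : seq G) (f : G -> 'M[R]_n), uniq s ->
        (forall g, f g \in Gam g) -> \sum_(g <- s) f g = 0 ->
        {in s, forall g, f g = 0}
    & forall g h X Y, X \in Gam g -> Y \in Gam h ->
        lie_bracket X Y \in Gam (g * h)%g].

Definition grading_isomorphic (G : groupType) n (L : {vspace 'M[R]_n})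
    (Gam Gam' : G -> {vspace 'M[R]_n}) : Prop :=
  exists psi : 'Hom('M[R]_n, 'M[R]_n),
    lie_iso L L psi /\ forall g, (psi @: Gam g)%VS = Gam' g.

Definition so_form p q : 'M[R]_(p + q) := block_mx 1%:M 0 0 (- 1%:M).

Definition so p q : {vspace 'M[R]_(p + q)} :=
  lker (linfun (fun X : 'M[R]_(p + q) => X^T *m so_form p q + so_form p q *m X)).

Lemma mem_so p q (X : 'M[R]_(p + q)) :
  (X \in so p q) = (X^T *m so_form p q + so_form p q *m X == 0).
Proof.
have lin : linear (fun X : 'M[R]_(p + q) =>
                     X^T *m so_form p q + so_form p q *m X).
  move=> a Y Z /=; rewrite linearP /= mulmxDl mulmxDr -scalemxAl -scalemxAr.
  by rewrite scalerDr addrACA.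
pose h := GRing.isLinear.Build _ _ _ _ _ lin.
pose f : {linear 'M[R]_(p + q) -> 'M[R]_(p + q)} := HB.pack (fun X : 'M[R]_(p + q) =>
                     X^T *m so_form p q + so_form p q *m X) h.
by rewrite memv_ker -[X in linfun X]/(f : _ -> _) lfunE.
Qed.

Definition phi_inv n (Phi X : 'M[R]_n) : 'M[R]_n := invmx Phi *m X^T *m Phi.

Definition Skew n (Phi : 'M[R]_n) : {vspace 'M[R]_n} :=
  lker (linfun (fun X : 'M[R]_n => phi_inv Phi X + X)).

Lemma mem_Skew n (Phi X : 'M[R]_n) : (X \in Skew Phi) = (phi_inv Phi X == - X).
Proof.
have lin : linear (fun X : 'M[R]_n => phi_inv Phi X + X).
  move=> a Y Z /=; rewrite /phi_inv linearP /= mulmxDr mulmxDl -scalemxAr.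
  by rewrite -scalemxAl scalerDr addrACA.
pose h := GRing.isLinear.Build _ _ _ _ _ lin.
pose f : {linear 'M[R]_n -> 'M[R]_n} :=
  HB.pack (fun X : 'M[R]_n => phi_inv Phi X + X) h.
by rewrite memv_ker -[X in linfun X]/(f : _ -> _) lfunE /= addr_eq0.
Qed.

End LieGradings.

Section GradingData.

Variable G : groupType.
Implicit Types (kappa : {fsfun G -> nat with 0%N}) (sigma : G -> int).

Definition G2 : pred G := [pred g : G | (g ^+ 2)%g == 1%g].

Definition weight kappa : nat := (\sum_(x <- finsupp kappa) kappa x)%N.

(* As sigma vanishes outside G2 and is bounded by kappa on G2, its support lies
   in that of kappa, so this finite sum is the sum over all of G2. *)
Definition signature kappa sigma : int :=
  \sum_(x <- finsupp kappa | x \in G2) sigma x.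

Definition paramB kappa sigma : Prop :=
  [/\ forall x, kappa (x^-1)%g = kappa x,
      odd (weight kappa),
      forall x, x \notin G2 -> sigma x = 0
    & forall x, x \in G2 ->
        (`|sigma x| <= kappa x)%N /\ (sigma x = (kappa x)%:Z %[mod 2])%Z].

Definition translate T (g : G) (f : G -> T) : G -> T := fun x => f (g^-1 * x)%g.

Definition same_orbit kappa sigma kappa' sigma' : Prop :=
  exists2 g : G, g \in G2 &
  exists2 eps : int, eps = 1 \/ eps = -1 &
    kappa' =1 translate g kappa /\
    sigma' =1 (fun x => eps * translate g sigma x).

End GradingData.

Section GammaB.

Variables (R : fieldType) (G : groupType).
Variables (kappa : {fsfun G -> nat with 0%N}) (sigma : G -> int).

(* The ordered support of kappa is
     t_0, ..., t_(m-1), u_0, u_0^-1, ..., u_(r'-1), u_(r'-1)^-1.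
   As the entries are distinct, no u_j is in G2. *)
Variables (m r' : nat) (t : 'I_m -> G) (u : 'I_r' -> G).

Definition support_order : Prop :=
  (forall i, t i \in @G2 G) /\
  perm_eq (codom t ++ codom u ++ [seq (u j)^-1%g | j : 'I_r'])
          (finsupp kappa).

Definition sizeB : nat :=
  (\sum_(i < m) kappa (t i) + \sum_(j < r') (kappa (u j) + kappa (u j)))%N.

(* The support element indexing the block that contains a given index. *)
Definition labelB (a : 'I_sizeB) : G :=
  match split a with
  | inl b => t (tagnat.sig1 b)
  | inr b => match split (tagnat.sig2 b) with
             | inl _ => u (tagnat.sig1 b)
             | inr _ => (u (tagnat.sig1 b))^-1%g
             end
  end.

Definition p_coef (x : G) : nat := `|(((kappa x)%:Z + sigma x) %/ 2)%Z|%N.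

(* diag(I_p, -I_q) with p = p_coef x and p + q = kappa x *)
Definition S_self (x : G) : 'M[R]_(kappa x) :=
  diag_mx (\row_a (if (a < p_coef x)%N then 1 else -1)).

Definition S_pair (x : G) : 'M[R]_(kappa x + kappa x) :=
  block_mx 0 1%:M 1%:M 0.

Definition PhiB : 'M[R]_sizeB :=
  block_mx (\mxdiag_(i < m) S_self (t i)) 0
           0 (\mxdiag_(j < r') S_pair (u j)).

Definition compB (g : G) : {vspace 'M[R]_sizeB} :=
  (\sum_(ab : 'I_sizeB * 'I_sizeB
         | (labelB ab.1 * (labelB ab.2)^-1)%g == g)
      <[delta_mx ab.1 ab.2]>)%VS.

Definition skewB : {vspace 'M[R]_sizeB} := Skew PhiB.

Definition GammaB (g : G) : {vspace 'M[R]_sizeB} := (compB g :&: skewB)%VS.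

End GammaB.

(* Gam is Gamma_B(kappa, sigma), for some admissible order of the support,
   transported to L along some isomorphism of Lie algebras. *)
Definition is_GammaB (R : fieldType) (G : groupType)
    (kappa : {fsfun G -> nat with 0%N}) (sigma : G -> int)
    n (L : {vspace 'M[R]_n}) (Gam : G -> {vspace 'M[R]_n}) : Prop :=
  exists (m r' : nat) (t : 'I_m -> G) (u : 'I_r' -> G),
    support_order kappa t u /\
    exists psi : 'Hom('M[R]_(sizeB kappa t u), 'M[R]_n),
      lie_iso (skewB R kappa sigma t u) L psi /\
      forall g, Gam g = (psi @: GammaB R kappa sigma t u g)%VS.

(* Main.v *)
(* For L = so(Phi) in M_n the trace of ad X ad Y ad Z ad W on L equals
   (n - 8) tr(XYZW) up to traces of shorter words; as n is odd, the traces of all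
   words of length at most 4 in L are determined by the Lie structure.  Hence they
   are preserved by isomorphisms and are graded for any grading of L.  Since L L
   spans M_n and the trace form is nondegenerate, isomorphisms extend to M_n, where
   they are inner by Skolem-Noether, and gradings extend to gradings of M_n that
   are compatible with the involution.

   A grading of M_n with n odd has a rank one idempotent in degree 1: cut down to
   the corner of a primitive idempotent of odd rank k.  Its degree 1 part is R,
   because k is odd, so it is a graded division algebra with lines as components;
   homogeneous elements then commute up to scalars c with c^k = 1, so c = 1, the
   corner is commutative and k = 1.  The columns thus form a graded space, i.e. in a
   suitable basis the indices carry labels in G and E_ab has degree l(a)/l(b).
   Compatibility with the involution forces the form to pair label x with label
   c/x for a constant c; as n is odd c is a square and may be shifted to 1.

   Labelled forms are classified by the multiplicity of each label and by the
   signature on each label of order at most two (Sylvester), which are kappa and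
   sigma.  A graded isomorphism is conjugation by a matrix that multiplies all
   labels by one h with h^2 = 1 and the form by a sign, which gives the orbits. *)
Require Import Defs.
From HB Require Import structures.
From mathcomp Require Import all_boot all_order all_algebra all_fingroup.
From mathcomp Require Import finmap reals polyrcf.
From mathcomp Require boolp.
From mathcomp Require Import ring lra zify.

Set Implicit Arguments.
Unset Strict Implicit.
Unset Printing Implicit Defensive.

Import Order.TTheory GRing.Theory Num.Theory.
Local Open Scope ring_scope.

(** * Traces on the Lie algebra of skew matrices *)

(** Multiplicativity of the extension to M_n is tested by pairing with two further skew letters, so
    it involves traces of five-letter words, one letter more than the adjoint traces give. The
    identity [word3] closes the gap: a product of three skew matrices is a combination of products
    of two and of sums XYZ + ZYX, which are skew again and hence determined by four-letter traces
    through nondegeneracy. The same reduction serves isomorphisms, where traces are preserved, and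
    gradings, where they vanish unless the degrees multiply to 1.

    A form is determined by its skew matrices only up to a scalar c. Over a real closed field |c| is
    a square and can be absorbed into the conjugating matrix, so only the sign of c survives: it is
    the factor acting on sigma, and the reason for the absolute value in p - q.

    Both [so_form] and [PhiB] are involutions, so the signature of a block is simply its trace, and
    the law of inertia becomes a comparison of traces. Gradings are compared by one principle: a
    covering family contained in a direct family equals it ([fam_eq]). *)

Section Bracket.
Variables (R : realFieldType) (n : nat).
Implicit Types (A B X Y Z : 'M[R]_n).

Lemma lie_bracket_is_linear X : linear (@lie_bracket R n X).
Proof.
move=> a Y Z; rewrite /lie_bracket linearP /= mulmxDl -scalemxAl scalerBr.
by rewrite opprD addrACA.
Qed.

HB.instance Definition _ X :=
  GRing.isLinear.Build R 'M[R]_n 'M[R]_n *:%R (lie_bracket X)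
    (lie_bracket_is_linear X).

Lemma lie_bracket_word X A Z B :
  lie_bracket X (A *m Z *m B) = (X *m A) *m Z *m B - A *m Z *m (B *m X).
Proof. by rewrite /lie_bracket !mulmxA. Qed.

Lemma mul_delta_mx_entry A B (j k a b : 'I_n) :
  (A *m delta_mx j k *m B) a b = A a j * B k b.
Proof.
rewrite mxE (bigD1 k) //= mxE (bigD1 j) //= mxE !eqxx mulr1.
rewrite big1 ?addr0 => [|i ij]; last by rewrite mxE (negPf ij) mulr0.
rewrite big1 ?addr0 // => i ik; rewrite mxE big1 ?mul0r // => l _.
by rewrite mxE (negPf ik) andbF mulr0.
Qed.

(** Expanding T (P E_jk) in the basis and exchanging the sums reassembles P b_i = b_i from its
    matrix entries. A trace over an unspecified basis of L thus becomes a computable sum over matrix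
    units. *)
Lemma basis_trace (L : {vspace 'M[R]_n}) d (b : d.-tuple 'M[R]_n)
    (T P : {linear 'M[R]_n -> 'M[R]_n}) :
  basis_of L b -> (forall Z, P Z \in L) -> {in L, forall Z, P Z = Z} ->
  {in L, forall Z, T Z \in L} ->
  \sum_i coord b i (T b`_i) = \sum_j \sum_k T (P (delta_mx j k)) j k.
Proof.
move=> bL PL Pid TL.
have TP j k : T (P (delta_mx j k)) j k =
    \sum_i coord b i (T (P (delta_mx j k))) * b`_i j k.
  rewrite {1}(coord_basis bL (TL _ (PL _))) summxE.
  by apply: eq_bigr => i _; rewrite mxE.
under [RHS]eq_bigr do under eq_bigr do rewrite TP.
under [RHS]eq_bigr do rewrite exchange_big.
rewrite [RHS]exchange_big; apply: eq_bigr => i _ /=.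
have biL : b`_i \in L by apply: (basis_mem bL); rewrite mem_nth ?size_tuple.
rewrite -{1}(Pid _ biL) {1}[b`_i]matrix_sum_delta !linear_sum.
apply: eq_bigr => j _; rewrite !linear_sum; apply: eq_bigr => k _.
by rewrite !linearZ /= mulrC.
Qed.

Section SkewTrace.
Variable Phi : 'M[R]_n.
Hypotheses (PhiT : Phi^T = Phi) (PhiU : Phi \in unitmx).

Lemma phi_invM X Y : phi_inv Phi (X *m Y) = phi_inv Phi Y *m phi_inv Phi X.
Proof. by rewrite /phi_inv trmx_mul !mulmxA mulmxK. Qed.

Lemma phi_inv1 : phi_inv Phi 1%:M = 1%:M.
Proof. by rewrite /phi_inv trmx1 mulmx1 mulVmx. Qed.

Lemma phi_inv_is_linear : linear (phi_inv Phi).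
Proof.
move=> a X Y; rewrite /phi_inv linearP /= mulmxDr mulmxDl.
by rewrite -scalemxAr -scalemxAl.
Qed.

HB.instance Definition _ :=
  GRing.isLinear.Build R 'M[R]_n 'M[R]_n *:%R (phi_inv Phi) phi_inv_is_linear.

Lemma phi_invK : involutive (phi_inv Phi).
Proof.
move=> X; rewrite /phi_inv !trmx_mul trmxK trmx_inv PhiT !mulmxA mulVmx //.
by rewrite mul1mx -mulmxA mulVmx // mulmx1.
Qed.

Lemma tr_phi_inv X : \tr (phi_inv Phi X) = \tr X.
Proof. by rewrite /phi_inv mxtrace_mulC mulmxA mulmxV // mul1mx mxtrace_tr. Qed.

Lemma skewP X : reflect (phi_inv Phi X = - X) (X \in Skew Phi).
Proof. by rewrite mem_Skew; apply: eqP. Qed.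

Lemma tr_skew X : X \in Skew Phi -> \tr X = 0.
Proof.
move=> /skewP h; have := tr_phi_inv X; rewrite h linearN /=; lra.
Qed.

Lemma lie_skew X Y :
  X \in Skew Phi -> Y \in Skew Phi -> lie_bracket X Y \in Skew Phi.
Proof.
move=> /skewP hX /skewP hY; apply/skewP; rewrite /lie_bracket linearB /=.
by rewrite !phi_invM hX hY !mulNmx !mulmxN !opprK opprB.
Qed.

Definition skew_proj X : 'M[R]_n := 2^-1 *: (X - phi_inv Phi X).

Lemma skew_proj_is_linear : linear skew_proj.
Proof.
move=> a X Y; rewrite /skew_proj [phi_inv _ _]linearP /= opprD addrACA.
by rewrite -scalerBr scalerDr !scalerA mulrC.
Qed.

HB.instance Definition _ :=
  GRing.isLinear.Build R 'M[R]_n 'M[R]_n *:%R skew_proj skew_proj_is_linear.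

Lemma skew_proj_in X : skew_proj X \in Skew Phi.
Proof.
by apply/skewP; rewrite /skew_proj linearZ linearB /= phi_invK -scalerN opprB.
Qed.

Lemma skew_proj_id : {in Skew Phi, forall X, skew_proj X = X}.
Proof.
move=> X /skewP h; rewrite /skew_proj h opprK -mulr2n -scaler_nat scalerA.
by rewrite mulVf ?scale1r // pnatr_eq0.
Qed.

(** By [basis_trace] this is the trace on [Skew Phi] of any linear f that preserves the skew
    matrices. It also makes sense for maps Z |-> A Z B, which need not preserve them but are the
    summands of iterated brackets. *)
Definition skew_tr (f : 'M[R]_n -> 'M[R]_n) : R :=
  \sum_j \sum_k f (skew_proj (delta_mx j k)) j k.

(* Composing Z |-> A Z B with the projection (Z - phi Z) / 2 onto the skew
   matrices, the first half contributes tr A tr B and the second tr (A phi B).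
     *)
Definition word_tr A B : R := 2^-1 * (\tr A * \tr B - \tr (A *m phi_inv Phi B)).

Lemma skew_tr_word A B : skew_tr (fun Z => A *m Z *m B) = word_tr A B.
Proof.
have -> : word_tr A B = \sum_j \sum_k 2^-1 *
    (A j j * B k k - (A *m invmx Phi) j k * (Phi *m B) j k).
  rewrite /word_tr; under [RHS]eq_bigr do rewrite -mulr_sumr big_split /=.
  rewrite -mulr_sumr big_split /=; congr (_ * (_ + _)).
    rewrite /mxtrace mulr_suml; apply: eq_bigr => j _.
    by rewrite mulr_sumr.
  rewrite /phi_inv !mulmxA -mulmxA -{2}PhiT -trmx_mul /mxtrace -sumrN.
  apply: eq_bigr => j _; rewrite mxE -sumrN; apply: eq_bigr => k _.
  by rewrite !mxE.
apply: eq_bigr => j _; apply: eq_bigr => k _.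
rewrite /skew_proj -scalemxAr -scalemxAl mxE mulmxBr mulmxBl.
rewrite [in LHS]mxE mul_delta_mx_entry mxE; congr (_ * (_ - _)).
rewrite /phi_inv trmx_delta !mulmxA -[_ *m Phi *m B]mulmxA.
by rewrite mul_delta_mx_entry.
Qed.

Definition ad_step X (g : 'M[R]_n -> 'M[R]_n -> R) A B : R :=
  g (X *m A) B - g A (B *m X).

(** Here f collects the outer brackets. By [lie_bracket_word], inserting an innermost bracket with X
    replaces the multipliers (A, B) by (X A, B) and (A, B X) with opposite signs. Traces are thus
    built from the outermost letter inwards and evaluated at A = B = 1. *)
Lemma skew_tr_ad (f : 'M[R]_n -> 'M[R]_n) g X :
  {morph f : U V / U - V} ->
  (forall A B, skew_tr (fun Z => f (A *m Z *m B)) = g A B) ->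
  forall A B,
    skew_tr (fun Z => f (lie_bracket X (A *m Z *m B))) = ad_step X g A B.
Proof.
move=> fB fg A B; rewrite /ad_step -!fg /skew_tr -sumrB; apply: eq_bigr => j _.
rewrite -sumrB; apply: eq_bigr => k _.
by rewrite lie_bracket_word fB mxE [(- _ : 'M_n) _ _]mxE.
Qed.

Lemma skew_tr_triv (f : 'M[R]_n -> 'M[R]_n) :
  skew_tr (fun Z => f (1%:M *m Z *m 1%:M)) = skew_tr f.
Proof.
by apply: eq_bigr => j _; apply: eq_bigr => k _; rewrite mulmx1 mul1mx.
Qed.

Section Basis.
Variables (d : nat) (b : d.-tuple 'M[R]_n).
Hypothesis bL : basis_of (Skew Phi) b.

Definition ad_tr (s : seq 'M[R]_n) : R :=
  \sum_i coord b i (foldr (@lie_bracket R n) b`_i s).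

(** The Killing form of the orthogonal Lie algebra. Its factor n - 2 is nonzero for odd n, so it
    yields the trace form itself. *)
Lemma ad_tr2 X Y : X \in Skew Phi -> Y \in Skew Phi ->
  ad_tr [:: X; Y] = (n%:R - 2) * \tr (X *m Y).
Proof.
move=> hX hY; rewrite /ad_tr /=.
rewrite (basis_trace (T := lie_bracket X \o lie_bracket Y) bL
  skew_proj_in skew_proj_id); last by move=> Z hZ /=; rewrite !lie_skew.
have t1 := skew_tr_ad X (f := id) (fun _ _ => erefl) skew_tr_word.
rewrite -[LHS]/(skew_tr (fun V => lie_bracket X (lie_bracket Y V))).
rewrite -skew_tr_triv [LHS](skew_tr_ad Y (linearB (lie_bracket X)) t1).
rewrite /ad_step /word_tr !(mulmx1, mul1mx).
rewrite !phi_invM !phi_inv1 (skewP _ hX) (skewP _ hY) !(mulmx1, mul1mx).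
rewrite !(mulmxN, mulNmx, opprK) !linearN /= mxtrace1.
by rewrite !(tr_skew hX, tr_skew hY) (mxtrace_mulC Y X); field.
Qed.

Lemma tr_rev3 X Y Z : X \in Skew Phi -> Y \in Skew Phi -> Z \in Skew Phi ->
  \tr (X *m Y *m Z) = - \tr (Z *m Y *m X).
Proof.
move=> hX hY hZ; rewrite -[LHS]tr_phi_inv !phi_invM.
rewrite (skewP _ hX) (skewP _ hY) (skewP _ hZ) !(mulmxN, mulNmx, opprK).
by rewrite linearN /= !mulmxA.
Qed.

Lemma tr_rev4 X Y Z W :
  X \in Skew Phi -> Y \in Skew Phi -> Z \in Skew Phi -> W \in Skew Phi ->
  \tr (X *m Y *m Z *m W) = \tr (W *m Z *m Y *m X).
Proof.
move=> hX hY hZ hW; rewrite -[LHS]tr_phi_inv !phi_invM.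
rewrite (skewP _ hX) (skewP _ hY) (skewP _ hZ) (skewP _ hW).
by rewrite !(mulmxN, mulNmx, opprK) !mulmxA.
Qed.

Lemma tr_cyc4 X Y Z W : \tr (X *m Y *m Z *m W) = \tr (Y *m Z *m W *m X).
Proof. by rewrite -!mulmxA mxtrace_mulC !mulmxA. Qed.

(** Applying [phi_inv] reverses a word and gives one sign per letter, so for three letters the words
    X Y Z and X Z Y have opposite traces. *)
Lemma tr_skew3 X Y Z : X \in Skew Phi -> Y \in Skew Phi -> Z \in Skew Phi ->
  2 * \tr (X *m Y *m Z) = \tr (X *m lie_bracket Y Z).
Proof.
move=> hX hY hZ; rewrite /lie_bracket mulmxBr linearB /= !mulmxA.
by rewrite (tr_rev3 hX hZ hY) (mxtrace_mulC (Y *m Z)) mulmxA; lra.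
Qed.

(* The factor n - 8 reflects triality; it does not vanish for odd n. *)
Lemma ad_tr4 X Y Z W :
  X \in Skew Phi -> Y \in Skew Phi -> Z \in Skew Phi -> W \in Skew Phi ->
  ad_tr [:: X; Y; Z; W] = (n%:R - 8) * \tr (X *m Y *m Z *m W)
    + 2 * \tr (X *m Y *m lie_bracket Z W)
    + 2 * \tr (X *m lie_bracket Y Z *m W)
    + \tr (X *m Y) * \tr (Z *m W) + \tr (X *m Z) * \tr (Y *m W)
    + \tr (X *m W) * \tr (Y *m Z).
Proof.
move=> hX hY hZ hW; rewrite /ad_tr /=.
rewrite (basis_trace
  (T := (lie_bracket X \o lie_bracket Y) \o (lie_bracket Z \o lie_bracket W))
  bL skew_proj_in skew_proj_id); last by move=> V hV /=; rewrite !lie_skew.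
have t1 := skew_tr_ad X (f := id) (fun _ _ => erefl) skew_tr_word.
have t2 := skew_tr_ad Y (linearB (lie_bracket X)) t1.
have fB : {morph lie_bracket X \o lie_bracket Y : U V / U - V}.
  by move=> U V /=; rewrite [lie_bracket Y _]linearB [LHS]linearB.
have t3 := skew_tr_ad Z fB t2.
have gB : {morph lie_bracket X \o lie_bracket Y \o lie_bracket Z : U V / U - V}.
  by move=> U V /=; rewrite [lie_bracket Z _]linearB [LHS]fB.
rewrite -[LHS]/(skew_tr (fun V => lie_bracket X (lie_bracket Y (lie_bracket Z
  (lie_bracket W V))))) -skew_tr_triv [LHS](skew_tr_ad W gB t3).
rewrite /ad_step /word_tr !(mulmx1, mul1mx).
rewrite !phi_invM !phi_inv1.
rewrite (skewP _ hX) (skewP _ hY) (skewP _ hZ) (skewP _ hW).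
have trN A : \tr (- A) = - \tr A by apply: raddfN.
have trB A B : \tr (A - B) = \tr A - \tr B by apply: raddfB.
rewrite !(mulmx1, mul1mx).
rewrite !(mulmxN, mulNmx) !trN !opprK mxtrace1.
rewrite !(tr_skew hX, tr_skew hY, tr_skew hZ, tr_skew hW).
rewrite /lie_bracket !(mulmxBr, mulmxBl).
rewrite !trB !mulmxA.
(* The 24 orders of four skew letters fall into three classes under rotation and reversal; XYZW,
   XYWZ and XZYW represent them. *)
have E0 : \tr (Y *m Z *m W *m X) = \tr (X *m Y *m Z *m W).
  by rewrite [LHS]tr_cyc4 [LHS]tr_cyc4 [LHS]tr_cyc4.
have E1 : \tr (X *m Z *m W *m Y) = \tr (X *m Y *m W *m Z).
  by rewrite [LHS]tr_cyc4 (tr_rev4 hZ hW hY hX).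
have E2 : \tr (Z *m W *m X *m Y) = \tr (X *m Y *m Z *m W).
  by rewrite [LHS]tr_cyc4 [LHS]tr_cyc4.
have E3 : \tr (Y *m W *m X *m Z) = \tr (X *m Z *m Y *m W).
  by rewrite [LHS]tr_cyc4 [LHS]tr_cyc4.
have E4 : \tr (X *m W *m Y *m Z) = \tr (X *m Z *m Y *m W).
  by rewrite [LHS]tr_cyc4 (tr_rev4 hW hY hZ hX).
have E5 : \tr (W *m X *m Y *m Z) = \tr (X *m Y *m Z *m W).
  by rewrite [LHS]tr_cyc4.
have E6 : \tr (Y *m Z *m X *m W) = \tr (X *m Z *m Y *m W).
  by rewrite [LHS]tr_cyc4 [LHS]tr_cyc4 [LHS]tr_cyc4 (tr_rev4 hW hY hZ hX).
have E7 : \tr (Z *m X *m Y *m W) = \tr (X *m Y *m W *m Z).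
  by rewrite [LHS]tr_cyc4.
have E8 : \tr (Y *m X *m Z *m W) = \tr (X *m Y *m W *m Z).
  by rewrite [LHS]tr_cyc4 [LHS]tr_cyc4 (tr_rev4 hZ hW hY hX).
have E9 : \tr (W *m Z *m Y *m X) = \tr (X *m Y *m Z *m W).
  by rewrite (tr_rev4 hW hZ hY hX).
rewrite E0 E1 E2 E3 E4 E5 E6 E7 E8 E9.
rewrite (mxtrace_mulC Y X) (mxtrace_mulC Z X) (mxtrace_mulC Z Y).
rewrite (mxtrace_mulC W X) (mxtrace_mulC W Y) (mxtrace_mulC W Z).
by field.
Qed.

End Basis.
End SkewTrace.
End Bracket.

(** * Products of skew matrices *)

Lemma mem_span_ind (K : fieldType) (vT : vectType K) (s : seq vT)
    (P : vT -> Prop) :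
  P 0 -> (forall a u v, P u -> P v -> P (a *: u + v)) ->
  {in s, forall v, P v} -> forall v, v \in <<s>>%VS -> P v.
Proof.
move=> P0 PD Ps v vs; rewrite (coord_span (X := in_tuple s) vs).
apply: big_ind => [|u w Pu Pw|i _]; rewrite ?P0 //.
  by rewrite -[u]scale1r; apply: PD.
by rewrite -[X in P X]addr0; apply: PD => //; apply: Ps; rewrite mem_nth.
Qed.

Lemma mul_mx_deltaE (R : fieldType) m n k (X : 'M[R]_(m,
  n)) (p : 'I_n) (q b : 'I_k) a :
  (X *m delta_mx p q) a b = X a p * (q == b)%:R.
Proof.
rewrite mxE (bigD1 p) //= big1 ?addr0 => [|l lp].
  by rewrite mxE eqxx /= eq_sym.
by rewrite mxE (negPf lp) mulr0.
Qed.

Lemma mul_delta_mxE (R : fieldType) m n k (X : 'M[R]_(m,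
  n)) (q : 'I_m) (p a : 'I_k) b :
  (delta_mx p q *m X) a b = (a == p)%:R * X q b.
Proof.
rewrite mxE (bigD1 q) //= big1 ?addr0 => [|l lq].
  by rewrite mxE eqxx andbT.
by rewrite mxE (negPf lq) andbF mul0r.
Qed.

Section Trace.
Variables (R : realFieldType) (n : nat).
Implicit Types (X Y Z : 'M[R]_n).

Lemma tr_mul_delta X i j : \tr (X *m delta_mx j i) = X i j.
Proof.
rewrite /mxtrace (bigD1 i) //= mxE (bigD1 j) //= mxE !eqxx mulr1.
rewrite big1 ?addr0 => [|k kj]; last by rewrite mxE (negPf kj) mulr0.
rewrite big1 ?addr0 // => k ki; rewrite mxE big1 // => l _.
by rewrite mxE (negPf ki) andbF mulr0.
Qed.

Lemma tr_mul_nondeg X : (forall Y, \tr (X *m Y) = 0) -> X = 0.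
Proof. by move=> h; apply/matrixP => i j; rewrite -tr_mul_delta h mxE. Qed.

(** An entry of Y minus its projection to U is a linear functional vanishing on U, and every
    functional is a trace pairing with some Z. A vector outside U would make such a Z nonzero. *)
Lemma tr_nondeg_full (U : {vspace 'M[R]_n}) :
  (forall Z, (forall Y, Y \in U -> \tr (Z *m Y) = 0) -> Z = 0) -> U = fullv.
Proof.
move=> h; apply/vspaceP => Y0; rewrite memvf; apply/negPn/negP => Y0U.
have w0 : Y0 - projv U Y0 != 0.
  by rewrite subr_eq0; apply: contraNneq Y0U => ->; apply: memv_proj.
have [a [c wac]] : exists a c, (Y0 - projv U Y0) a c != 0.
  by apply/matrix0Pn.
pose g := (\1 - projv U)%VF.
have gE Y : g Y = Y - projv U Y by rewrite !lfunE /= !lfunE.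
pose Z : 'M[R]_n := \matrix_(k, j) g (delta_mx j k) a c.
have ZE Y : \tr (Z *m Y) = g Y a c.
  rewrite {2}[Y]matrix_sum_delta linear_sum summxE mxtrace_mulC.
  apply: eq_bigr => j _; rewrite linear_sum summxE mxE.
  by apply: eq_bigr => k _; rewrite linearZ /= !mxE.
have Z0 : Z = 0.
  by apply: h => Y YU; rewrite ZE gE (projv_id YU) subrr mxE.
by move: (ZE Y0); rewrite Z0 mul0mx mxtrace0 gE => /esym/eqP; apply/negP.
Qed.

(** For skew letters every term on the right is a product of at most two skew matrices, since a word
    of three letters plus its reversal is skew ([skew_sum_rev]). *)
Lemma word3 X Y Z : 4 *: (X *m Y *m Z) = 2 *: (X *m lie_bracket Y Z)
  + (lie_bracket X Y *m Z + Y *m lie_bracket X Z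
    + (lie_bracket X Z *m Y + Z *m lie_bracket X Y))
  + ((X *m Y *m Z + Z *m Y *m X) + (X *m Z *m Y + Y *m Z *m X)).
Proof.
rewrite /lie_bracket !(mulmxBl, mulmxBr, mulmxA).
move: (X *m Y *m Z) (X *m Z *m Y) (Y *m X *m Z) (Y *m Z *m X)
  (Z *m X *m Y) (Z *m Y *m X) => a b c d e f.
by apply/matrixP => i j; rewrite !mxE; lra.
Qed.

Lemma central_scalar (C : 'M[R]_n) :
  (forall X, C *m X = X *m C) -> exists c, C = c%:M.
Proof.
case: n C => [C _|m C h]; first by exists 0; apply/matrixP; case.
exists (C 0 0); apply/matrixP => i j; rewrite mxE.
have e k l a b : C a k * (l == b)%:R = (a == k)%:R * C l b :> R.
  have := congr1 (fun M : 'M_ _ => M a b) (h (delta_mx k l)).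
  by cbv beta; rewrite mul_mx_deltaE mul_delta_mxE.
have := e j 0 i 0; rewrite eqxx mulr1 => ->.
by case: eqP => _; rewrite ?mul1r ?mul0r.
Qed.

End Trace.

Section SkewForm.
Variables (R : realFieldType) (n : nat) (Phi : 'M[R]_n).
Hypotheses (PhiT : Phi^T = Phi) (PhiU : Phi \in unitmx).
Implicit Types (X Y Z : 'M[R]_n).

(** The map [phi_inv] preserves traces and negates X, so X is orthogonal to the self-adjoint part of
    Z. *)
Lemma tr_skew_proj X Z :
  X \in Skew Phi -> \tr (X *m skew_proj Phi Z) = \tr (X *m Z).
Proof.
move=> /skewP hX; rewrite /skew_proj -scalemxAr linearZ mulmxBr linearB /=.
have -> : \tr (X *m phi_inv Phi Z) = - \tr (X *m Z).
  rewrite -(tr_phi_inv PhiU) phi_invM // phi_invK // hX mulmxN linearN /=.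
  by rewrite mxtrace_mulC.
lra.
Qed.

Lemma tr_skew_nondeg X : X \in Skew Phi ->
  (forall Y, Y \in Skew Phi -> \tr (X *m Y) = 0) -> X = 0.
Proof.
move=> hX h; apply: tr_mul_nondeg => Z.
by rewrite -(tr_skew_proj Z hX) h // skew_proj_in.
Qed.

Lemma skew_sum_rev X Y Z : X \in Skew Phi -> Y \in Skew Phi -> Z \in Skew Phi ->
  X *m Y *m Z + Z *m Y *m X \in Skew Phi.
Proof.
move=> /skewP hX /skewP hY /skewP hZ; apply/skewP; rewrite linearD /=.
rewrite !phi_invM // hX hY hZ !(mulmxN, mulNmx, opprK) opprD !mulmxA.
by rewrite addrC.
Qed.

Hypothesis n3 : (2 < n)%N.

(** The hypothesis makes each Z X orthogonal to the skew matrices, hence self-adjoint, and comparing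
    entries at three distinct indices kills Z. For n = 2 all products of two skew matrices are
    scalar and the conclusion fails. *)
Lemma skew_annihilator Z :
  (forall X Y, X \in Skew Phi -> Y \in Skew Phi -> \tr (Z *m X *m Y) = 0) ->
  Z = 0.
Proof.
move=> h.
have other (a c : 'I_n) : exists2 k, k != a & k != c.
  have : (#|[set a; c]| < #|'I_n|)%N.
    by rewrite card_ord (leq_ltn_trans _ n3) // cards2; case: (_ == _).
  move=> lt; have /subsetPn[k _ ] : ~~ ([set: 'I_n] \subset [set a; c]).
    by apply: contraL lt => /subset_leq_card; rewrite cardsT -leqNgt.
  by rewrite !inE negb_or => /andP[]; exists k.
(* In these coordinates X = Phi^-1 K is skew when K is antisymmetric, and [phi_inv Phi Z] is the
   transpose of N. *)
pose N := Phi *m Z *m invmx Phi.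
have NK (K : 'M[R]_n) : K^T = - K -> N *m K = - (K *m N^T).
  move=> KT; pose X := invmx Phi *m K.
  have hX : X \in Skew Phi.
    apply/skewP; rewrite /phi_inv trmx_mul trmx_inv PhiT KT.
    by rewrite mulmxA mulmxKV // mulmxN.
  have : skew_proj Phi (Z *m X) = 0.
    apply: (tr_skew_nondeg (skew_proj_in PhiT PhiU _)) => Y hY.
    by rewrite mxtrace_mulC tr_skew_proj // mxtrace_mulC h.
  move/eqP; rewrite /skew_proj scaler_eq0 invr_eq0 pnatr_eq0 /= subr_eq0.
  rewrite phi_invM // (skewP _ _ hX) mulNmx => /eqP ZX.
  rewrite /N -!mulmxA -/X ZX /X /phi_inv !trmx_mul trmx_inv PhiT.
  by rewrite mulmxN !mulmxA mulmxV // mul1mx.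
have Nent j k a b : N a j * (k == b)%:R - N a k * (j == b)%:R =
    - ((a == j)%:R * N b k - (a == k)%:R * N b j) :> R.
  have := NK (delta_mx j k - delta_mx k j).
  rewrite linearB /= !trmx_delta opprB => /(_ erefl).
  move/(congr1 (fun M : 'M_ _ => M a b)).
  cbv beta; rewrite mulmxBr mulmxBl.
  have eB (U V : 'M[R]_n) : (U - V) a b = U a b - V a b by rewrite !mxE.
  have eO (U : 'M[R]_n) : (- U) a b = - U a b by rewrite mxE.
  by rewrite eO !eB !mul_mx_deltaE !mul_delta_mxE !mxE.
have N0 : N = 0.
  have Nd (j k : 'I_n) : j != k -> N j j + N k k = 0.
    move=> jk; have := Nent j k j k; rewrite !eqxx (negPf jk) /=; lra.
  apply/matrixP => a c; rewrite [RHS]mxE; have [<-|ac] := eqVneq a c.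
    have [k ka _] := other a a; have [l la lk] := other a k.
    by have := Nd _ _ ka; have := Nd _ _ la; have := Nd _ _ lk; lra.
  have [k ka kc] := other a c; have := Nent c k a k.
  rewrite eqxx (negPf ac) eq_sym (negPf kc) eq_sym (negPf ka) /=; lra.
have : invmx Phi *m N *m Phi = Z.
  by rewrite /N !mulmxA mulVmx // mul1mx mulmxKV.
by rewrite N0 mulmx0 mul0mx.
Qed.

(** By [skew_annihilator] nothing nonzero is orthogonal to all products of two skew matrices, so
    these products span M_n and a linear property need only be checked on them. *)
Lemma skew_prod_ind (s : seq 'M[R]_n) (P : 'M[R]_n -> Prop) :
  <<s>>%VS = Skew Phi ->
  P 0 -> (forall a A B, P A -> P B -> P (a *: A + B)) ->
  (forall X Y, X \in s -> Y \in s -> P (X *m Y)) -> forall Z, P Z.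
Proof.
move=> sS P0 PD Ps Z.
apply: (@mem_span_ind _ _ [seq X *m Y | X <- s, Y <- s]) => // [V|].
  by move=> /allpairsP[[X Y] /= [hX hY ->]]; apply: Ps.
suff -> : <<[seq X *m Y | X <- s, Y <- s]>>%VS = fullv by rewrite memvf.
apply: tr_nondeg_full => V hV; apply: skew_annihilator => X Y; rewrite -sS.
have trl (f : {linear 'M[R]_n -> 'M[R]_n}) : forall a A B, \tr (f A) = 0 ->
    \tr (f B) = 0 -> \tr (f (a *: A + B)) = 0.
  by move=> a A B hA hB; rewrite !linearP /= hA hB mulr0 addr0.
move=> hX; move: Y; apply: mem_span_ind => [||Y hY].
- by rewrite mulmx0 mxtrace0.
- exact: (trl (mulmx (V *m X))).
move: X hX; apply: mem_span_ind => [||X hX].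
- by rewrite mulmx0 mul0mx mxtrace0.
- exact: (trl (mulmxr Y \o mulmx V)).
by rewrite -mulmxA hV //; apply: memv_span; apply/allpairsP; exists (X, Y).
Qed.

Lemma scalar_of_skew_comm C :
  (forall X, X \in Skew Phi -> C *m X = X *m C) -> exists c, C = c%:M.
Proof.
move=> h; apply: central_scalar.
apply: (@skew_prod_ind (vbasis (Skew Phi)));
  rewrite ?(span_basis (vbasisP _)) ?mulmx0 ?mul0mx //.
- by move=> a A B hA hB; rewrite mulmxDr mulmxDl -scalemxAr -scalemxAl hA hB.
- by move=> X Y /vbasis_mem hX /vbasis_mem hY; rewrite mulmxA h // -mulmxA h //
    mulmxA.
Qed.

End SkewForm.

(** * Isomorphisms of skew Lie algebras *)

Lemma lie_iso_cap_ker (R : fieldType) m n (L1 : {vspace 'M[R]_m})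
    (L2 : {vspace 'M[R]_n}) (psi : 'Hom('M[R]_m, 'M[R]_n)) :
  lie_iso L1 L2 psi -> (L1 :&: lker psi)%VS = 0%VS.
Proof.
case=> _ inj _; apply/eqP; rewrite -subv0; apply/subvP => X.
rewrite memv_cap memv_ker => /andP[XL /eqP X0]; rewrite memv0; apply/eqP.
by apply: inj; rewrite ?mem0v // linear0.
Qed.

(** Column k of A is F(E_k0) v, where v is chosen with F(E_00) v nonzero, so A intertwines the
    standard module with its twist by F. A nonzero vector killed by A could be moved by a matrix
    unit to a multiple of the first basis vector, whose image F(E_00) v is nonzero. *)
Lemma skolem_noether (R : fieldType) n (F : {linear 'M[R]_n -> 'M[R]_n}) :
  injective F -> (forall X Y, F (X *m Y) = F X *m F Y) ->
  exists2 A, A \in unitmx & forall X, F X *m A = A *m X.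
Proof.
case: n F => [|n] F Finj FM.
  by exists 1%:M; rewrite ?unitmx1 // => X; rewrite [RHS]flatmx0 [LHS]flatmx0.
have [i [j Fij]] : exists i j, F (delta_mx 0 0) i j != 0.
  apply/matrix0Pn; apply: contraTneq (oner_neq0 R) => F0.
  have /matrixP/(_ 0 0) : delta_mx 0 0 = 0 :> 'M[R]_n.+1.
    by apply: Finj; rewrite F0 linear0.
  by rewrite !mxE => /eqP; rewrite oner_eq0.
pose v : 'cV[R]_n.+1 := delta_mx j 0.
pose A : 'M[R]_n.+1 := \matrix_(a, k) (F (delta_mx k 0) *m v) a 0.
have AE X : F X *m A = A *m X.
  have colA k : col k A = F (delta_mx k 0) *m v.
    by apply/matrixP => a b; rewrite !mxE ord1; apply: eq_bigr => l _;
      rewrite !mxE.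
  apply/matrixP => a k.
  have -> : (F X *m A) a k = (F (X *m delta_mx k 0) *m v) a 0.
    by rewrite FM -mulmxA -colA !mxE; apply: eq_bigr => l _;
      rewrite [in RHS]mxE.
  have -> : X *m delta_mx k 0 = \sum_l X l k *: delta_mx l 0 :> 'M[R]_n.+1.
    apply/matrixP => p q; rewrite mul_mx_deltaE summxE (bigD1 p) //= big1.
      by rewrite !mxE eqxx addr0 /= eq_sym.
    by move=> l lp; rewrite !mxE eq_sym (negPf lp) mulr0.
  rewrite linear_sum mulmx_suml summxE mxE; apply: eq_bigr => l _.
  by rewrite linearZ -scalemxAl !mxE mulrC; congr (_ * _); rewrite ?mxE.
exists A => //; rewrite -unitmx_tr -row_free_unit -kermx_eq0.
apply: contraT => /rowV0Pn[w /sub_kermxP wA w0].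
have Aw : A *m w^T = 0 by rewrite -[A]trmxK -trmx_mul wA trmx0.
have /rV0Pn[k wk] := w0.
have /matrixP/(_ i 0) : A *m (delta_mx 0 k *m w^T) = 0.
  by rewrite mulmxA -AE -mulmxA Aw mulmx0.
have -> : delta_mx 0 k *m w^T = w 0 k *: delta_mx 0 0 :> 'cV[R]_n.+1.
  by apply/matrixP => p q; rewrite mul_delta_mxE !mxE ord1 mulrC andbT.
rewrite -scalemxAr -colE !mxE => /eqP; rewrite mulf_eq0 (negPf wk) /=.
have -> : \sum_j0 F (delta_mx 0 0) i j0 * v j0 0 = F (delta_mx 0 0) i j.
  rewrite (bigD1 j) //= big1 ?addr0 => [|l lj];
    first by rewrite mxE !eqxx mulr1.
  by rewrite mxE (negPf lj) mulr0.
by rewrite (negPf Fij).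
Qed.

Section Theta.
Variables (R : fieldType) (n d : nat) (b : d.-tuple 'M[R]_n).

(** Coordinates of Z through its pairing with products of two basis elements; [pair_tr_inj] shows
    that they determine Z. *)
Definition pair_tr Z : 'M[R]_d := \matrix_(i, j) \tr (Z *m b`_i *m b`_j).

Lemma pair_tr_is_linear : linear pair_tr.
Proof.
move=> a Y Z; apply/matrixP => i j; rewrite !mxE.
by rewrite !mulmxDl -!scalemxAl linearP.
Qed.

HB.instance Definition _ :=
  GRing.isLinear.Build R 'M[R]_n 'M[R]_d *:%R pair_tr pair_tr_is_linear.
End Theta.

Lemma pair_tr_inj (R : realFieldType) n (Phi : 'M[R]_n) d
    (b : d.-tuple 'M[R]_n) :
  Phi^T = Phi -> Phi \in unitmx -> (2 < n)%N ->
  <<b>>%VS = Skew Phi -> injective (pair_tr b).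
Proof.
move=> PhiT PhiU n3 bS Y Z YZ; apply/eqP; rewrite -subr_eq0; apply/eqP.
apply: (skew_annihilator PhiT PhiU n3) => U V hU.
have key i j : \tr ((Y - Z) *m b`_i *m b`_j) = 0.
  case: (ltnP i d) => id; last by rewrite nth_default ?size_tuple //
    mulmx0 mul0mx mxtrace0.
  case: (ltnP j d) => jd; last by rewrite (nth_default _ (s := b) (n :=
    j)) ?size_tuple // mulmx0 mxtrace0.
  have /matrixP/(_ (Ordinal id) (Ordinal jd)) : pair_tr b (Y - Z) = 0.
    by rewrite linearB /= YZ subrr.
  by rewrite !mxE.
have trl (f : {linear 'M[R]_n -> 'M[R]_n}) : forall a A B, \tr (f A) = 0 ->
    \tr (f B) = 0 -> \tr (f (a *: A + B)) = 0.
  by move=> a A B hA hB; rewrite !linearP /= hA hB mulr0 addr0.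
rewrite -bS in hU *; move: V; apply: mem_span_ind => [||V hV].
- by rewrite mulmx0 mxtrace0.
- exact: (trl (mulmx ((Y - Z) *m U))).
move: U hU; apply: mem_span_ind => [||U hU].
- by rewrite mulmx0 mul0mx mxtrace0.
- exact: (trl (mulmxr V \o mulmx (Y - Z))).
by rewrite -(nth_index 0 hU) -(nth_index 0 hV).
Qed.

Section Iso.
Variables (R : realFieldType) (n : nat) (P1 P2 : 'M[R]_n).
Hypotheses (P1T : P1^T = P1) (P1U : P1 \in unitmx).
Hypotheses (P2T : P2^T = P2) (P2U : P2 \in unitmx).
Hypotheses (n3 : (2 < n)%N) (nodd : odd n).
Variable f : 'Hom('M[R]_n, 'M[R]_n).
Hypothesis fiso : lie_iso (Skew P1) (Skew P2) f.
Implicit Types X Y Z W U V : 'M[R]_n.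

Let b := vbasis (Skew P1).
Let fb := [tuple of map f b].

Let bP : basis_of (Skew P1) b := vbasisP _.
Let fbP : basis_of (Skew P2) fb.
Proof.
by case: (fiso) => <- _ _; apply: limg_basis_of bP; apply: lie_iso_cap_ker fiso.
Qed.

Let b_in i : b`_i \in Skew P1.
Proof.
have [h|h] := ltnP i (size b); first by rewrite vbasis_mem ?mem_nth.
by rewrite nth_default // mem0v.
Qed.

Let f_in X : X \in Skew P1 -> f X \in Skew P2.
Proof. by case: fiso => <- _ _ hX; apply: memv_img. Qed.

Let f_lie X Y : X \in Skew P1 -> Y \in Skew P1 ->
  f (lie_bracket X Y) = lie_bracket (f X) (f Y).
Proof. by case: fiso => _ _; apply. Qed.

Let fbE (i : 'I_(\dim (Skew P1))) : fb`_i = f b`_i.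
Proof. by rewrite (nth_map 0) ?size_tuple. Qed.

(** The image f Y has the same coordinates in [fb] as Y has in b, and f commutes with iterated
    brackets. *)
Let ad_tr_iso s : {subset s <= Skew P1} -> ad_tr fb (map f s) = ad_tr b s.
Proof.
move=> sS; apply: eq_bigr => i _; rewrite fbE.
have [-> h] : foldr (@lie_bracket R n) (f b`_i) (map f s)
    = f (foldr (@lie_bracket R n) b`_i s)
    /\ foldr (@lie_bracket R n) b`_i s \in Skew P1.
  elim: s sS => [|X s IH] sS //=.
  have [|-> h] := IH; first by move=> Y hY; apply: sS; rewrite inE hY orbT.
  have XS : X \in Skew P1 by apply: sS; rewrite inE eqxx.
  by rewrite f_lie // lie_skew.
move: (foldr _ _ _) h => X hX; rewrite {1}(coord_basis bP hX) linear_sum.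
under eq_bigr do rewrite linearZ /= -fbE.
by rewrite coord_sum_free // (basis_free fbP).
Qed.

Let seq_in s : all (mem (Skew P1)) s -> {subset s <= Skew P1}.
Proof. by move/allP. Qed.

Lemma iso_tr2 X Y : X \in Skew P1 -> Y \in Skew P1 ->
  \tr (f X *m f Y) = \tr (X *m Y).
Proof.
move=> hX hY; have n2 : n%:R - 2 != 0 :> R.
  by rewrite subr_eq0 eqr_nat; apply/eqP => n2; move: nodd; rewrite n2.
apply: (mulfI n2); rewrite -(ad_tr2 P2T P2U fbP) ?f_in //.
rewrite -(ad_tr2 P1T P1U bP) // -[RHS]ad_tr_iso //.
by apply: seq_in; rewrite /= hX hY.
Qed.

Lemma iso_tr3 X Y Z : X \in Skew P1 -> Y \in Skew P1 -> Z \in Skew P1 ->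
  \tr (f X *m f Y *m f Z) = \tr (X *m Y *m Z).
Proof.
move=> hX hY hZ; have n2 : 2 != 0 :> R by rewrite pnatr_eq0.
apply: (mulfI n2); rewrite (tr_skew3 P2U) ?f_in // -f_lie //.
by rewrite iso_tr2 ?lie_skew // (tr_skew3 P1U).
Qed.

Lemma iso_tr4 X Y Z W : X \in Skew P1 -> Y \in Skew P1 -> Z \in Skew P1 ->
  W \in Skew P1 ->
  \tr (f X *m f Y *m f Z *m f W) = \tr (X *m Y *m Z *m W).
Proof.
move=> hX hY hZ hW; have n8 : n%:R - 8 != 0 :> R.
  by rewrite subr_eq0 eqr_nat; apply/eqP => n8; move: nodd; rewrite n8.
apply: (mulfI n8).
have := ad_tr4 P2T P2U fbP (f_in hX) (f_in hY) (f_in hZ) (f_in hW).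
have := ad_tr4 P1T P1U bP hX hY hZ hW.
rewrite -(ad_tr_iso (s := [:: X; Y; Z; W])) /=; last first.
  by apply: seq_in; rewrite /= hX hY hZ hW.
by move=> ->; rewrite -!f_lie // !iso_tr3 ?iso_tr2 ?lie_skew //; lra.
Qed.

(** Both sides are skew for P2, so it is enough to pair them with the images f W, where only
    four-letter traces occur. *)
Lemma iso_sum_rev X Y Z : X \in Skew P1 -> Y \in Skew P1 -> Z \in Skew P1 ->
  f (X *m Y *m Z + Z *m Y *m X) = f X *m f Y *m f Z + f Z *m f Y *m f X.
Proof.
move=> hX hY hZ; apply/eqP; rewrite -subr_eq0; apply/eqP.
have hT := skew_sum_rev P1U hX hY hZ.
apply: (tr_skew_nondeg P2T P2U).
  by rewrite memvB ?f_in ?skew_sum_rev ?f_in.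
case: (fiso) => <- _ _ _ /memv_imgP[W hW ->].
rewrite mulmxBl linearB /= iso_tr2 // !mulmxDl !linearD /= !iso_tr4 //; lra.
Qed.

(** The first three letters are rewritten by [word3]; f respects each resulting skew letter by
    [f_lie] and [iso_sum_rev], so traces of three and four letters suffice. *)
Lemma iso_tr5 X Y Z U V : X \in Skew P1 -> Y \in Skew P1 -> Z \in Skew P1 ->
  U \in Skew P1 -> V \in Skew P1 ->
  \tr (f X *m f Y *m f Z *m f U *m f V) = \tr (X *m Y *m Z *m U *m V).
Proof.
move=> hX hY hZ hU hV; have n4 : 4 != 0 :> R by rewrite pnatr_eq0.
have mulZ (a : R) (A B : 'M[R]_n) : a * \tr (A *m B) = \tr ((a *: A) *m B).
  by rewrite -scalemxAl linearZ.
apply: (mulfI n4); rewrite -![_ *m _ *m f V]mulmxA -![_ *m _ *m V]mulmxA.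
rewrite !mulZ !word3 -!f_lie // -!iso_sum_rev //.
move: (skew_sum_rev P1U hX hY hZ) (skew_sum_rev P1U hX hZ hY).
move: (lie_skew P1U hY hZ) (lie_skew P1U hX hY) (lie_skew P1U hX hZ).
move: (lie_bracket Y Z) (lie_bracket X Y) (lie_bracket X Z) => A B C hA hB hC.
move: (X *m Y *m Z + _) (X *m Z *m Y + _) => T S hT hS.
rewrite !mulmxDl -!scalemxAl !mxtraceD !mxtraceZ !mulmxA.
by rewrite !iso_tr4 ?iso_tr3.
Qed.

(* The extension of f to all matrices, read off from the pairing of X with
   products of two basis elements. *)
Definition iso_ext : 'End('M[R]_n) :=
  ((linfun (pair_tr fb))^-1 \o linfun (pair_tr b))%VF.

Lemma pair_tr_ext X T : pair_tr fb T = pair_tr b X -> iso_ext X = T.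
Proof.
move=> XT; rewrite /iso_ext lfunE /= lfunE /= -XT -[pair_tr fb T]lfunE.
rewrite lker0_lfunK //; apply/lker0P => Y Z; rewrite !lfunE /=.
by apply: (pair_tr_inj P2T P2U n3); rewrite (span_basis fbP).
Qed.

Lemma iso_ext2 X Y : X \in Skew P1 -> Y \in Skew P1 ->
  iso_ext (X *m Y) = f X *m f Y.
Proof.
move=> hX hY; apply: pair_tr_ext; apply/matrixP => i j.
by rewrite !mxE !fbE iso_tr4.
Qed.

Lemma iso_ext1 X : X \in Skew P1 -> iso_ext X = f X.
Proof.
move=> hX; apply: pair_tr_ext; apply/matrixP => i j.
by rewrite !mxE !fbE iso_tr3.
Qed.

Lemma iso_ext3 X Y Z : X \in Skew P1 -> Y \in Skew P1 -> Z \in Skew P1 ->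
  iso_ext (X *m Y *m Z) = f X *m f Y *m f Z.
Proof.
move=> hX hY hZ; apply: pair_tr_ext; apply/matrixP => i j.
by rewrite !mxE !fbE iso_tr5.
Qed.

Let b_span : <<b>>%VS = Skew P1 := span_basis bP.

(** Left multiplication by a single skew matrix is checked on products of two, where words of length
    three suffice. An arbitrary left factor is a combination of products of two skew matrices, so
    this applies twice. *)
Lemma iso_extM : {morph iso_ext : X Y / X *m Y}.
Proof.
have extMl X Z : X \in Skew P1 -> iso_ext (X *m Z) = f X *m iso_ext Z.
  move=> hX; move: Z; apply: (skew_prod_ind P1T P1U n3 b_span).
  - by rewrite mulmx0 linear0 mulmx0.
  - move=> a A B hA hB; rewrite mulmxDr -scalemxAr !linearP /= hA hB.
    by rewrite ?mulmxDr -?scalemxAr.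
  move=> Y Z /vbasis_mem hY /vbasis_mem hZ.
  by rewrite (iso_ext2 hY hZ) !mulmxA iso_ext3.
move=> Z W; move: Z; apply: (skew_prod_ind P1T P1U n3 b_span).
- by rewrite mul0mx !linear0 mul0mx.
- move=> a A B hA hB; rewrite mulmxDl -scalemxAl !linearP /= hA hB.
  by rewrite ?mulmxDl -?scalemxAl.
move=> X Y /vbasis_mem hX /vbasis_mem hY.
by rewrite -mulmxA !extMl // (iso_ext1 hY) mulmxA.
Qed.

Lemma iso_ext_inj : injective iso_ext.
Proof.
have pE X : pair_tr fb (iso_ext X) = pair_tr b X.
  move: X; apply: (skew_prod_ind P1T P1U n3 b_span).
  - by rewrite !linear0.
  - by move=> a A B hA hB; rewrite !linearP /= hA hB.
  move=> X Y /vbasis_mem hX /vbasis_mem hY; rewrite iso_ext2 //.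
  by apply/matrixP => i j; rewrite !mxE !fbE iso_tr4.
move=> X Y XY; apply: (pair_tr_inj P1T P1U n3 b_span).
by rewrite -!pE XY.
Qed.

(** By Skolem-Noether f is conjugation by A. All of [Skew P1] is skew for the pulled back form N =
    A^T P2 A as well, so P1^-1 N commutes with [Skew P1] and is a scalar. *)
Lemma skew_iso_conj : exists A c, [/\ A \in unitmx, c != 0,
  A^T *m P2 *m A = c *: P1 &
  forall X, X \in Skew P1 -> f X = A *m X *m invmx A].
Proof.
have [A AU AE] := skolem_noether iso_ext_inj iso_extM.
have fE X : X \in Skew P1 -> f X = A *m X *m invmx A.
  by move=> hX; rewrite -AE mulmxK //; apply/esym/iso_ext1.
have [N NE] : exists N, N = A^T *m P2 *m A by eexists.
have NU : N \in unitmx by rewrite NE !unitmx_mul unitmx_tr AU P2U.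
have skewE (P X : 'M[R]_n) : P \in unitmx -> X \in Skew P ->
  X^T *m P = - (P *m X).
  move=> PU /skewP; rewrite /phi_inv -mulmxA => /(congr1 (mulmx P)).
  by rewrite mulKVmx // mulmxN.
have NX X : X \in Skew P1 -> X^T *m N = - (N *m X).
  move=> hX; have := skewE _ _ P2U (f_in hX); rewrite fE //.
  rewrite !trmx_mul trmx_inv => /(congr1 (fun Y => A^T *m Y *m A)).
  rewrite !mulmxA mulmxV ?unitmx_tr // mul1mx NE !mulmxA => ->.
  by rewrite mulmxN mulNmx !mulmxA mulmxKV.
have [c Nc] : exists c, invmx P1 *m N = c%:M.
  apply: (scalar_of_skew_comm P1T P1U n3) => X hX.
  apply: (can_inj (mulKmx P1U)); rewrite !mulmxA mulmxV // mul1mx.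
  have -> : P1 *m X = - (X^T *m P1) by rewrite skewE // opprK.
  by rewrite !mulNmx mulmxK // NX // opprK.
exists A, c; split=> //.
  apply/eqP => c0; have i : 'I_n by exists 0; lia.
  have N0 : N = 0 by rewrite -[N](mulKVmx P1U) Nc c0 mul_mx_scalar scale0r.
  have /matrixP/(_ i i) := mulVmx NU; rewrite {2}N0 mulmx0 !mxE eqxx.
  by move/eqP; rewrite eq_sym oner_eq0.
by rewrite -NE -[N](mulKVmx P1U) Nc mul_mx_scalar.
Qed.

End Iso.

(** * Gradings of skew Lie algebras *)

Section Families.
Variables (K : fieldType) (vT : vectType K) (G : choiceType).
Implicit Types (V : G -> {vspace vT}) (U : {vspace vT}).

Definition fam_direct V := forall (s : seq G) (f : G -> vT), uniq s ->
  (forall g, f g \in V g) -> \sum_(g <- s) f g = 0 -> {in s, forall g, f g = 0}.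

Definition fam_covers V U :=
  {in U, forall X, exists s : seq G, X \in (\sum_(g <- s) V g)%VS}.

Lemma mem_fam_sum V s X : uniq s -> X \in (\sum_(g <- s) V g)%VS ->
  exists2 f : G -> vT, forall g, f g \in V g & X = \sum_(g <- s) f g.
Proof.
elim: s X => [|h s IH] X /=.
  rewrite big_nil memv0 => _ /eqP ->; exists (fun=> 0); rewrite ?big_nil //.
  by move=> g; rewrite mem0v.
case/andP=> hs us; rewrite big_cons => /memv_addP[x hx [y hy ->]].
have [f fV ->] := IH y us hy.
exists (fun g => if g == h then x else f g).
  by move=> g; case: eqP => [->|].
rewrite big_cons eqxx; congr (_ + _); apply: eq_big_seq => g gs.
by case: eqP => // gh; rewrite gh (negPf hs) in gs.
Qed.

Lemma sub_fam_sum V s1 s2 : {subset s1 <= s2} ->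
  (\sum_(g <- s1) V g <= \sum_(g <- s2) V g)%VS.
Proof.
move=> s12; elim: s1 s12 => [|h s IH] s12; first by rewrite big_nil sub0v.
rewrite big_cons subv_add IH ?andbT; last first.
  by move=> g gs; apply: s12; rewrite inE gs orbT.
have : h \in s2 by apply: s12; rewrite inE eqxx.
elim: (s2) => // k t IHt; rewrite inE big_cons => /predU1P[->|/IHt ht].
  exact: addvSl.
exact: subv_trans ht (addvSr _ _).
Qed.

Lemma covers_ind V U (P : vT -> Prop) :
  fam_covers V U -> P 0 -> (forall u v, P u -> P v -> P (u + v)) ->
  (forall g X, X \in V g -> P X) -> forall X, X \in U -> P X.
Proof.
move=> cov P0 PD PV X /cov[s].
elim: s X => [|g s IH] X; first by rewrite big_nil memv0 => /eqP ->.
by rewrite big_cons => /memv_addP[x hx [y hy ->]]; apply: PD; eauto.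
Qed.

Lemma fam_sum_covers V U (P : seq vT) :
  <<P>>%VS = U -> {in P, forall X, exists g, X \in V g} -> fam_covers V U.
Proof.
move=> <- PV; apply: mem_span_ind => [||Y /PV[g Yg]].
- by exists [::]; rewrite mem0v.
- move=> a u v [s us] [t vt]; exists (s ++ t); rewrite big_cat /=.
  by rewrite memv_add ?memvZ.
by exists [:: g]; rewrite big_seq1.
Qed.

(** An expansion of X through V' is also one through V, and directness of V leaves only its term of
    degree g, which lies in V'. *)
Lemma fam_eq V V' U : (forall g, V' g <= V g)%VS -> fam_covers V' U ->
  fam_direct V -> forall g X, X \in U -> X \in V g -> X \in V' g.
Proof.
move=> V'V cov dir h X XU Xh; have [s Xs] := cov _ XU.
have us : uniq (undup (h :: s)) := undup_uniq _.
have hs : h \in undup (h :: s) by rewrite mem_undup inE eqxx.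
have : X \in (\sum_(g <- undup (h :: s)) V' g)%VS.
  apply: (subvP (sub_fam_sum _ _)) Xs => g gs.
  by rewrite mem_undup inE gs orbT.
case/(mem_fam_sum us) => f fV' XE.
pose f' g := f g - (if g == h then X else 0).
suff : f' h = 0 by rewrite /f' eqxx => /eqP; rewrite subr_eq0 => /eqP <-;
  apply: fV'.
apply: (dir _ f' us) hs => [g|].
  rewrite /f' memvB ?(subvP (V'V g) _ (fV' g)) //.
  by have [->|_] := eqVneq g h; rewrite ?mem0v.
rewrite sumrB -XE (bigD1_seq h) ?mem_undup ?inE ?eqxx //= big1 ?addr0 ?subrr //.
by move=> g /negPf ->.
Qed.

Lemma free_span_sub (s : seq vT) :
  exists t : seq vT, [/\ {subset t <= s}, free t & <<t>>%VS = <<s>>%VS].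
Proof.
elim: s => [|x s [t [ts tf tS]]]; first by exists [::]; rewrite nil_free.
have [xt|xt] := boolP (x \in <<t>>%VS).
  exists t; split=> //; first by move=> y /ts; rewrite inE orbC => ->.
  by rewrite span_cons -tS; apply/esym/addv_idPr; rewrite -memvE.
exists (x :: t); split; last by rewrite !span_cons tS.
  by move=> y; rewrite !inE => /predU1P[->|/ts ->]; rewrite ?eqxx ?orbT.
by rewrite free_cons xt tf.
Qed.

Lemma hom_basis V U : fam_covers V U -> (forall g, V g <= U)%VS ->
  exists (b : (\dim U).-tuple vT) (d : 'I_(\dim U) -> G),
    basis_of U b /\ forall i : 'I_(\dim U), b`_i \in V (d i).
Proof.
move=> cov VU.
have [s [sU sV]] : exists s : seq vT,
    <<s>>%VS = U /\ {in s, forall X, exists g, X \in V g}.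
  have : forall t : seq vT, {subset t <= U} -> exists s : seq vT,
      [/\ {subset t <= <<s>>%VS}, (<<s>> <= U)%VS
        & {in s, forall X, exists g, X \in V g}].
    elim=> [|x t IH] tU; first by exists [::]; rewrite span_nil sub0v.
    have [|s [ts sU sV]] := IH; first by move=> y yt; apply: tU;
      rewrite inE yt orbT.
    have [r] : exists r : seq G, x \in (\sum_(g <- r) V g)%VS.
      by apply: cov; apply: tU; rewrite inE eqxx.
    move=> xr; have [f fV xE] := mem_fam_sum (undup_uniq r)
      (subvP (sub_fam_sum V (s2 := undup r) (fun g =>
        etrans (mem_undup r g))) _ xr).
    exists (map f (undup r) ++ s); split.
    - move=> y; rewrite inE span_cat => /predU1P[->|/ts ys].
        rewrite (subvP (addvSl _ _)) // xE big_seq rpred_sum // => g gr.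
        by rewrite memv_span ?map_f.
      exact: (subvP (addvSr _ _)).
    - rewrite span_cat subv_add sU andbT; apply/span_subvP => y /mapP[g _ ->].
      exact: (subvP (VU g)).
    - move=> y; rewrite mem_cat => /orP[/mapP[g _ ->]|/sV //].
      by exists g.
  case/(_ (vbasis U)) => [x|s [bs sU sV]]; first exact: vbasis_mem.
  exists s; split=> //; apply/eqP; rewrite eqEsubv sU /=.
  by rewrite -{1}(span_basis (vbasisP U)); apply/span_subvP.
have [t [ts tf tS]] := free_span_sub s.
have tU : basis_of U t by rewrite basisEfree tf tS sU subvv -sU -tS dim_span.
have st : size t == \dim U by rewrite -sU -tS; move: tf; rewrite /free eq_sym.
have /fin_all_exists[d dP] :
    forall i : 'I_(\dim U), exists g, (Tuple st)`_i \in V g.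
  by move=> i; apply: sV; apply: ts; rewrite mem_nth //= (eqP st).
by exists (Tuple st), d.
Qed.
End Families.

Section GradedSkew.
Variables (R : realFieldType) (G : groupType).
Hypothesis Gcomm : forall x y : G, (x * y)%g = (y * x)%g.
Variables (n : nat) (Phi : 'M[R]_n).
Hypotheses (PhiT : Phi^T = Phi) (PhiU : Phi \in unitmx).
Hypotheses (n3 : (2 < n)%N) (nodd : odd n).
Variable Gam : G -> {vspace 'M[R]_n}.
Hypothesis gr : is_grading (Skew Phi) Gam.
Implicit Types X Y Z U V W : 'M[R]_n.

Let Gam_in g X : X \in Gam g -> X \in Skew Phi.
Proof. by case: gr => h _ _ _; apply/subvP/h. Qed.

Let Gam_cov : fam_covers Gam (Skew Phi). Proof. by case: gr. Qed.
Let Gam_dir : fam_direct Gam. Proof. by case: gr. Qed.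
Let Gam_lie g h X Y : X \in Gam g -> Y \in Gam h ->
  lie_bracket X Y \in Gam (g * h)%g.
Proof. by case: gr => _ _ _; apply. Qed.

Lemma graded_Skew_basis :
  exists (b : (\dim (Skew Phi)).-tuple 'M[R]_n) (d : 'I_(\dim (Skew Phi)) -> G),
    basis_of (Skew Phi) b /\ forall i : 'I_(\dim (Skew Phi)),
      b`_i \in Gam (d i).
Proof. by case: gr => h _ _ _; apply: hom_basis. Qed.

Section Basis.
Variables (b : (\dim (Skew Phi)).-tuple 'M[R]_n).
Variables (d : 'I_(\dim (Skew Phi)) -> G).
Hypotheses (bP : basis_of (Skew Phi) b).
Hypothesis bG : forall i : 'I_(\dim (Skew Phi)), b`_i \in Gam (d i).

Let b_in (i : 'I_(\dim (Skew Phi))) : b`_i \in Skew Phi := Gam_in (bG i).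

(** The lines through the basis vectors, grouped by degree, form a covering family inside [Gam], so
    by [fam_eq] they exhaust it. *)
Lemma graded_coord g X (i : 'I_(\dim (Skew Phi))) : X \in Gam g -> d i != g ->
  coord b i X = 0.
Proof.
move=> Xg dig; pose V' h := (\sum_(j | d j == h) <[b`_j]>)%VS.
have : X \in V' g.
  apply: (fam_eq (U := Skew Phi) (V := Gam)) => //; last exact: Gam_in Xg.
    move=> h; apply/subv_sumP => j /eqP <-; rewrite -memvE; exact: bG.
  apply: (fam_sum_covers (span_basis bP)) => _ /(nthP 0)[j jd <-].
  rewrite size_tuple in jd; exists (d (Ordinal jd)).
  by rewrite memvE (sumv_sup (Ordinal jd)).
case/memv_sumP => f fV ->; rewrite linear_sum big1 // => j /eqP dj.
have /vlineP[k ->] : f j \in <[b`_j]>%VS by apply: fV; rewrite dj.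
rewrite linearZ /= coord_free ?(basis_free bP) //.
suff -> : (j == i) = false by rewrite mulr0.
by apply: contraNF dig => /eqP <-; rewrite dj.
Qed.

(** The word acts with degree g other than 1, so it moves every basis vector to another degree and
    has zero diagonal. *)
Let ad_tr0 s (g : G) : (g != 1)%g ->
  (forall i : 'I_(\dim (Skew Phi)), foldr (@lie_bracket R n) b`_i s \in Gam (g *
    d i)%g) ->
  ad_tr b s = 0.
Proof.
move=> g1 h; apply: big1 => i _; apply: graded_coord (h i) _.
by rewrite eq_sym -[X in _ != X]mul1g (can_eq (mulgK _)).
Qed.

Lemma graded_tr2 g h X Y : X \in Gam g -> Y \in Gam h ->
  (g * h != 1)%g -> \tr (X *m Y) = 0.
Proof.
move=> hX hY gh; have n2 : n%:R - 2 != 0 :> R.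
  by rewrite subr_eq0 eqr_nat; apply/eqP => n2; move: nodd; rewrite n2.
apply: (mulfI n2); rewrite -(ad_tr2 PhiT PhiU bP) ?(Gam_in hX) ?(Gam_in hY) //.
by rewrite mulr0; apply: ad_tr0 gh _ => i /=; rewrite -mulgA !Gam_lie.
Qed.

Lemma graded_tr3 g h k X Y Z : X \in Gam g -> Y \in Gam h -> Z \in Gam k ->
  (g * h * k != 1)%g -> \tr (X *m Y *m Z) = 0.
Proof.
move=> hX hY hZ ghk; have n2 : 2 != 0 :> R by rewrite pnatr_eq0.
apply: (mulfI n2); rewrite (tr_skew3 PhiU) ?(Gam_in hX) ?(Gam_in hY,
  Gam_in hZ) //.
by rewrite mulr0; apply: graded_tr2 hX (Gam_lie hY hZ) _; rewrite mulgA.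
Qed.

Lemma graded_tr4 g h k l X Y Z W :
  X \in Gam g -> Y \in Gam h -> Z \in Gam k -> W \in Gam l ->
  (g * h * k * l != 1)%g -> \tr (X *m Y *m Z *m W) = 0.
Proof.
move=> hX hY hZ hW ghkl; have n8 : n%:R - 8 != 0 :> R.
  by rewrite subr_eq0 eqr_nat; apply/eqP => n8; move: nodd; rewrite n8.
apply: (mulfI n8).
have := ad_tr4 PhiT PhiU bP (Gam_in hX) (Gam_in hY) (Gam_in hZ) (Gam_in hW).
rewrite (ad_tr0 ghkl) => [|i]; last by rewrite /= -!mulgA !Gam_lie.
rewrite (graded_tr3 hX hY (Gam_lie hZ hW)) ?mulgA //.
rewrite (graded_tr3 hX (Gam_lie hY hZ) hW) ?mulgA //.
(* For products of two traces: if the degrees x and y of the two pairs have product other than 1,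
   then one of them differs from 1. *)
have prod0 (x y : G) (a c : R) : (x * y != 1)%g -> ((x != 1)%g -> a = 0) ->
    ((y != 1)%g -> c = 0) -> a * c = 0.
  move=> xy ha hc; have [x1|/ha ->] := eqVneq x 1%g; last by rewrite mul0r.
  by rewrite hc ?mulr0 //; rewrite x1 mul1g in xy.
rewrite (prod0 (g * h)%g (k * l)%g _ _ _ (graded_tr2 hX hY) (graded_tr2 hZ hW));
  last by rewrite mulgA.
rewrite (prod0 (g * k)%g (h * l)%g _ _ _ (graded_tr2 hX hZ) (graded_tr2 hY hW));
  last by rewrite mulgA -(mulgA g) (Gcomm k) mulgA.
rewrite (prod0 (g * l)%g (h * k)%g _ _ _ (graded_tr2 hX hW) (graded_tr2 hY hZ));
  last by rewrite -mulgA (Gcomm l) !mulgA.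
by move=> e; rewrite mulr0; lra.
Qed.

(** The trace form pairs degree h only with degree h^-1. A component of X of degree h other than g
    is therefore orthogonal to every basis vector, hence zero. *)
Lemma graded_dual g X : X \in Skew Phi ->
  (forall i : 'I_(\dim (Skew Phi)), (g * d i != 1)%g -> \tr (X *m b`_i) = 0) ->
  X \in Gam g.
Proof.
move=> hX Xb; pose Xc h := \sum_(i | d i == h) coord b i X *: b`_i.
have XcG h : Xc h \in Gam h.
  by apply: rpred_sum => i /eqP <-; apply: rpredZ; apply: bG.
have Xc0 h : h != g -> Xc h = 0.
  move=> hg; apply: (tr_skew_nondeg PhiT PhiU); first exact: Gam_in (XcG h).
  rewrite -(span_basis bP); apply: mem_span_ind => [||_ /(nthP 0)[i + <-]].
  - by rewrite mulmx0 mxtrace0.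
  - by move=> a A B hA hB; rewrite mulmxDr -scalemxAr linearP /= hA hB mulr0
      addr0.
  rewrite size_tuple => id; pose j := Ordinal id; rewrite -[i]/(nat_of_ord j).
  have [hj|hj] := eqVneq (h * d j)%g 1%g; last exact: graded_tr2 (XcG h) (bG j)
    hj.
  have hE i0 : (d i0 == h) = (d i0 * d j == 1)%g.
    by rewrite -hj (can_eq (mulgK _)).
  rewrite -[RHS](Xb j); last by rewrite -hj (can_eq (mulgK _)) eq_sym.
  rewrite [in RHS](coord_basis bP hX) !mulmx_suml !linear_sum /=.
  rewrite [RHS](bigID (fun i0 => d i0 == h)) /= [X in _ = _ + X]big1 ?addr0 //.
  move=> k; rewrite hE => dk; rewrite -scalemxAl linearZ /=.
  by rewrite (graded_tr2 (bG k) (bG j) dk) mulr0.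
suff -> : X = Xc g by [].
rewrite {1}(coord_basis bP hX) (bigID (fun i => d i == g)) /=.
rewrite [X in _ + X]big1 ?addr0 // => i dig.
have : coord b i (Xc (d i)) = coord b i X.
  rewrite linear_sum (bigD1 i) //= linearZ /= coord_free ?(basis_free bP) //.
  rewrite eqxx mulr1 big1 ?addr0 // => j /andP[_ ji].
  by rewrite linearZ /= coord_free ?(basis_free bP) // (negPf ji) mulr0.
by rewrite Xc0 // linear0 => <-; rewrite scale0r.
Qed.

Lemma graded_sum_rev g h k X Y Z : X \in Gam g -> Y \in Gam h -> Z \in Gam k ->
  X *m Y *m Z + Z *m Y *m X \in Gam (g * h * k)%g.
Proof.
move=> hX hY hZ; apply: graded_dual => [|i ne].
  by apply: skew_sum_rev; rewrite ?(Gam_in hX, Gam_in hY, Gam_in hZ).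
rewrite mulmxDl linearD /= (graded_tr4 hX hY hZ (bG i)) //.
rewrite (graded_tr4 hZ hY hX (bG i)) ?addr0 //.
by rewrite -(mulgA k) (Gcomm k) (Gcomm h).
Qed.

Lemma graded_tr5 g h k l m X Y Z U V :
  X \in Gam g -> Y \in Gam h -> Z \in Gam k -> U \in Gam l -> V \in Gam m ->
  (g * h * k * l * m != 1)%g -> \tr (X *m Y *m Z *m U *m V) = 0.
Proof.
move=> hX hY hZ hU hV ne; have n4 : 4 != 0 :> R by rewrite pnatr_eq0.
have mulZ (a : R) (A B : 'M[R]_n) : a * \tr (A *m B) = \tr ((a *: A) *m B).
  by rewrite -scalemxAl linearZ.
apply: (mulfI n4); rewrite mulr0 -[_ *m _ *m V]mulmxA mulZ word3.
move: (graded_sum_rev hX hY hZ) (graded_sum_rev hX hZ hY).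
move: (Gam_lie hY hZ) (Gam_lie hX hY) (Gam_lie hX hZ).
move: (lie_bracket Y Z) (lie_bracket X Y) (lie_bracket X Z) => A B C hA hB hC.
move: (X *m Y *m Z + _) (X *m Z *m Y + _) => T S hT hS.
rewrite !mulmxDl -!scalemxAl !mxtraceD !mxtraceZ !mulmxA.
rewrite (graded_tr4 hX hA hU hV) ?mulgA // (graded_tr4 hB hZ hU hV) ?mulgA //.
rewrite (graded_tr4 hY hC hU hV); last by rewrite mulgA (Gcomm h).
rewrite (graded_tr4 hC hY hU hV); last by rewrite -(mulgA g) (Gcomm k) mulgA.
rewrite (graded_tr4 hZ hB hU hV); last by rewrite (Gcomm k).
rewrite (graded_tr3 hT hU hV) // (graded_tr3 hS hU hV); last first.
  by rewrite -(mulgA g) (Gcomm k) mulgA.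
by rewrite mulr0 !addr0.
Qed.

End Basis.
End GradedSkew.

(** * The induced grading of the matrix algebra *)

Section Dual.
Variables (R : fieldType) (G : groupType) (n k : nat).
Variables (b : k.-tuple 'M[R]_n) (d : 'I_k -> G) (g : G).

Definition off_pair_tr Z : 'M[R]_k := \matrix_(i, j)
  if (g * d i * d j == 1)%g then 0 else \tr (Z *m b`_i *m b`_j).

Lemma off_pair_tr_is_linear : linear off_pair_tr.
Proof.
move=> a Y Z; apply/matrixP => i j; rewrite !mxE.
case: ifP => _; first by rewrite mulr0 addr0.
by rewrite !mulmxDl -!scalemxAl linearP.
Qed.

HB.instance Definition _ :=
  GRing.isLinear.Build R 'M[R]_n 'M[R]_k *:%R off_pair_tr off_pair_tr_is_linear.

(** The component of degree g is prescribed by duality: Z may pair nontrivially with b_i b_j only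
    when g d_i d_j = 1. Directness then follows because the pairings determine Z. *)
Definition dual_comp : {vspace 'M[R]_n} := lker (linfun off_pair_tr).

Lemma dual_compP Z : reflect
  (forall i j : 'I_k, (g * d i * d j != 1)%g -> \tr (Z *m b`_i *m b`_j) = 0)
  (Z \in dual_comp).
Proof.
rewrite memv_ker lfunE /=; apply: (iffP eqP) => [/matrixP h i j ne|h].
  by have := h i j; rewrite !mxE (negPf ne).
apply/matrixP => i j; rewrite !mxE; case: ifP => // /negbT; exact: h.
Qed.
End Dual.

(** The vanishing of traces outside degree 1 passes to corners and makes inverse degrees pair
    nondegenerately, which supplies inverses of homogeneous elements. *)
Definition assoc_grading (R : fieldType) (G : groupType) n
    (M : G -> {vspace 'M[R]_n}) :=
  [/\ forall g h X Y, X \in M g -> Y \in M h -> X *m Y \in M (g * h)%g,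
      fam_covers M fullv, 1%:M \in M 1%g &
      forall g X, X \in M g -> g != 1%g -> \tr X = 0].

Section AssocGrading.
Variables (R : realFieldType) (G : groupType).
Hypothesis Gcomm : forall x y : G, (x * y)%g = (y * x)%g.
Variables (n : nat) (Phi : 'M[R]_n).
Hypotheses (PhiT : Phi^T = Phi) (PhiU : Phi \in unitmx).
Hypotheses (n3 : (2 < n)%N) (nodd : odd n).
Variable Gam : G -> {vspace 'M[R]_n}.
Hypothesis gr : is_grading (Skew Phi) Gam.
Implicit Types X Y Z U V W : 'M[R]_n.

Lemma skew_assoc_grading : exists M : G -> {vspace 'M[R]_n},
  [/\ assoc_grading M, fam_direct M, forall g, (Gam g <= M g)%VS &
      forall g X, X \in M g -> phi_inv Phi X \in M g].
Proof.
have [b [d [bP bG]]] := graded_Skew_basis gr.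
have [Gam_sub _ _ _] := gr.
have Gam_in g X : X \in Gam g -> X \in Skew Phi by apply/subvP/Gam_sub.
have tr2 := graded_tr2 PhiT PhiU nodd gr bP bG.
have tr3 := graded_tr3 PhiT PhiU nodd gr bP bG.
have tr4 := graded_tr4 Gcomm PhiT PhiU nodd gr bP bG.
have tr5 := graded_tr5 Gcomm PhiT PhiU nodd gr bP bG.
pose M := dual_comp b d.
have GM g : (Gam g <= M g)%VS.
  by apply/subvP => X hX; apply/dual_compP => i j; apply: tr3.
have M2 g h X Y : X \in Gam g -> Y \in Gam h -> X *m Y \in M (g * h)%g.
  by move=> hX hY; apply/dual_compP => i j; apply: tr4.
have M3 g h k X Y Z : X \in Gam g -> Y \in Gam h -> Z \in Gam k ->
    X *m Y *m Z \in M (g * h * k)%g.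
  by move=> hX hY hZ; apply/dual_compP => i j; apply: tr5.
(* The dual family M is direct but not visibly covering, while the family M' of products of
   homogeneous skew elements is covering but not visibly direct. As M' lies in M, [fam_eq]
   identifies them, and properties of M can be checked on products. *)
pose M' g := (\sum_(ij | (d ij.1 * d ij.2)%g == g) <[b`_ij.1 *m b`_ij.2]>)%VS.
have M'M g : (M' g <= M g)%VS.
  by apply/subv_sumP => -[i j] /= /eqP <-; rewrite -memvE M2.
have M'cov : fam_covers M' fullv.
  move=> Z _; move: Z.
  apply: (skew_prod_ind PhiT PhiU n3 (span_basis bP)).
  - by exists [::]; rewrite mem0v.
  - move=> a A B [s As] [t Bt]; exists (s ++ t); rewrite big_cat /=.
    by rewrite memv_add ?memvZ.
  move=> _ _ /(nthP 0)[i + <-] /(nthP 0)[j + <-]; rewrite !size_tuple => id jd.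
  exists [:: (d (Ordinal id) * d (Ordinal jd))%g]; rewrite big_seq1.
  by rewrite memvE (sumv_sup (Ordinal id, Ordinal jd)).
have Mcov : fam_covers M fullv.
  move=> Z /M'cov[s Zs]; exists s; apply: subvP Zs.
  by elim: (s) => [|h t IH]; rewrite ?big_nil ?subvv // !big_cons addvS.
have Mdir : fam_direct M.
  move=> s f us fM sf0 h hs; apply: (pair_tr_inj PhiT PhiU n3 (span_basis bP)).
  rewrite linear0; apply/matrixP => i j; rewrite !mxE.
  have [hij|hij] := eqVneq (h * d i * d j)%g 1%g; last first.
    by have /dual_compP := fM h; apply.
  have := congr1 (fun Z => \tr (Z *m b`_i *m b`_j)) sf0; cbv beta.
  rewrite !mul0mx mxtrace0 !mulmx_suml linear_sum (bigD1_seq h) //= big1.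
    by rewrite addr0.
  move=> k kh; have /dual_compP := fM k; apply.
  by rewrite -hij !(can_eq (mulgK _)).
have Mind h (P : 'M[R]_n -> Prop) : P 0 ->
    (forall a A B, P A -> P B -> P (a *: A + B)) ->
    (forall g k X Y, X \in Gam g -> Y \in Gam k -> (g * k)%g = h ->
      P (X *m Y)) ->
    forall Z, Z \in M h -> P Z.
  move=> P0 PD PXY Z Zh.
  have : Z \in M' h by apply: (fam_eq (U := fullv) (V := M)) Zh; rewrite ?memvf.
  case/memv_sumP => f fV ->; apply: big_ind => // [A B PA PB|[i j] /eqP hij].
    by rewrite -[A]scale1r; apply: PD.
  have /vlineP[c ->] := fV _ (introT eqP hij); rewrite -[_ *: _]addr0.
  by apply: PD => //; apply: PXY hij.
exists M; split=> //; first split=> //.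
- have MG g h X Y : X \in M g -> Y \in Gam h -> X *m Y \in M (g * h)%g.
    move=> + hY; move: X; apply: Mind => [|a A B hA hB|k l X Z hX hZ <-].
    + by rewrite mul0mx mem0v.
    + by rewrite mulmxDl -scalemxAl rpredD ?rpredZ.
    + exact: M3.
  move=> g h X Y hX; move: Y; apply: Mind => [|a A B hA hB|k l Y Z hY hZ <-].
  + by rewrite mulmx0 mem0v.
  + by rewrite mulmxDr -scalemxAr rpredD ?rpredZ.
  by rewrite mulmxA mulgA; apply: (MG) hZ; apply: MG.
- by apply/dual_compP => i j; rewrite mul1g mul1mx; apply: tr2.
- move=> g X Xg g1; move: X Xg; apply: Mind => [|a A B hA hB|k l X Y hX hY kl].
  + by rewrite mxtrace0.
  + by rewrite linearP /= hA hB mulr0 addr0.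
  by apply: tr2 hX hY _; rewrite kl.
- move=> g; apply: Mind => [|a A B hA hB|k l X Y hX hY <-].
  + by rewrite /phi_inv trmx0 mulmx0 mul0mx mem0v.
  + by rewrite phi_inv_is_linear rpredD ?rpredZ.
  rewrite phi_invM // (skewP _ _ (Gam_in _ _ hX)) (skewP _ _ (Gam_in _ _ hY)).
  by rewrite mulNmx mulmxN opprK Gcomm M2.
Qed.

End AssocGrading.

(** * A homogeneous idempotent of rank one *)

(** A rank factorization z = C W turns the trace into that of W C, which is again nilpotent and of
    smaller size because z is singular. *)
Lemma mxtrace_nilpotent (F : fieldType) k (z : 'M[F]_k) m :
  z ^+ m = 0 -> \tr z = 0.
Proof.
elim/ltn_ind: k z m => -[_ z m _|k IH z m zm];
  first by rewrite [z]flatmx0 mxtrace0.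
have zU : z \isn't a GRing.unit.
  by apply: contra_eqN zm => zU; apply: contraTneq (unitrX m zU) => ->;
    rewrite unitr0.
have rk : (\rank z < k.+1)%N.
  by rewrite ltn_neqAle rank_leq_row andbT; apply: contra zU => /eqP h;
    rewrite -row_full_unit /row_full h.
rewrite -[z]mulmx_base mxtrace_mulC; apply: (IH _ rk _ m.+1).
have -> : forall j, (row_base z *m col_base z) ^+ j.+1 =
    row_base z *m z ^+ j *m col_base z.
  elim=> [|j IHj]; first by rewrite expr1 expr0 mulmx1.
  rewrite exprSr IHj -mulmxE mulmxA -(mulmxA _ (col_base z) (row_base z)).
  by rewrite mulmx_base -(mulmxA (row_base z)) mulmxE -exprSr.
by rewrite zm mulmx0 mul0mx.
Qed.

Lemma idem_base (F : fieldType) k (E : 'M[F]_k) :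
  E *m E = E -> row_base E *m col_base E = 1%:M.
Proof.
move=> EE; have CW : col_base E *m row_base E = E := mulmx_base E.
have [D DC] := row_fullP (col_base_full E).
have [V WV] := row_freeP (row_base_free E).
move: D V DC WV CW; move: (col_base E) (row_base E) => C W D V DC WV CW.
rewrite -[W *m C]mul1mx -DC -[_ *m (W *m C)]mulmx1 -WV.
rewrite -!mulmxA (mulmxA C W V) (mulmxA C W) CW.
by rewrite (mulmxA E) EE -[X in X *m V]CW -mulmxA WV mulmx1.
Qed.

Lemma mxtrace_idem (F : fieldType) k (E : 'M[F]_k) :
  E *m E = E -> \tr E = (\rank E)%:R.
Proof.
move=> EE; rewrite -[in LHS](mulmx_base E) mxtrace_mulC idem_base //.
by rewrite mxtrace1.
Qed.

Section Corner.
Variables (R : rcfType) (G : groupType) (k : nat) (M : G -> {vspace 'M[R]_k}).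
Hypothesis Mgr : assoc_grading M.

(** With E = C W and W C = 1, the map Y |-> C Y W identifies matrices of size [\rank E] with the
    corner cut out by E; as E has degree 1, cutting preserves degrees. *)
Lemma idem_corner E : E \in M 1%g -> E *m E = E ->
  exists (C : 'M[R]_(k, \rank E)) (W : 'M[R]_(\rank E, k)),
  [/\ W *m C = 1%:M, C *m W = E &
   assoc_grading (fun g => (linfun (mulmxr W \o mulmx C) @^-1: M g)%VS)].
Proof.
move=> E1 EE; exists (col_base E), (row_base E).
have CW : col_base E *m row_base E = E := mulmx_base E.
have WC := idem_base EE.
have [MM Mcov _ Mtr] := Mgr.
split=> //; move: (col_base E) (row_base E) CW WC => C W CW WC.
have memP g Y : (Y \in (linfun (mulmxr W \o mulmx C) @^-1: M g)%VS) =
    (C *m Y *m W \in M g).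
  by rewrite -memv_preim lfunE.
split=> [g h X Y|Y _||g X].
- rewrite !memP => hX hY; have := MM _ _ _ _ hX hY.
  by rewrite !mulmxA -(mulmxA (C *m X) W C) WC mulmx1.
- have [s Ys] := Mcov (C *m Y *m W) (memvf _).
  have [f fM YE] := mem_fam_sum (undup_uniq s)
    (subvP (sub_fam_sum M (s2 := undup s) (fun g =>
      etrans (mem_undup s g))) _ Ys).
  exists (undup s).
  have -> : Y = \sum_(g <- undup s) W *m f g *m C.
    rewrite -mulmx_suml -mulmx_sumr -YE !mulmxA WC mul1mx -mulmxA WC.
    by rewrite mulmx1.
  elim: (undup s) => [|g t IH]; first by rewrite !big_nil mem0v.
  rewrite !big_cons memv_add // memP !mulmxA CW -mulmxA CW.
  by rewrite -[g]mul1g -[X in M (X)]mulg1 !MM // mul1g.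
- by rewrite memP mulmx1 CW.
rewrite memP => hX g1; rewrite -(Mtr _ _ hX g1) mxtrace_mulC mulmxA WC.
by rewrite mul1mx.
Qed.

End Corner.

Section Primitive.
Variables (R : rcfType) (G : groupType).
Hypothesis Gcomm : forall x y : G, (x * y)%g = (y * x)%g.
Variables (k' : nat) (M : G -> {vspace 'M[R]_k'.+1}).
Local Notation k := k'.+1.
Hypothesis Mgr : assoc_grading M.
Hypothesis kodd : odd k.
Hypothesis prim : forall E, E \in M 1%g -> E *m E = E -> E = 0 \/ E = 1%:M.

Let M1 g h X Y : X \in M g -> Y \in M h -> X *m Y \in M (g * h)%g.
Proof. by case: Mgr => h' _ _ _; apply: h'. Qed.

Lemma comp1_horner y p : y \in M 1%g -> horner_mx y p \in M 1%g.
Proof.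
have [_ _ one1 _] := Mgr; move=> hy; elim/poly_ind: p => [|p c IH].
  by rewrite rmorph0 mem0v.
rewrite rmorphD rmorphM /= horner_mx_X horner_mx_C rpredD //.
  by rewrite -[1%g]mulg1 M1.
by rewrite -scalemx1 rpredZ.
Qed.

(* Fitting's lemma: Bezout for the factors 'X^m and q of the characteristic
   polynomial, q 0 <> 0, gives complementary idempotents in the component of 1.
     *)
Lemma comp1_fitting y : y \in M 1%g ->
  y \in unitmx \/ exists m, y ^+ m = 0.
Proof.
move=> hy; have [m [q q0 pE]] := multiplicity_XsubC (char_poly y) 0.
rewrite monic_neq0 ?char_poly_monic //= subr0 in q0 pE.
have /Bezout_coprimepP[[u v] /=] : coprimep ('X^m) q.
  by apply: coprimep_expl; rewrite coprimep_sym -['X]subr0 coprimep_XsubC.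
rewrite -size_poly_eq1 => /size_poly1P[c c0 uv].
pose e1 : 'M[R]_k := horner_mx y (c^-1 *: (u * 'X^m)).
pose e0 : 'M[R]_k := horner_mx y (c^-1 *: (v * q)).
have e01 : e1 + e0 = 1%:M.
  by rewrite -rmorphD -scalerDr uv -mul_polyC -polyCM mulVf //= rmorph1.
have e10 : e1 *m e0 = 0.
  rewrite mulmxE -rmorphM /= -scalerAl -scalerAr scalerA.
  have -> : u * 'X^m * (v * q) = u * v * char_poly y.
    by rewrite pE; ring.
  by rewrite linearZ /= rmorphM /= Cayley_Hamilton mulr0 scaler0.
have e11 : e1 *m e1 = e1 by rewrite -{3}[e1]mulmx1 -e01 mulmxDr e10 addr0.
have e1M : e1 \in M 1%g by apply: comp1_horner.
have Xm : horner_mx y ('X^m) = y ^+ m by rewrite rmorphXn /= horner_mx_X.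
have [e1z|e1o] := prim e1M e11.
  right; exists m; rewrite -[LHS]mulr1 -[1]/(1%:M) -e01 e1z add0r.
  rewrite -Xm -rmorphM /= -scalerAr linearZ /=.
  have -> : 'X^m * (v * q) = v * char_poly y by rewrite pE; ring.
  by rewrite rmorphM /= Cayley_Hamilton mulr0 scaler0.
have [m0|m0] := posnP m; last first.
  left; suff : y *m horner_mx y (c^-1 *: (u * 'X^(m.-1))) = 1%:M.
    by case/mulmx1_unit.
  rewrite -e1o /e1 -{1}[y]horner_mx_X mulmxE -rmorphM; congr horner_mx.
  by rewrite -scalerAr -{2}(prednK m0) exprS mulrCA.
left; rewrite unitmxE unitfE; apply: contraNneq q0 => dy.
rewrite rootE; have := char_poly_det y; rewrite dy mulr0 pE m0 expr0 mulr1.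
by rewrite -horner_coef0 => ->.
Qed.

(** As k is odd, x has an eigenvalue c, so N = x - c is singular. For X of degree 1 the product N X
    is singular, hence nilpotent by [comp1_fitting], hence of trace zero; in other degrees N X has
    trace zero anyway. Nondegeneracy gives N = 0. *)
Lemma comp1_scalar x : x \in M 1%g -> exists c, x = c%:M.
Proof.
move=> hx; have [_ Mcov one1 Mtr] := Mgr.
have [c cr] : {c | root (char_poly x) c}.
  by apply: odd_poly_root; rewrite size_char_poly /= negbK.
exists c; pose N := x - c%:M.
have NM : N \in M 1%g by rewrite rpredB // -scalemx1 rpredZ.
have NU : N \notin unitmx.
  move: cr; rewrite -eigenvalue_root_char => /eigenvalueP[v vx v0].
  apply/negP => NU; move/negP: v0; apply; rewrite -(mulmxK NU v).
  by rewrite mulmxBr vx mul_mx_scalar subrr mul0mx.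
have [NU'|[m Nm]] := comp1_fitting NM; first by rewrite NU' in NU.
apply/eqP; rewrite -subr_eq0 -/N; apply/eqP/tr_mul_nondeg => Y.
move: Y (memvf Y); apply: (covers_ind Mcov) => [|U V hU hV|g X hX].
- by rewrite mulmx0 mxtrace0.
- by rewrite mulmxDr linearD /= hU hV addr0.
have NX := M1 NM hX; rewrite mul1g in NX.
have [g1|g1] := eqVneq g 1%g; last exact: Mtr NX g1.
rewrite g1 in NX; have [NXU|[l NXl]] := comp1_fitting NX.
  by move: NXU; rewrite unitmx_mul (negPf NU).
exact: mxtrace_nilpotent NXl.
Qed.

(** Nondegeneracy and the vanishing of traces outside degree 1 give Y of degree g^-1 with
    [\tr (X *m Y)] nonzero; then X Y has degree 1 and is a scalar. *)
Lemma hom_inv g X : X \in M g -> X != 0 ->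
  exists Y c, [/\ c != 0, Y \in M g^-1%g & X *m Y = c%:M].
Proof.
move=> hX X0; have [_ Mcov _ Mtr] := Mgr.
suff [Y [hY YX]] : exists Y, Y \in M g^-1%g /\ \tr (X *m Y) != 0.
  have := M1 hX hY; rewrite mulgV => /comp1_scalar[c cE].
  exists Y, c; split=> //; apply: contraNneq YX => c0.
  by rewrite cE c0 mxtrace_scalar mul0rn.
have /matrix0Pn[i [j Xij]] := X0.
have [s Ds] := Mcov (delta_mx j i) (memvf _).
have [f fM DE] := mem_fam_sum (undup_uniq s)
  (subvP (sub_fam_sum M (s2 := undup s) (fun g =>
    etrans (mem_undup s g))) _ Ds).
have /hasP[h _ hX'] : has (fun h => \tr (X *m f h) != 0) (undup s).
  apply: contraNT Xij => /hasPn no; rewrite -tr_mul_delta DE mulmx_sumr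
    linear_sum.
  by rewrite big_seq big1 //= => h /no; rewrite negbK => /eqP.
exists (f h); split=> //; suff <- : h = g^-1%g by apply: fM.
apply/esym/eqP; rewrite -(can_eq (mulKg g)) mulgV.
apply: contraNT hX' => gh; apply/eqP; apply: (Mtr (g * h)%g); first exact: M1.
by rewrite eq_sym.
Qed.

Lemma hom_unit g X : X \in M g -> X != 0 -> X \in unitmx.
Proof.
move=> hX X0; have [Y [c [c0 _ XY]]] := hom_inv hX X0.
have : X *m (c^-1 *: Y) = 1%:M.
  by rewrite -scalemxAr XY -mul_scalar_mx -scalar_mxM mulVf.
by case/mulmx1_unit.
Qed.

(* X Z = c Z X because the components are lines; taking determinants, c^k = 1
   with k odd forces c = 1. *)
Lemma hom_comm g h X Z : X \in M g -> Z \in M h -> X *m Z = Z *m X.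
Proof.
move=> hX hZ; have [->|X0] := eqVneq X 0; first by rewrite mul0mx mulmx0.
have [->|Z0] := eqVneq Z 0; first by rewrite mul0mx mulmx0.
have XU := hom_unit hX X0; have ZU := hom_unit hZ Z0.
have ZXU : Z *m X \in unitmx by rewrite unitmx_mul XU ZU.
have ZX0 : Z *m X != 0.
  by apply: contraTneq ZXU => ->; rewrite unitmxE det0 unitr0.
have [Y [c [c0 hY ZXY]]] := hom_inv (M1 hZ hX) ZX0.
have := M1 (M1 hX hZ) hY; rewrite (Gcomm h) mulgV => /comp1_scalar[e eE].
have YU : Y \in unitmx.
  have : Z *m X *m (c^-1 *: Y) = 1%:M.
    by rewrite -scalemxAr ZXY -mul_scalar_mx -scalar_mxM mulVf.
  case/mulmx1_unit => _; rewrite !unitmxE detZ unitrM => /andP[_]; exact.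
have XZE : X *m Z = (e / c) *: (Z *m X).
  apply: (can_inj (mulmxK YU)); rewrite -scalemxAl ZXY eE scale_scalar_mx.
  by rewrite divfK.
have /eqP := congr1 determinant XZE.
rewrite detZ !det_mulmx (mulrC (\det Z)) -[X in X == _]mul1r.
rewrite (can_eq (mulrK _)) -?unitrM ?unitmxE; last by move: XU ZU;
  rewrite !unitmxE unitrM => -> ->.
move=> /eqP/esym/eqP ek.
have e0 : 0 < e / c by rewrite -(real_exprn_odd_gt0 _ kodd) ?num_real //
  (eqP ek).
rewrite pexpr_eq1 // in ek; last exact: ltW.
by rewrite XZE (eqP ek) scale1r.
Qed.

Lemma primitive_dim1 : k' = 0%N.
Proof.
have [_ Mcov _ _] := Mgr.
have comm (X Z : 'M[R]_k) : X *m Z = Z *m X.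
  move: X (memvf X); apply: (covers_ind Mcov) => [|U V hU hV|g X hX].
  - by rewrite mul0mx mulmx0.
  - by rewrite mulmxDl mulmxDr hU hV.
  move: Z (memvf Z); apply: (covers_ind Mcov) => [|U V hU hV|h Z hZ].
  - by rewrite mul0mx mulmx0.
  - by rewrite mulmxDl mulmxDr hU hV.
  exact: hom_comm hX hZ.
have [c cE] := central_scalar (comm (delta_mx 0 0)).
case: k' cE => // l /matrixP cE; have := cE 0 0; rewrite !mxE /= => c1.
have := cE ord_max ord_max; rewrite !mxE /= eqxx -c1 => /eqP.
by rewrite eq_sym oner_eq0.
Qed.

End Primitive.

Lemma rank1_idempotent (R : rcfType) (G : groupType)
    (Gcomm : forall x y : G, (x * y)%g = (y * x)%g) k (M : G ->
      {vspace 'M[R]_k}) :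
  assoc_grading M -> odd k ->
  exists (v : 'cV[R]_k) (w : 'rV[R]_k), w *m v = 1%:M /\ v *m w \in M 1%g.
Proof.
elim/ltn_ind: k M => -[//|k IH M Mgr kodd].
(* A homogeneous idempotent of odd rank other than 1 leads to a smaller corner of odd size, where
   induction applies. *)
have cut E : E \in M 1%g -> E *m E = E -> E != 1%:M -> odd (\rank E) ->
    exists (v : 'cV[R]_k.+1) (w : 'rV[R]_k.+1),
      w *m v = 1%:M /\ v *m w \in M 1%g.
  move=> E1 EE En1 Eodd; have [C [W [WC CW gr]]] := idem_corner Mgr E1 EE.
  have rk : (\rank E < k.+1)%N.
    rewrite ltn_neqAle rank_leq_row andbT; apply: contra En1 => h.
    have EU : E \in unitmx by rewrite -row_full_unit.
    by rewrite -[E](mulmxK EU) EE mulmxV.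
  have [v [w [wv vw]]] := IH _ rk _ gr Eodd.
  exists (C *m v), (w *m W); split.
    by rewrite mulmxA -(mulmxA w) WC mulmx1.
  by move: vw; rewrite -memv_preim lfunE /= !mulmxA.
have [|no] := boolp.pselect (exists E, [/\ E \in M 1%g, E *m E = E,
  E != 0 & E != 1%:M]).
  case=> E [E1 EE E0 En1].
  have [_ _ one1 _] := Mgr.
  (* The ranks of E and 1 - E add up to an odd size, so exactly one of them is odd. *)
  have rE : (\rank E + \rank (1%:M - E)%R = k.+1)%N.
    suff -> : \rank (1%:M - E)%R = (k.+1 - \rank E)%N.
      by rewrite subnKC ?rank_leq_row.
    rewrite -mxrank_ker; apply/eqP; rewrite eqn_leq; apply/andP; split.
      by apply: mxrankS; apply/sub_kermxP; rewrite mulmxBl mul1mx EE subrr.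
    apply: mxrankS; apply/row_subP => i.
    have /sub_kermxP h := row_sub i (kermx E).
    have -> : row i (kermx E) = row i (kermx E) *m (1%:M - E).
      by rewrite mulmxBr mulmx1 h subr0.
    exact: submxMl.
  have [oE|eE] := boolP (odd (\rank E)); first exact: (cut E).
  apply: (cut (1%:M - E)).
  - by rewrite rpredB.
  - by rewrite mulmxBr mulmx1 mulmxBl mul1mx EE subrr subr0.
  - by rewrite -subr_eq0 addrAC subrr add0r oppr_eq0.
  by have := congr1 odd rE; rewrite oddD (negPf eE) kodd.
have prim E : E \in M 1%g -> E *m E = E -> E = 0 \/ E = 1%:M.
  move=> E1 EE; have [->|E0] := eqVneq E 0; first by left.
  have [->|En1] := eqVneq E 1%:M; first by right.
  by case: no; exists E.
have k0 := primitive_dim1 Gcomm Mgr kodd prim.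
move: M Mgr {IH cut no prim kodd}; rewrite k0 => M [_ _ one1 _].
by exists 1%:M, 1%:M; rewrite mulmx1.
Qed.

(** * Labelled bases *)

Lemma pair_list (T : eqType) (tau : T -> T) (s : seq T) :
  involutive tau -> uniq s -> {in s, forall x, tau x \in s /\ tau x != x} ->
  exists u, perm_eq (u ++ map tau u) s.
Proof.
move=> tauK; have [k] := ubnP (size s); elim: k s => // k IH [|x s] /=.
  by exists [::].
rewrite ltnS => sk /andP[xs us] h.
have [txs tx] := h x (mem_head _ _); rewrite inE (negPf tx) /= in txs.
have [|||u uP] := IH (rem (tau x) s).
- by rewrite size_rem // (leq_trans _ sk) // prednK //; case: (s) txs.
- exact: rem_uniq.
- move=> y; rewrite mem_rem_uniq // inE => /andP[ytx ys].
  have [tys ty] := h y (mem_behead (s := x :: s) ys); split=> //.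
  rewrite mem_rem_uniq // inE (inj_eq (can_inj tauK)).
  have yx : y != x by apply: contraNneq xs => <-.
  rewrite yx /=; move: tys; rewrite inE => /predU1P[tyx|//].
  by rewrite -tyx tauK eqxx in ytx.
exists (x :: u); rewrite /= perm_cons -cat1s perm_catCA cat1s.
by rewrite perm_sym (perm_trans (perm_to_rem txs)) // perm_cons perm_sym.
Qed.

Lemma sum_by_label (V : nmodType) (I : finType) (T : eqType) (l : I -> T)
    (s : seq T) (F : I -> V) : uniq s -> (forall i, l i \in s) ->
  \sum_i F i = \sum_(x <- s) \sum_(i | l i == x) F i.
Proof.
move=> us ls; under [RHS]eq_bigr do rewrite big_mkcond.
rewrite exchange_big; apply: eq_bigr => i _ /=.
rewrite (bigD1_seq (l i)) //= eqxx big1 ?addr0 // => x xi.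
by rewrite eq_sym (negPf xi).
Qed.

Lemma unit_perm (F : fieldType) n (A : 'M[F]_n) :
  A \in unitmx -> exists s : 'S_n, forall i, A i (s i) != 0.
Proof.
rewrite unitmxE unitfE => dA.
have /existsP[s /forallP sP] : [exists s : 'S_n, [forall i, A i (s i) != 0]].
  apply: contraNT dA => /existsPn no; rewrite /determinant big1 // => s _.
  have /forallPn[i] := no s; rewrite negbK => /eqP Ai.
  by rewrite (bigD1 i) //= Ai mul0r mulr0.
by exists s.
Qed.

Section CompLabel.
Variables (R : fieldType) (G : groupType) (n : nat) (l : 'I_n -> G).

(** The body of [compB] for an arbitrary labelling, kept literally so that [GammaB] is an instance
    of [skew_label] by conversion. *)
Definition comp_label (g : G) : {vspace 'M[R]_n} :=
  (\sum_(ab : 'I_n * 'I_n | (l ab.1 * (l ab.2)^-1)%g == g)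
      <[delta_mx ab.1 ab.2]>)%VS.

Lemma comp_labelP g (X : 'M[R]_n) : reflect
  (forall a b, X a b != 0 -> (l a * (l b)^-1)%g = g) (X \in comp_label g).
Proof.
apply: (iffP memv_sumP) => [[f fV -> a b]|h].
  rewrite summxE => /eqP fab; apply/eqP; apply: contra_notT fab => ab.
  apply: big1 => -[c e] /= ce; have /vlineP[k ->] := fV (c, e) ce.
  rewrite !mxE /=; case: eqP => [ac|_]; last by rewrite mulr0.
  case: eqP => [be|_]; last by rewrite mulr0.
  by rewrite ac be ce in ab.
exists (fun ab => X ab.1 ab.2 *: delta_mx ab.1 ab.2).
  by move=> ab _; rewrite memvZ // memv_line.
rewrite {1}[X]matrix_sum_delta pair_big /= [RHS]big_mkcond.
apply: eq_bigr => -[a b] _ /=; case: eqP => // ab.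
have [->|/h //] := eqVneq (X a b) 0; exact: scale0r.
Qed.

Lemma comp_label_direct : fam_direct comp_label.
Proof.
move=> s f us fV sf h hs; apply/matrixP => a b; rewrite mxE.
apply/eqP; apply: contraT => hab.
have /comp_labelP/(_ a b hab) lab := fV h.
have /matrixP/(_ a b) := sf; rewrite summxE (bigD1_seq h) //= big1 => [|k kh].
  by rewrite addr0 mxE => /eqP; rewrite (negPf hab).
apply/eqP; apply: contraNT kh => kab.
by have /comp_labelP/(_ a b kab) := fV k; rewrite lab => ->.
Qed.

Lemma comp_label_covers : fam_covers comp_label fullv.
Proof.
apply: (@fam_sum_covers _ _ _ _ _
  [seq delta_mx ab.1 ab.2 | ab <- enum {: 'I_n * 'I_n}]); last first.
  move=> _ /mapP[[a b] _ ->]; exists (l a * (l b)^-1)%g.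
  by rewrite memvE (sumv_sup (a, b)).
apply/vspaceP => X; rewrite memvf [X]matrix_sum_delta.
apply: rpred_sum => a _; apply: rpred_sum => b _; apply: rpredZ.
by apply: memv_span; apply/mapP; exists (a, b); rewrite // mem_enum.
Qed.

End CompLabel.

Section ColBasis.
Variables (R : fieldType) (G : groupType) (n : nat).
Variable V : G -> {vspace 'cV[R]_n}.
Hypotheses (Vcov : fam_covers V fullv) (Vdir : fam_direct V).

Lemma hom_col_basis : exists (B : 'M[R]_n) (l : 'I_n -> G),
  [/\ B \in unitmx, forall j, col j B \in V (l j) &
   forall h x a, x \in V h -> (invmx B *m x) a 0 != 0 -> l a = h].
Proof.
have [b [d [bP bV]]] := hom_basis Vcov (fun g => subvf (V g)).
have dn : \dim (fullv : {vspace 'cV[R]_n}) = n by rewrite dimvf /dim /= muln1.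
move: b d bP bV; rewrite dn => b d bP bV.
pose B : 'M[R]_n := \matrix_(i, j) b`_j i 0.
have colB j : col j B = b`_j by apply/matrixP => i k; rewrite !mxE ord1.
have BU : B \in unitmx.
  rewrite -unitmx_tr -row_free_unit -kermx_eq0; apply/eqP/row_matrixP => i.
  have /sub_kermxP := row_sub i (kermx B^T); move: (row i _) => w wB.
  rewrite row0; apply/rowP => j; rewrite mxE.
  have /freeP := basis_free bP; apply; apply/matrixP => c k.
  transitivity ((w *m B^T) 0 c); last by rewrite wB !mxE.
  by rewrite summxE mxE ord1; apply: eq_bigr => a _; rewrite !mxE.
exists B, d; split=> // [j|h x a xh]; first by rewrite colB.
have : x \in (\sum_(j | d j == h) <[b`_j]>)%VS.
  pose V' h := (\sum_(j | d j == h) <[b`_j]>)%VS.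
  apply: (fam_eq (V := V) (V' := V') (U := fullv)) xh => //; last exact: memvf.
    by move=> g; apply/subv_sumP => j /eqP <-; rewrite -memvE.
  apply: (fam_sum_covers (span_basis bP)) => _ /(nthP 0)[j jd <-].
  rewrite size_tuple in jd; exists (d (Ordinal jd)).
  by rewrite memvE (sumv_sup (Ordinal jd)).
case/memv_sumP => f fV -> /eqP; rewrite mulmx_sumr summxE.
move=> ne; apply/eqP; apply: contra_notT ne => ah.
apply: big1 => j /eqP jh; have /vlineP[c ->] := fV j (introT eqP jh).
rewrite -scalemxAr -colB colE mulmxA mulVmx // mul1mx !mxE andbT.
case: eqP => [aj|_]; last by rewrite mulr0.
by rewrite aj jh eqxx in ah.
Qed.
End ColBasis.

Section GradedLabel.
Variables (R : rcfType) (G : groupType).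
Hypothesis Gcomm : forall x y : G, (x * y)%g = (y * x)%g.
Variables (n : nat) (Phi : 'M[R]_n).
Hypotheses (PhiT : Phi^T = Phi) (PhiU : Phi \in unitmx).
Hypotheses (n3 : (2 < n)%N) (nodd : odd n).

(* A nonzero term of det Psi is a permutation s with l (s a) = c0 / l a; were c0
   not a square, the labels would be paired off and n would be even. *)
Lemma odd_label_sqrt (l : 'I_n -> G) (Psi : 'M[R]_n) c0 : Psi \in unitmx ->
  (forall a b, Psi a b != 0 -> (l a * l b)%g = c0) ->
  exists h : G, (h * h)%g = c0.
Proof.
move=> /unit_perm[s sP] lP.
have [/existsP[a /eqP ac]|/existsPn no] := boolP [exists a,
  (l a * l a)%g == c0].
  by exists (l a).
pose tau x := (x^-1 * c0)%g.
have ls a : l (s a) = tau (l a) by rewrite /tau -(lP _ _ (sP a)) mulKg.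
have tauK : involutive tau.
  by move=> x; rewrite /tau invMg invgK (Gcomm _ x) mulgKV.
pose c x := \sum_(a | l a == x) 1%N.
have ctau x : c (tau x) = c x.
  rewrite /c (reindex_inj (@perm_inj _ s)) /=; apply: eq_bigl => a.
  by rewrite ls (inj_eq (can_inj tauK)).
have [|x|u uP] := @pair_list _ tau (undup (codom l)) tauK.
- exact: undup_uniq.
- rewrite !mem_undup => /codomP[a ->]; rewrite -ls codom_f; split=> //.
  rewrite ls /tau; apply: contra (no a) => /eqP {2}<-.
  by rewrite mulKVg.
have : n = \sum_(a : 'I_n) 1%N by rewrite sum1_card card_ord.
rewrite (sum_by_label (l := l) (s := undup (codom l)) (V :=
  nat)) ?undup_uniq //.
  rewrite -(perm_big _ uP) big_cat big_map /=.
  under [X in _ + X]eq_bigr do rewrite -/(c _) ctau /c.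
  by move=> ne; move: nodd; rewrite ne oddD addbb.
by move=> a; rewrite mem_undup codom_f.
Qed.

Variable Gam : G -> {vspace 'M[R]_n}.
Hypothesis gr : is_grading (Skew Phi) Gam.

Lemma graded_label : exists (B : 'M[R]_n) (l : 'I_n -> G),
  [/\ B \in unitmx,
    forall g X, X \in Gam g -> invmx B *m X *m B \in comp_label R l g &
    forall a b, (B^T *m Phi *m B) a b != 0 -> (l a * l b)%g = 1%g].
Proof.
have [M [Mgr Mdir GM Mphi]] := skew_assoc_grading Gcomm PhiT PhiU n3 nodd gr.
have [v [w [wv vw]]] := rank1_idempotent Gcomm Mgr nodd.
have [MM Mcov one1 _] := Mgr.
(* Right multiplication by w identifies columns with the left ideal M_n v w, which is graded because
   v w has degree 1. *)
pose V g : {vspace 'cV[R]_n} := (linfun (mulmxr w) @^-1: M g)%VS.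
have memV g x : (x \in V g) = (x *m w \in M g) by rewrite -memv_preim lfunE.
have Vcov : fam_covers V fullv.
  move=> x _; have [s xs] := Mcov (x *m w) (memvf _).
  have [f fM xE] := mem_fam_sum (undup_uniq s)
    (subvP (sub_fam_sum M (s2 := undup s) (fun g =>
      etrans (mem_undup s g))) _ xs).
  exists (undup s); have -> : x = \sum_(g <- undup s) f g *m v.
    by rewrite -mulmx_suml -xE -mulmxA wv mulmx1.
  elim: (undup s) => [|g t IH]; first by rewrite !big_nil mem0v.
  rewrite !big_cons memv_add // memV -mulmxA.
  by have := MM _ _ _ _ (fM g) vw; rewrite mulg1.
have Vdir : fam_direct V.
  move=> s f us fV sf h hs; suff e : f h *m w = 0.
    by rewrite -[f h]mulmx1 -wv mulmxA e mul0mx.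
  apply: (Mdir s (fun g => f g *m w) us) hs => [g|]; first by rewrite -memV.
  by rewrite -mulmx_suml sf mul0mx.
have [B [l [BU BV lP]]] := hom_col_basis Vcov Vdir.
have MB g X : X \in M g -> invmx B *m X *m B \in comp_label R l g.
  move=> Xg; apply/comp_labelP => a b ab; rewrite -[g](mulgK (l b)).
  congr (_ * _)%g; apply: (lP _ (X *m col b B)).
    by rewrite memV -mulmxA; apply: MM Xg _; rewrite -memV; apply: BV.
  by rewrite colE !mulmxA -colE mxE.
(* So far M is only contained in the label grading N. As M covers and N is direct they coincide, so
   the conjugated matrix units are homogeneous for M. *)
pose N g := (linfun (mulmxr B \o mulmx (invmx B)) @^-1: comp_label R l g)%VS.
have memN g X : (X \in N g) = (invmx B *m X *m B \in comp_label R l g).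
  by rewrite -memv_preim lfunE.
have Ndir : fam_direct N.
  move=> s f us fN sf h hs.
  suff e : invmx B *m f h *m B = 0.
    by rewrite -[f h](mulKVmx BU) -[invmx B *m _](mulmxK BU) e mul0mx mulmx0.
  apply: (comp_label_direct (l := l) (f := fun g =>
    invmx B *m f g *m B) us) hs => [g|].
    by rewrite -memN; apply: fN.
  by rewrite -mulmx_suml -mulmx_sumr sf mulmx0 mul0mx.
have EM a b : B *m delta_mx a b *m invmx B \in M (l a * (l b)^-1)%g.
  apply: (fam_eq (V := N) (U := fullv)) => //; last 1 first.
  - rewrite memN !mulmxA mulVmx // mul1mx mulmxKV //.
    by rewrite memvE (sumv_sup (a, b)).
  - by move=> g; apply/subvP => X; rewrite memN; apply: MB.
  exact: memvf.
pose Psi := B^T *m Phi *m B.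
have PsiU : Psi \in unitmx by rewrite !unitmx_mul unitmx_tr BU PhiU.
have PsiE a b : invmx Psi *m delta_mx b a *m Psi \in comp_label R l (l a * (l
  b)^-1)%g.
  have := MB _ _ (Mphi _ _ (EM a b)).
  rewrite /phi_inv !trmx_mul trmx_delta trmx_inv.
  suff -> : invmx Psi = invmx B *m invmx Phi *m invmx B^T by rewrite /Psi
    !mulmxA.
  apply: (can_inj (mulKmx PsiU)); rewrite mulmxV // /Psi !mulmxA.
  by rewrite mulmxK // mulmxK // mulmxV // unitmx_tr.
have n0 : (0 < n)%N by lia.
have PIU : invmx Psi \in unitmx by rewrite unitmx_inv.
(* A nonzero entry (c, b) of Psi^-1 is fixed. The adjoint of E_ab has the degree of E_ab, and its
   entry (c, e) shows that l a * l e = l c * l b whenever Psi a e is nonzero. *)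
have [s sP] := unit_perm PIU.
pose c := Ordinal n0; pose b := s c.
have lPsi a e : Psi a e != 0 -> (l a * l e)%g = (l c * l b)%g.
  move=> ae; have /comp_labelP/(_ c e) := PsiE a b.
  rewrite mul_delta_mx_entry mulf_neq0 ?sP // => /(_ isT) ce.
  have -> : l c = (l a * (l b)^-1 * l e)%g by rewrite -ce mulgKV.
  by rewrite -!mulgA (Gcomm (l e)) mulKg.
have [h hh] := odd_label_sqrt PsiU lPsi.
(* Dividing all labels by h keeps the quotients l a / l b and turns the constant h * h into 1. *)
exists B, (fun a => h^-1 * l a)%g; split=> //.
  move=> g X Xg; have /comp_labelP XP := MB _ _ (subvP (GM g) _ Xg).
  apply/comp_labelP => a e /XP <-.
  by rewrite invMg invgK -mulgA (mulgA (l a)) (Gcomm (_ * _)%g h) mulKg.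
move=> a e /lPsi ae; rewrite -mulgA (mulgA (l a)) (Gcomm (l a)) -(mulgA _ (l
  a)).
by rewrite ae -hh mulKg mulVg.
Qed.
End GradedLabel.

(** * Signatures *)

Section Sylvester.
Variable R : rcfType.

Definition sgn_mx k (P : nat) : 'M[R]_k :=
  diag_mx (\row_(a < k) (if (a < P)%N then 1 else -1)).

Lemma sgn_mxE k P i j :
  sgn_mx k P i j = (if (i < P)%N then 1 else -1) *+ (i == j).
Proof. by rewrite !mxE; case: eqP => // ->. Qed.

Lemma sgn_mxS k P : sgn_mx k.+1 P.+1 = block_mx 1%:M 0 0 (sgn_mx k P) :> 'M_(1 +
  k).
Proof.
apply/matrixP => i j; rewrite sgn_mxE.
case: (split_ordP (i : 'I_(1 + k))) => i' ->;
case: (split_ordP (j : 'I_(1 + k))) => j' ->; rewrite ?block_mxEul ?block_mxEur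
  ?block_mxEdl ?block_mxEdr ?mxE ?sgn_mxE.
- by rewrite !ord1.
- by rewrite eq_lrshift.
- by rewrite eq_rlshift.
- by rewrite eq_rshift /= add1n ltnS.
Qed.

Lemma sgn_mx0S k : sgn_mx k.+1 0 = block_mx (- 1%:M) 0 0 (sgn_mx k 0) :> 'M_(1 +
  k).
Proof.
apply/matrixP => i j; rewrite sgn_mxE.
case: (split_ordP (i : 'I_(1 + k))) => i' ->;
case: (split_ordP (j : 'I_(1 + k))) => j' ->; rewrite ?block_mxEul ?block_mxEur
  ?block_mxEdl ?block_mxEdr ?mxE ?sgn_mxE.
- by rewrite !ord1.
- by rewrite eq_lrshift.
- by rewrite eq_rlshift.
- by rewrite eq_rshift.
Qed.

Lemma sgn_mxT k P : (sgn_mx k P)^T = sgn_mx k P.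
Proof. exact: tr_diag_mx. Qed.

Lemma sgn_mx_sqr k P : sgn_mx k P *m sgn_mx k P = 1%:M.
Proof.
rewrite mulmx_diag -diag_const_mx; congr diag_mx; apply/rowP => i.
by rewrite !mxE; case: ifP => _; rewrite ?mulrNN mulr1.
Qed.

Lemma mxtrace_sgn_mx k P : (P <= k)%N -> \tr (sgn_mx k P) = (2 * P)%:R - k%:R.
Proof.
move=> Pk; rewrite mxtrace_diag; under eq_bigr do rewrite mxE.
rewrite -(subnKC Pk) big_split_ord /=.
under eq_bigr do rewrite ltn_ord.
under [X in _ + X]eq_bigr do rewrite ltnNge leq_addr /=.
by rewrite !sumr_const !card_ord natrD natrM mulNrn; ring.
Qed.

Definition qform k (S : 'M[R]_k) (v : 'rV[R]_k) : R := (v *m S *m v^T) 0 0.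

Lemma qformE k (S : 'M[R]_k) v : v *m S *m v^T = (qform S v)%:M.
Proof. exact: mx11_scalar. Qed.

(** The rows of K span the orthogonal complement of v, the kernel of S v^T, which is complementary
    to v because [qform S v] is nonzero. *)
Lemma split_off k (S : 'M[R]_k.+1) (v : 'rV[R]_k.+1) :
  S^T = S -> S \in unitmx -> qform S v != 0 ->
  exists (K : 'M[R]_(k, k.+1)), let A : 'M[R]_k.+1 := col_mx v K in
  [/\ A \in unitmx, (K *m S *m K^T)^T = K *m S *m K^T,
    K *m S *m K^T \in unitmx &
    A *m S *m A^T = block_mx (qform S v)%:M 0 0 (K *m S *m K^T) :> 'M_(1 + k)].
Proof.
move=> ST SU qv; pose y := S *m v^T.
have y0 : y != 0.
  by apply: contraNneq qv => y0; rewrite /qform -mulmxA -/y y0 mulmx0 mxE.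
have rk : \rank (kermx y) = k.
  rewrite mxrank_ker; suff -> : \rank y = 1%N by rewrite subn1.
  by apply/eqP; rewrite eqn_leq rank_leq_col lt0n mxrank_eq0.
have [K [KK Kfree]] : exists K : 'M[R]_(k, k.+1), K *m y = 0 /\ row_free K.
  move: (row_base (kermx y)) (row_base_free (kermx y)) (eq_row_base (kermx y)).
  by rewrite rk => K Kf KE; exists K; split=> //; apply/sub_kermxP; rewrite KE.
exists K; set A := col_mx v K => /=.
have AU : A \in unitmx.
  rewrite -row_free_unit -kermx_eq0; apply/eqP/row_matrixP => i.
  have /sub_kermxP := row_sub i (kermx A); move: (row i _) => u.
  rewrite row0 -[u](@hsubmxK _ 1 1 k) mul_row_col => uA.
  have : lsubmx (u : 'rV_(1 + k)) *m (v *m y) = 0.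
    have := congr1 (mulmxr y) uA; rewrite /= mulmxDl -!mulmxA KK mulmx0 addr0.
    by rewrite mul0mx.
  rewrite /y mulmxA qformE mul_mx_scalar => /eqP.
  rewrite scaler_eq0 (negPf qv) /= => /eqP u1.
  move: uA; rewrite u1 mul0mx add0r => /eqP.
  by rewrite mulmx_free_eq0 // => /eqP ->; rewrite row_mx0.
have AE : A *m S *m A^T = block_mx (qform S v)%:M 0 0 (K *m S *m K^T) :> 'M_(1 +
  k).
  rewrite /A tr_col_mx mul_col_mx mul_col_row -qformE; congr block_mx.
    by apply: trmx_inj; rewrite !trmx_mul trmxK ST trmx0 -/y.
  by rewrite -mulmxA -/y.
split=> //; first by rewrite !trmx_mul trmxK ST mulmxA.
have : A *m S *m A^T \in unitmx by rewrite !unitmx_mul AU SU unitmx_tr AU.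
rewrite AE unitmxE (@det_ublock _ 1 k) unitrM -!unitmxE => /andP[_]; exact.
Qed.

Lemma qform_neq0 k (S : 'M[R]_k) : S^T = S -> S != 0 ->
  exists v, qform S v != 0.
Proof.
move=> ST /matrix0Pn[i [j Sij]].
pose e a : 'rV[R]_k := delta_mx 0 a.
have eS a b : (e a *m S *m (e b)^T) 0 0 = S a b.
  by rewrite trmx_delta mul_mx_deltaE mul_delta_mxE !eqxx mulr1 mul1r.
have qe a : qform S (e a) = S a a by exact: eS.
have qD : qform S (e i + e j) = S i i + S j j + 2 * S i j.
  rewrite /qform linearD /= !mulmxDl !mulmxDr.
  have mD (X Y : 'M[R]_1) : (X + Y) 0 0 = X 0 0 + Y 0 0 by rewrite mxE.
  have Sji : S j i = S i j by rewrite -{1}ST mxE.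
  by rewrite !mD !eS Sji; ring.
have [i0|i0] := eqVneq (S i i) 0; last by exists (e i); rewrite qe.
have [j0|j0] := eqVneq (S j j) 0; last by exists (e j); rewrite qe.
exists (e i + e j); rewrite qD i0 j0 !add0r mulf_neq0 // pnatr_eq0 //.
Qed.

Lemma qform_mul m k (A : 'M[R]_(m, k)) S u :
  qform S (u *m A) = qform (A *m S *m A^T) u.
Proof. by rewrite /qform trmx_mul !mulmxA. Qed.

Lemma qform_scale k (S : 'M[R]_k) a v : qform S (a *: v) = a ^+ 2 * qform S v.
Proof.
by rewrite /qform linearZ /= -!scalemxAl -scalemxAr scalerA mxE expr2.
Qed.

Lemma qform_normalize k (S : 'M[R]_k) v : qform S v != 0 ->
  exists w, qform S w = Num.sg (qform S v).
Proof.
move=> q0; exists ((Num.sqrt `|qform S v|)^-1 *: v).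
rewrite qform_scale exprVn sqr_sqrtr ?normr_ge0 // {2}[qform S v]numEsg.
by rewrite mulrCA mulVf ?mulr1 // normr_eq0.
Qed.

(* A negative vector is split off only when no positive one is left, so the signs
   come out sorted. *)
Lemma sylvester k (S : 'M[R]_k) : S^T = S -> S \in unitmx ->
  exists (A : 'M[R]_k) (P : nat),
    (P <= k)%N /\ A *m S *m A^T = sgn_mx k P.
Proof.
elim: k S => [|k IH] S ST SU.
  by exists 1%:M, 0%N; split=> //; apply/matrixP; case.
have step c v : c != 0 -> qform S v = c -> exists (A : 'M[R]_k.+1) P,
    [/\ (P <= k)%N, A *m S *m A^T = block_mx c%:M 0 0 (sgn_mx k P) :> 'M_(1 + k)
      &
     ((0 < P)%N -> exists w, 0 < qform S w)].
  move=> c0 qv; have q0 : qform S v != 0 by rewrite qv.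
  have [K [_ KT KU AE]] := split_off ST SU q0.
  have [B [P [Pk BE]]] := IH _ KT KU.
  pose D : 'M[R]_(1 + k) := block_mx 1%:M 0 0 B.
  pose C : 'M[R]_(1 + k) := col_mx v K.
  exists (D *m C), P; split=> //.
    have -> : D *m C *m S *m (D *m C)^T = D *m (C *m S *m C^T) *m D^T.
      by rewrite trmx_mul !mulmxA.
    rewrite /C AE qv /D tr_block_mx !trmx0 trmx1.
    rewrite mulmx_block !(mul0mx, mulmx0, mul1mx, addr0, add0r).
    by rewrite mulmx_block !(mul0mx, mulmx0, mulmx1, addr0, add0r) BE.
  move=> P0; pose i := Ordinal (leq_trans P0 Pk).
  exists (delta_mx 0 i *m B *m K); rewrite -mulmxA mulmxA.
  rewrite !qform_mul BE /qform trmx_delta mul_mx_deltaE mul_delta_mxE sgn_mxE.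
  by rewrite P0 !eqxx mulr1 mul1r ltr01.
have [[v qv]|no] := boolp.pselect (exists v, 0 < qform S v).
  have [w qw] := qform_normalize (lt0r_neq0 qv); rewrite gtr0_sg // in qw.
  have [A [P [Pk AE _]]] := step _ _ (oner_neq0 R) qw.
  by exists A, P.+1; rewrite ltnS sgn_mxS.
have S0 : S != 0 by apply: contraTneq SU => ->; rewrite unitr0.
have [v qv] := qform_neq0 ST S0.
have qv0 : qform S v < 0.
  by rewrite lt_neqAle qv leNgt; apply/negP => h; apply: no; exists v.
have [w qw] := qform_normalize qv; rewrite ltr0_sg // in qw.
have N1 : -1 != 0 :> R by rewrite oppr_eq0 oner_neq0.
have [A [[|P] [Pk AE Ppos]]] := step _ _ N1 qw; last by case: no; apply: Ppos.
by exists A, 0%N; rewrite sgn_mx0S raddfN /= in AE *.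
Qed.

Lemma sylvester_unit k (S A : 'M[R]_k) P :
  A *m S *m A^T = sgn_mx k P -> A \in unitmx.
Proof.
move=> AE; have : A *m (S *m A^T *m sgn_mx k P) = 1%:M.
  by rewrite !mulmxA AE sgn_mx_sqr.
by case/mulmx1_unit.
Qed.

Lemma row_sqr_ge0 k (v : 'rV[R]_k) : 0 <= (v *m v^T) 0 0.
Proof. by rewrite mxE sumr_ge0 // => i _; rewrite mxE -expr2 sqr_ge0. Qed.

Lemma row_sqr_eq0 k (v : 'rV[R]_k) : (v *m v^T) 0 0 = 0 -> v = 0.
Proof.
rewrite mxE => /eqP; rewrite psumr_eq0 => [/allP h|i _]; last first.
  by rewrite mxE -expr2 sqr_ge0.
apply/rowP => i; rewrite mxE; apply/eqP; rewrite -(sqrf_eq0 (v 0 i)).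
by have := h i (mem_index_enum _); rewrite mxE -expr2.
Qed.

(* The form S1 is positive on the row space of 1 + S1, while S2 is negative on
   that of 1 - S2; both spaces meet trivially once A identifies the forms. *)
Lemma invol_congr_le n (S1 S2 A : 'M[R]_n) :
  S1 *m S1 = 1%:M -> S2 *m S2 = 1%:M ->
  A *m S2 *m A^T = S1 -> \tr S1 <= \tr S2.
Proof.
move=> S11 S22 AE.
have AU : A \in unitmx.
  have : A *m (S2 *m A^T *m S1) = 1%:M by rewrite !mulmxA AE S11.
  by case/mulmx1_unit.
have half (S : 'M[R]_n) : S *m S = 1%:M ->
    let E := 2^-1 *: (1%:M + S) in E *m E = E /\ \tr E = 2^-1 * (n%:R + \tr S).
  move=> SS E; split; last by rewrite linearZ linearD /= mxtrace1.
  rewrite /E -scalemxAl -scalemxAr mulmxDl mul1mx mulmxDr mulmx1 SS.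
  rewrite [S + 1%:M]addrC -mulr2n -scaler_nat !scalerA.
  by congr (_ *: _); field.
pose E1 := 2^-1 *: (1%:M + S1); pose E2 := 2^-1 *: (1%:M - S2).
have [E1i trE1] := half _ S11.
have [|E2i trE2] := half (- S2); first by rewrite mulNmx mulmxN opprK.
rewrite -/E1 -/E2 linearN /= in E1i trE1 E2i trE2.
have E1S : E1 *m S1 = E1.
  by rewrite /E1 -scalemxAl mulmxDl mul1mx S11 addrC.
have E2S : E2 *m S2 = - E2.
  by rewrite /E2 -scalemxAl mulmxBl mul1mx S22 -scalerN opprB.
have cap0 : (E1 *m A :&: E2 = 0)%MS.
  apply/eqP; rewrite -submx0; apply/row_subP => i.
  have := row_sub i (E1 *m A :&: E2)%MS; rewrite sub_capmx.
  move: (row i _) => x /andP[/submxP[u xu] /submxP[w xw]].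
  have x1 : x *m S2 *m x^T = (u *m E1) *m (u *m E1)^T.
    have -> : x *m S2 *m x^T = u *m E1 *m (A *m S2 *m A^T) *m (u *m E1)^T.
      by rewrite xu !trmx_mul !mulmxA.
    by rewrite AE -(mulmxA u) E1S.
  have x2 : x *m S2 *m x^T = - (x *m x^T).
    by rewrite xw -[w *m E2 *m S2]mulmxA E2S mulmxN mulNmx.
  rewrite submx0; apply/eqP/row_sqr_eq0/eqP.
  rewrite eq_le row_sqr_ge0 andbT -oppr_ge0.
  suff -> : - (x *m x^T) 0 0 = (u *m E1 *m (u *m E1)^T) 0 0 by exact:
    row_sqr_ge0.
  by rewrite -x1 x2 [RHS]mxE.
have rk : (\rank E1 + \rank E2 <= n)%N.
  have <- : \rank (E1 *m A) = \rank E1 by rewrite mxrankMfree // row_free_unit.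
  by rewrite -(mxrank_disjoint_sum cap0) rank_leq_col.
rewrite -(ler_nat R) natrD -(mxtrace_idem E1i) -(mxtrace_idem E2i) in rk.
rewrite trE1 trE2 in rk; lra.
Qed.

(** Equality follows from [invol_congr_le] for A and for its inverse. The trace of a symmetric
    involution is its signature, so this contains the law of inertia. The sizes m and n are kept
    apart because in use they agree only propositionally. *)
Lemma invol_congr_trace m n (S1 : 'M[R]_m) (S2 : 'M[R]_n) (A : 'M[R]_(n, m)) :
  m = n -> S1 *m S1 = 1%:M -> S2 *m S2 = 1%:M ->
  A^T *m S2 *m A = S1 -> \tr S1 = \tr S2.
Proof.
move=> mn; case: _ / mn in S2 A *; move=> S11 S22 AE.
apply/eqP; rewrite eq_le; apply/andP; split.
  by apply: (invol_congr_le (A := A^T) S11 S22); rewrite trmxK.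
have AU : A \in unitmx.
  have : (S1 *m A^T *m S2) *m A = 1%:M by rewrite -!mulmxA (mulmxA A^T) AE.
  by case/mulmx1_unit.
apply: (invol_congr_le (A := (invmx A)^T) S22 S11).
by rewrite trmxK -AE trmx_inv !mulmxA mulVmx ?unitmx_tr // mul1mx mulmxK.
Qed.

End Sylvester.

(** * Congruence of labelled forms *)

Definition label_count (T : eqType) n (l : 'I_n -> T) (x : T) : nat :=
  #|[pred a | l a == x]|.

Section Labelled.
Variables (R : rcfType) (G : groupType) (n : nat) (l : 'I_n -> G).
Implicit Types (Phi : 'M[R]_n) (x : G).

Definition label_orth Phi := forall a b, Phi a b != 0 -> (l a * l b)%g = 1%g.

(** C embeds a standard form isometrically into the part of label x. When k is the multiplicity of
    x, P is the inertia index there; an embedding is moved along permutations by mere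
    composition. *)
Definition label_sig Phi x (k P : nat) := exists2 C : 'M[R]_(n, k),
  forall a j, C a j != 0 -> l a = x & C^T *m Phi *m C = sgn_mx R k P.

Definition label_incl x : 'M[R]_(n, label_count l x) :=
  \matrix_(a, j) (a == enum_val j)%:R.

Lemma label_incl_supp x a j : label_incl x a j != 0 -> l a = x.
Proof.
rewrite mxE; case: (a =P _) => [-> _|_]; last by rewrite eqxx.
by apply/eqP; have := enum_valP j; rewrite inE.
Qed.

Lemma label_inclK x : (label_incl x)^T *m label_incl x = 1%:M.
Proof.
apply/matrixP => i j; rewrite mxE (bigD1 (enum_val i)) //= big1 ?addr0.
  by rewrite !mxE eqxx mul1r (inj_eq enum_val_inj).
by move=> a /negPf ai; rewrite !mxE ai mul0r.
Qed.

Definition label_mask x : 'M[R]_n := diag_mx (\row_a (l a == x)%:R).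

Lemma label_incl_mask x : label_incl x *m (label_incl x)^T = label_mask x.
Proof.
apply/matrixP => a b; rewrite !mxE.
have [ax|ax] := eqVneq (l a) x; last first.
  rewrite mul0rn big1 // => j _; rewrite !mxE; case: eqP => [aj|_];
    last by rewrite mul0r.
  by have := enum_valP j; rewrite inE -aj (negPf ax).
have aP : a \in [pred a | l a == x] by rewrite inE ax.
rewrite (bigD1 (enum_rank_in aP a)) //= big1 => [|j ja].
  by rewrite !mxE enum_rankK_in // eqxx mul1r addr0 eq_sym.
rewrite !mxE; case: eqP => [aj|_]; last by rewrite mul0r.
by move: ja; rewrite [X in enum_rank_in aP X]aj enum_valK_in eqxx.
Qed.

Lemma label_mask_supp x k (C : 'M[R]_(n, k)) :
  (forall a j, C a j != 0 -> l a = x) -> label_mask x *m C = C.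
Proof.
move=> CP; apply/matrixP => a j; rewrite mul_diag_mx !mxE.
by have [->|/CP ->] := eqVneq (C a j) 0; rewrite ?mulr0 // eqxx mul1r.
Qed.

Lemma label_mask_suppT x k (C : 'M[R]_(n, k)) :
  (forall a j, C a j != 0 -> l a = x) -> C^T *m label_mask x = C^T.
Proof.
move=> CP; apply: trmx_inj; rewrite trmx_mul trmxK /label_mask tr_diag_mx.
exact: label_mask_supp.
Qed.

Lemma label_maskC Phi x : label_orth Phi ->
  label_mask x *m Phi = Phi *m label_mask x^-1%g.
Proof.
move=> PhiO; apply/matrixP => a b; rewrite mul_diag_mx mul_mx_diag !mxE mulrC.
have [->|/PhiO ab] := eqVneq (Phi a b) 0; first by rewrite !mul0r.
congr (_ * _%:R); congr nat_of_bool; apply/eqP/eqP => [<-|bx].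
  by apply: (mulgI (l a)); rewrite ab mulgV.
by apply: (mulIg (l b)); rewrite ab bx mulgV.
Qed.

Lemma label_mask_comm Phi x : label_orth Phi -> (x * x)%g = 1%g ->
  label_mask x *m Phi = Phi *m label_mask x.
Proof.
move=> PhiO xx; rewrite label_maskC //; congr (_ *m label_mask _).
by apply: (mulgI x); rewrite mulgV xx.
Qed.

Lemma label_orth_inv Phi : Phi \in unitmx -> label_orth Phi ->
  label_orth (invmx Phi).
Proof.
move=> PhiU PhiO c e ce; pose x := l e.
have : invmx Phi *m label_mask x = label_mask x^-1%g *m invmx Phi.
  apply: (can_inj (mulKmx PhiU)); apply: (can_inj (mulmxK PhiU)).
  by rewrite !mulmxA mulmxV // mul1mx mulmxKV // label_maskC.
move/matrixP/(_ c e); rewrite mul_mx_diag mul_diag_mx !mxE eqxx mulr1.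
case: eqP => [-> _|_]; first by rewrite mulVg.
by rewrite mul0r => /eqP; rewrite (negPf ce).
Qed.

Definition label_block Phi x : 'M[R]_(label_count l x) :=
  (label_incl x)^T *m Phi *m label_incl x.

(** When x^2 = 1 the form Phi preserves the label x, so restriction to the block is compatible with
    the product. *)
Lemma label_blockM Phi Psi x : label_orth Phi -> (x * x)%g = 1%g ->
  label_block Phi x *m label_block Psi x = label_block (Phi *m Psi) x.
Proof.
move=> PhiO xx; pose J := label_incl x.
transitivity (J^T *m (Phi *m (J *m J^T)) *m Psi *m J).
  by rewrite /label_block !mulmxA.
rewrite label_incl_mask -label_mask_comm // -label_incl_mask !mulmxA.
by rewrite label_inclK mul1mx /label_block !mulmxA.
Qed.

Lemma label_block1 x : label_block 1%:M x = 1%:M.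
Proof. by rewrite /label_block mulmx1 label_inclK. Qed.

Lemma label_block_tr Phi x : (label_block Phi x)^T = label_block Phi^T x.
Proof. by rewrite /label_block !trmx_mul trmxK mulmxA. Qed.

Lemma label_sig_ex Phi x : Phi^T = Phi -> Phi \in unitmx -> label_orth Phi ->
  (x * x)%g = 1%g ->
  exists P, (P <= label_count l x)%N /\ label_sig Phi x (label_count l x) P.
Proof.
move=> PhiT PhiU PhiO xx; have [||A [P [Pk AE]]] :=
  @sylvester _ _ (label_block Phi x).
- by rewrite label_block_tr PhiT.
- have : label_block Phi x *m label_block (invmx Phi) x = 1%:M.
    by rewrite label_blockM // mulmxV // label_block1.
  by case/mulmx1_unit.
exists P; split=> //; exists (label_incl x *m A^T).
  move=> a j; rewrite mxE => ne; apply/eqP; apply: contraNT ne => ax.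
  rewrite big1 // => i _; have [->|/label_incl_supp] :=
    eqVneq (label_incl x a i) 0.
    by rewrite mul0r.
  by move/eqP; rewrite (negPf ax).
by rewrite trmx_mul trmxK !mulmxA -AE /label_block !mulmxA.
Qed.

Lemma tr_label_block Phi x : \tr (label_block Phi x) = \sum_(a | l a == x) Phi a
  a.
Proof.
rewrite /label_block -mulmxA mxtrace_mulC -mulmxA label_incl_mask big_mkcond.
apply: eq_bigr => a _; rewrite mul_mx_diag !mxE.
by case: eqP; rewrite ?mulr1 ?mulr0.
Qed.

(** The block is then an involution congruent to [sgn_mx], so its trace recovers P. This links
    sigma, known as a trace on [PhiB], with Sylvester indices. *)
Lemma label_sig_invol Phi x P : Phi *m Phi = 1%:M -> label_orth Phi ->
  (x * x)%g = 1%g -> (P <= label_count l x)%N ->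
  label_sig Phi x (label_count l x) P ->
  \sum_(a | l a == x) Phi a a = (2 * P)%:R - (label_count l x)%:R.
Proof.
move=> PP PhiO xx Pk [C CP CE]; rewrite -tr_label_block -(mxtrace_sgn_mx R Pk).
apply/esym; apply: (invol_congr_trace (A := (label_incl x)^T *m C)) => //.
- exact: sgn_mx_sqr.
- by rewrite label_blockM // PP label_block1.
pose J := label_incl x.
transitivity (C^T *m (J *m J^T) *m Phi *m ((J *m J^T) *m C)).
  by rewrite /label_block trmx_mul trmxK !mulmxA.
by rewrite label_incl_mask label_mask_supp // label_mask_suppT.
Qed.

(* pos selects one label of each pair {x, x^-1} with x <> x^-1: the congruence is
   the identity there and Phi2^-1 Phi1 on the other labels. *)
Lemma labelled_congr_same (Phi1 Phi2 : 'M[R]_n) (pos : pred G) :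
  Phi1^T = Phi1 -> Phi1 *m Phi1 = 1%:M -> label_orth Phi1 ->
  Phi2^T = Phi2 -> Phi2 \in unitmx -> label_orth Phi2 ->
  (forall a, (l a * l a)%g != 1%g -> pos (l a)^-1%g = ~~ pos (l a)) ->
  (forall x, (x * x)%g = 1%g -> exists P,
     label_sig Phi1 x (label_count l x) P /\
     label_sig Phi2 x (label_count l x) P) ->
  exists2 A : 'M[R]_n, A^T *m Phi2 *m A = Phi1 &
    forall a b, A a b != 0 -> l a = l b.
Proof.
move=> P1T P11 P1O P2T P2U P2O posP sig.
have /boolp.choice[D DP] : forall x, exists D : 'M[R]_n, (x * x)%g = 1%g ->
    [/\ forall a b, D a b != 0 -> l a = x /\ l b = x
      & D^T *m Phi2 *m D = label_mask x *m Phi1].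
  move=> x; have [xx|/eqP xx] := eqVneq (x * x)%g 1%g; last by exists 0.
  have [P [[C1 C1P C1E] [C2 C2P C2E]]] := sig x xx.
  pose J := label_incl x; pose I := sgn_mx R (label_count l x) P.
  have C1J : J *m (J^T *m C1) = C1.
    by rewrite mulmxA label_incl_mask label_mask_supp.
  (* On the block of label x the inverse of C1 is I C1^T Phi1, because C1 is an isometry and I
     squares to 1. The witness C2 I C1^T Phi1 below is thus C2 after the inverse of C1. *)
  have C1inv : C1 *m I *m C1^T *m Phi1 = label_mask x.
    have : (J^T *m C1) *m (I *m C1^T *m Phi1 *m J) = 1%:M.
      apply: mulmx1C; rewrite -!mulmxA (mulmxA J) label_incl_mask.
      by rewrite label_mask_supp // !mulmxA -(mulmxA I) -(mulmxA I) C1E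
        sgn_mx_sqr.
    move/(congr1 (fun M => J *m M *m J^T)); rewrite mulmx1 label_incl_mask =>
      <-.
    transitivity ((label_mask x *m C1) *m I *m (C1^T *m (Phi1 *m label_mask
      x))).
      rewrite label_mask_supp // -label_mask_comm // (mulmxA C1^T).
      by rewrite label_mask_suppT // !mulmxA.
    by rewrite -label_incl_mask !mulmxA.
  exists (C2 *m I *m C1^T *m Phi1) => _; split=> [a b|].
    have e1 : label_mask x *m (C2 *m I *m C1^T *m Phi1) = C2 *m I *m C1^T *m
      Phi1.
      by rewrite !mulmxA label_mask_supp.
    have e2 : C2 *m I *m C1^T *m Phi1 *m label_mask x = C2 *m I *m C1^T *m Phi1.
      by rewrite -mulmxA -label_mask_comm // mulmxA -(mulmxA _ C1^T)
        label_mask_suppT.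
    move=> ne; split; apply/eqP; apply: contraNT ne => /negPf lx; apply/eqP.
      by rewrite -e1 mul_diag_mx !mxE lx mul0r.
    by rewrite -e2 mul_mx_diag !mxE lx mulr0.
  rewrite !trmx_mul trmxK P1T sgn_mxT.
  transitivity (Phi1 *m (C1 *m I *m (C2^T *m Phi2 *m C2) *m I *m C1^T *m Phi1)).
    by rewrite !mulmxA.
  rewrite C2E -/I -(mulmxA C1 I) sgn_mx_sqr mulmx1 C1inv.
  by rewrite label_mask_comm.
pose Psi := invmx Phi2 *m Phi1.
pose Q x := if (x * x == 1)%g then D x else if pos x then 1%:M else Psi.
pose A : 'M[R]_n := \matrix_(c, a) Q (l a) c a.
have QA a b : (A^T *m Phi2 *m A) a b = ((Q (l a))^T *m Phi2 *m Q (l b)) a b.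
  rewrite !mxE; apply: eq_bigr => c _; rewrite [A c b]mxE; congr (_ * _).
  by rewrite !mxE; apply: eq_bigr => e _; rewrite !mxE.
have AP a b : A a b != 0 -> l a = l b.
  rewrite mxE /Q; case: (_ =P 1%g) => [xx|_].
    by have [h _] := DP _ xx => /h[].
  case: ifP => _; first by rewrite mxE; case: (a =P b) => [->|_]; rewrite ?eqxx.
  rewrite mxE => ne; apply/eqP; apply: contraNT ne => ab; apply/eqP.
  apply: big1 => c _; have [->|/P1O cb] := eqVneq (Phi1 c b) 0;
    first by rewrite mulr0.
  have [->|/(label_orth_inv P2U P2O) ac] := eqVneq (invmx Phi2 a c) 0.
    by rewrite mul0r.
  case/eqP: ab; apply: (mulIg (l c)); rewrite ac.
  have -> : l b = (l c)^-1%g by apply: (mulgI (l c)); rewrite cb mulgV.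
  by rewrite mulVg.
exists A => //; apply/matrixP => a b.
have [lab|lab] := eqVneq (l a * l b)%g 1%g; last first.
  transitivity (0 : R); last first.
    by apply/esym/eqP; apply: contraNT lab => /P1O ->.
  rewrite mxE big1 // => c _; have [->|/AP cb] := eqVneq (A c b) 0;
    first by rewrite mulr0.
  rewrite mxE big1 ?mul0r // => e _; rewrite mxE.
  have [->|/AP ea] := eqVneq (A e a) 0; first by rewrite mul0r.
  have [->|/P2O ec] := eqVneq (Phi2 e c) 0; first by rewrite mulr0.
  by rewrite -ea -cb ec eqxx in lab.
have lb : l b = (l a)^-1%g by apply: (mulgI (l a)); rewrite lab mulgV.
have lxx : (l b * l b == 1)%g = (l a * l a == 1)%g.
  by rewrite lb -invMg invg_eq1.
rewrite QA /Q lxx; case: (_ =P 1%g) => [xx|/eqP xx].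
  have lba : l b = l a by rewrite lb; apply: (mulgI (l a)); rewrite mulgV xx.
  rewrite lba; have [_ ->] := DP _ xx.
  by rewrite mul_diag_mx !mxE eqxx mul1r.
rewrite lb posP //; case: (pos (l a)) => /=.
  by rewrite trmx1 mul1mx mulKVmx.
by rewrite mulmx1 trmx_mul trmx_inv P1T P2T mulmxKV.
Qed.
End Labelled.

Lemma count_codom (T : eqType) n (l : 'I_n -> T) x :
  count_mem x (codom l) = label_count l x.
Proof.
rewrite codomE count_map /label_count cardE -size_filter -filter_predI.
by congr size; apply: eq_filter => a; rewrite /= andbT.
Qed.

Lemma label_perm (T : eqType) n (l1 l2 : 'I_n -> T) :
  label_count l1 =1 label_count l2 -> exists s : 'S_n, forall a,
    l2 (s a) = l1 a.
Proof.
move=> l12; pose t1 := [tuple l1 i | i < n]; pose t2 := [tuple l2 i | i < n].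
have : perm_eq t1 t2.
  have tE (f : 'I_n -> T) : tval [tuple f i | i < n] = codom f.
    by rewrite codomE -val_ord_tuple.
  by apply/allP => x _; apply/eqP; rewrite !tE !count_codom.
case/tuple_permP => s /val_inj st; exists s => a.
by have := congr1 (fun t => tnth t a) st; rewrite !tnth_mktuple.
Qed.

Lemma label_count_size (T : eqType) n1 n2 (l1 : 'I_n1 -> T) (l2 : 'I_n2 -> T) :
  label_count l1 =1 label_count l2 -> n1 = n2.
Proof.
move=> l12; have : perm_eq (codom l1) (codom l2).
  by apply/allP => x _; apply/eqP; rewrite !count_codom.
by move/perm_size; rewrite !size_codom !card_ord.
Qed.

Lemma labelled_congr (R : rcfType) (G : groupType) n1 n2 (l1 : 'I_n1 -> G)
    (l2 : 'I_n2 -> G) (Phi1 : 'M[R]_n1) (Phi2 : 'M[R]_n2) (pos : pred G) :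
  Phi1^T = Phi1 -> Phi1 *m Phi1 = 1%:M -> label_orth l1 Phi1 ->
  Phi2^T = Phi2 -> Phi2 \in unitmx -> label_orth l2 Phi2 ->
  label_count l1 =1 label_count l2 ->
  (forall a, (l1 a * l1 a)%g != 1%g -> pos (l1 a)^-1%g = ~~ pos (l1 a)) ->
  (forall x, (x * x)%g = 1%g -> exists P,
     label_sig l1 Phi1 x (label_count l1 x) P /\
     label_sig l2 Phi2 x (label_count l1 x) P) ->
  exists2 A : 'M[R]_(n2, n1), A^T *m Phi2 *m A = Phi1 &
    forall b a, A b a != 0 -> l2 b = l1 a.
Proof.
move=> P1T P11 P1O P2T P2U P2O l12 posP sig.
have n12 := label_count_size l12.
case: _ / n12 in l2 Phi2 P2T P2U P2O l12 sig *.
have [s sP] := label_perm l12.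
pose Q := perm_mx s : 'M[R]_n1.
have QE (k : nat) (C : 'M[R]_(n1, k)) a j : (Q *m C) a j = C (s a) j.
  by rewrite -row_permE mxE.
have QQ : Q^T *m Q = 1%:M by rewrite tr_perm_mx -perm_mxM mulVg perm_mx1.
have QQ' : Q *m Q^T = 1%:M by rewrite tr_perm_mx -perm_mxM mulgV perm_mx1.
have E a b : (Q *m Phi2 *m Q^T) a b = Phi2 (s a) (s b).
  by rewrite -mulmxA QE -[_ *m _]trmxK trmx_mul trmxK mxE QE mxE.
have [|||||A AE AP] := @labelled_congr_same _ _ _ l1 Phi1 (Q *m Phi2 *m Q^T) pos
  P1T P11 P1O.
- by rewrite !trmx_mul trmxK P2T mulmxA.
- by rewrite !unitmx_mul P2U unitmx_tr !unitmx_perm.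
- by move=> a b; rewrite E => /P2O; rewrite !sP.
- exact: posP.
- move=> x xx; have [P [sig1 [C CP CE]]] := sig x xx.
  exists P; split=> //; exists (Q *m C).
    by move=> a j; rewrite QE => /CP; rewrite sP.
  rewrite trmx_mul !mulmxA -(mulmxA _ Q^T) QQ mulmx1.
  by rewrite -(mulmxA _ Q^T) QQ mulmx1.
exists (Q^T *m A); first by rewrite trmx_mul trmxK !mulmxA -AE !mulmxA.
move=> b a; have := QE _ (Q^T *m A) (s^-1 b)%g a.
by rewrite mulmxA QQ' mul1mx permKV => <- /AP <-; rewrite -sP permKV.
Qed.

(** * The form of GammaB *)

Lemma big_tagnat (V : nmodType) m (p_ : 'I_m -> nat)
    (F : forall i, 'I_(p_ i) -> V) :
  \sum_(b < \sum_i p_ i) F (tagnat.sig1 b) (tagnat.sig2 b)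
    = \sum_i \sum_(j < p_ i) F i j.
Proof. by rewrite sig_big_dep (reindex _ tagnat.sig_bij_on). Qed.

Lemma mul_mxdiag (F : fieldType) m (p_ : 'I_m -> nat)
    (B C : forall i, 'M[F]_(p_ i)) :
  mxdiag B *m mxdiag C = mxdiag (fun i => B i *m C i).
Proof.
rewrite {2}/mxdiag mul_mxdiag_mxblock; apply/eq_mxblock => i j.
by case: eqVneq => [->|_]; rewrite ?conform_mx_id ?mulmx0.
Qed.

Section PhiBFacts.
Variables (R : rcfType) (G : groupType).
Variables (kappa : {fsfun G -> nat with 0%N}) (sigma : G -> int).
Variables (m r' : nat) (t : 'I_m -> G) (u : 'I_r' -> G).

Local Notation N := (sizeB kappa t u).
Local Notation Phi := (PhiB R kappa sigma t u).
Local Notation lab := (@labelB G kappa m r' t u).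

Lemma S_selfE x : S_self R kappa sigma x = sgn_mx R (kappa x) (p_coef kappa
  sigma x).
Proof. by []. Qed.

Lemma PhiBT : Phi^T = Phi.
Proof.
rewrite /PhiB tr_block_mx !trmx0 !tr_mxdiag; congr block_mx; apply/eq_mxdiagP =>
  i.
  by rewrite S_selfE sgn_mxT.
by rewrite /S_pair tr_block_mx !trmx0 trmx1.
Qed.

Lemma PhiB_sqr : Phi *m Phi = 1%:M.
Proof.
rewrite /PhiB mulmx_block !(mulmx0, mul0mx, addr0, add0r) !mul_mxdiag.
rewrite [RHS]scalar_mx_block; congr block_mx; rewrite -mxdiagZ;
  apply/eq_mxdiagP => i.
  by rewrite S_selfE sgn_mx_sqr.
by rewrite /S_pair mulmx_block !(mulmx0, mul0mx, mulmx1, addr0,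
  add0r) -scalar_mx_block.
Qed.

Lemma lab_lshift b : lab (lshift _ b) = t (tagnat.sig1 b).
Proof. by rewrite /labelB -[lshift _ b]/(unsplit (inl b)) unsplitK. Qed.

Lemma lab_rshift b : lab (rshift _ b) =
  if split (tagnat.sig2 b) is inl _ then u (tagnat.sig1 b)
  else (u (tagnat.sig1 b))^-1%g.
Proof. by rewrite /labelB -[rshift _ b]/(unsplit (inr b)) unsplitK. Qed.

Lemma labelB_sum (V : nmodType) (f : G -> V) :
  \sum_(a < N) f (lab a) = \sum_i f (t i) *+ kappa (t i)
    + \sum_j (f (u j) *+ kappa (u j) + f (u j)^-1%g *+ kappa (u j)).
Proof.
rewrite big_split_ord /=; congr (_ + _).
  under eq_bigr do rewrite lab_lshift.
  rewrite (big_tagnat (fun i _ => f (t i))).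
  by apply: eq_bigr => i _; rewrite sumr_const card_ord.
under eq_bigr do rewrite lab_rshift.
rewrite (big_tagnat (fun i (j : 'I_(kappa (u i) + kappa (u i))) => f
   (if split j is inl _ then u i else (u i)^-1%g))).
apply: eq_bigr => i _; rewrite big_split_ord /=; congr (_ + _).
  rewrite -[in RHS](card_ord (kappa (u i))) -sumr_const; apply: eq_bigr => j _.
  by rewrite -[lshift _ j]/(unsplit (inl j)) unsplitK.
rewrite -[in RHS](card_ord (kappa (u i))) -sumr_const; apply: eq_bigr => j _.
by rewrite -[rshift _ j]/(unsplit (inr j)) unsplitK.
Qed.

(** The hyperbolic blocks [S_pair] have zero diagonal, so only the labels t_i contribute. *)
Lemma PhiB_diag_sum (f : pred G) :
  \sum_(a < N | f (lab a)) Phi a a = \sum_(i | f (t i)) \tr (S_self R kappa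
    sigma (t i)).
Proof.
rewrite big_mkcond big_split_ord /= [X in _ + X]big1 ?addr0.
  under eq_bigr do rewrite lab_lshift block_mxEul mxE eqxx conform_mx_id.
  rewrite (big_tagnat (fun i (j : 'I_(kappa (t i))) =>
    if f (t i) then S_self R kappa sigma (t i) j j else 0)).
  rewrite [RHS]big_mkcond; apply: eq_bigr => i _.
  by case: ifP => _ //; rewrite big1.
move=> b _; case: ifP => // _; rewrite block_mxEdr mxE eqxx conform_mx_id.
rewrite /S_pair; case: (split_ordP (tagnat.sig2 b)) => j ->.
  by rewrite block_mxEul mxE.
by rewrite block_mxEdr mxE.
Qed.

Hypothesis supp : support_order kappa t u.

Lemma supp_t i : (t i * t i)%g = 1%g.
Proof. by case: supp => /(_ i) + _; rewrite inE expg2 => /eqP. Qed.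

Lemma PhiB_orth : label_orth lab Phi.
Proof.
move=> a b; case: (split_ordP a) => a' ->; case: (split_ordP b) => b' ->.
- rewrite block_mxEul !lab_lshift mxE.
  case: (tagnat.sig1 a' =P _) => [e _|_]; first by rewrite e supp_t.
  by rewrite mxE eqxx.
- by rewrite block_mxEur mxE eqxx.
- by rewrite block_mxEdl mxE eqxx.
rewrite block_mxEdr !lab_rshift mxE /tagnat.sig1 /tagnat.sig2.
case: (tagnat.sig a') (tagnat.sig b') => [i j] [i' j'] /=.
case: (i =P i') => [ii'|_]; last by rewrite mxE eqxx.
case: _ / ii' in j' *; rewrite conform_mx_id /S_pair.
case: (split_ordP j) => k ->; case: (split_ordP j') => k' ->.
- by rewrite block_mxEul mxE eqxx.
- by rewrite mulgV.
- by rewrite mulVg.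
by rewrite block_mxEdr mxE eqxx.
Qed.

Lemma supp_sum (V : nmodType) (f : G -> V) :
  \sum_i f (t i) + \sum_j (f (u j) + f (u j)^-1%g) = \sum_(x <- finsupp kappa) f
    x.
Proof.
case: supp => _ p; rewrite -(perm_big _ p) !codomE !big_cat /= !big_map.
by rewrite -!enumT !big_enum /= big_split.
Qed.

(** An element of [G2] equals its inverse and would occur twice in the duplicate-free support. *)
Lemma supp_u j : u j \notin @G2 G.
Proof.
case: supp => _ /perm_uniq; rewrite fset_uniq !cat_uniq =>
  /and3P[_ _ /and3P[_ h _]].
apply/negP; rewrite inE expg2 => /eqP uu.
have us : (u j)^-1%g \in [seq (u j)^-1%g | j : 'I_r'] by apply/imageP; exists j.
move/hasPn: h => /(_ _ us) /negP; apply.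
have -> : (u j)^-1%g = u j by apply: (mulgI (u j)); rewrite mulgV uu.
exact: codom_f.
Qed.

Hypothesis kinv : forall x, kappa x^-1%g = kappa x.

Lemma sizeB_weight : N = weight kappa.
Proof. by rewrite /weight -(supp_sum kappa) /=; congr (_ + _)%N;
  apply: eq_bigr => j _; rewrite kinv. Qed.

Lemma sum_supp_pick (V : nmodType) (f : G -> V) x : (kappa x = 0%N ->
  f x = 0) ->
  \sum_(y <- finsupp kappa) (if y == x then f y else 0) = f x.
Proof.
move=> f0; have [xs|xs] := boolP (x \in finsupp kappa).
  rewrite (bigD1_seq x) ?fset_uniq //= eqxx big1 ?addr0 // => y /negPf -> //.
rewrite f0; last by apply/eqP; rewrite memNfinsupp in xs.
rewrite big_seq big1 // => y ys; case: eqP => // yx.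
by rewrite yx (negPf xs) in ys.
Qed.

Lemma labelB_count x : label_count lab x = kappa x.
Proof.
rewrite /label_count -sum1_card big_mkcond /=.
rewrite [LHS](labelB_sum (V := nat) (fun y => if y == x then 1%N else 0%N)).
rewrite -[RHS](@sum_supp_pick nat kappa x) // -supp_sum.
have kE (y : G) k : ((if y == x then 1%N else 0%N) *+ k)%R = (if y == x then k
  else 0)%N.
  by case: eqP => _; rewrite ?mul0rn //; elim: k => // k IH; rewrite mulrS IH.
congr (_ + _); apply: eq_bigr => j _; rewrite !kE //.
by rewrite kinv.
Qed.

Hypothesis par : paramB kappa sigma.

(** The bound and parity of sigma make the division by 2 exact and its result nonnegative, so the
    absolute value in [p_coef] changes nothing. *)
Lemma p_coefE x : x \in @G2 G ->
  (p_coef kappa sigma x <= kappa x)%N /\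
  (2 * p_coef kappa sigma x)%:Z = (kappa x)%:Z + sigma x.
Proof.
case: par => _ _ _ /(_ x) + xG => /(_ xG) [h1 h2]; rewrite /p_coef; lia.
Qed.

Lemma tr_S_self x : x \in @G2 G ->
  \tr (S_self R kappa sigma x) = (sigma x)%:~R.
Proof.
move=> /p_coefE[h1 h2]; rewrite S_selfE mxtrace_sgn_mx //.
have -> : sigma x = (2 * p_coef kappa sigma x)%:Z - (kappa x)%:Z by rewrite h2;
  ring.
by rewrite rmorphB.
Qed.

Lemma PhiB_trace_label x : x \in @G2 G ->
  \sum_(a < N | lab a == x) Phi a a = (sigma x)%:~R.
Proof.
move=> xG; rewrite (PhiB_diag_sum (pred1 x)).
have tG i : t i \in @G2 G by case: supp.
have [_ _ sN sG] := par.
rewrite -(@sum_supp_pick R (fun y => (sigma y)%:~R) x) => [|kx]; last first.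
  by have [] := sG _ xG; rewrite kx leqn0 absz_eq0 => /eqP ->.
rewrite -supp_sum [X in _ = _ + X]big1 ?addr0 => [|j _].
  by rewrite big_mkcond; apply: eq_bigr => i _ /=; case: eqP => // _;
    rewrite tr_S_self.
have uG : (u j)^-1%g \notin @G2 G.
  have := supp_u j; rewrite !inE !expg2 -invMg; apply: contra => /eqP uu.
  by rewrite -[(_ * _)%g]invgK uu invg1.
by rewrite !sN ?supp_u // !if_same addr0.
Qed.

Lemma PhiB_trace : \tr Phi = (signature kappa sigma)%:~R.
Proof.
rewrite /mxtrace (sum_by_label (l := lab) (s := finsupp kappa)) ?fset_uniq //.
  rewrite /signature rmorph_sum /= [RHS]big_mkcond; apply: eq_bigr => x _.
  case: ifP => xG; first exact: PhiB_trace_label.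
  rewrite big1 // => a /eqP ax; apply/eqP; apply: contraFT xG => /PhiB_orth.
  by rewrite ax inE expg2 => ->.
move=> a; rewrite mem_finsupp -labelB_count -lt0n; apply/card_gt0P.
by exists a; rewrite inE.
Qed.

End PhiBFacts.

(** * Transport of gradings *)

Section LieIso.
Variable R : fieldType.

Lemma lie_iso_in m n (L1 : {vspace 'M[R]_m}) (L2 : {vspace 'M[R]_n}) psi X :
  lie_iso L1 L2 psi -> X \in L1 -> psi X \in L2.
Proof. by case=> <- _ _ XL; apply: memv_img. Qed.

Lemma lie_iso_comp m n k (L1 : {vspace 'M[R]_m}) (L2 : {vspace 'M[R]_n})
    (L3 : {vspace 'M[R]_k}) psi chi :
  lie_iso L1 L2 psi -> lie_iso L2 L3 chi -> lie_iso L1 L3 (chi \o psi)%VF.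
Proof.
move=> psi_iso chi_iso; have psiL X : X \in L1 -> psi X \in L2 :=
  lie_iso_in psi_iso.
case: psi_iso chi_iso => [p1 p2 p3] [c1 c2 c3]; split.
- by rewrite limg_comp p1 c1.
- by move=> X Y XL YL; rewrite !lfunE /= => /c2 e; apply: p2 => //; apply: e;
    apply: psiL.
- by move=> X Y XL YL; rewrite !lfunE /= p3 // c3 ?psiL.
Qed.

Lemma lie_iso_inv m n (L1 : {vspace 'M[R]_m}) (L2 : {vspace 'M[R]_n}) psi :
  (forall X Y, X \in L1 -> Y \in L1 -> lie_bracket X Y \in L1) ->
  lie_iso L1 L2 psi ->
  exists2 chi, lie_iso L2 L1 chi & {in L1, cancel psi chi}.
Proof.
move=> L1lie psi_iso; have [p1 p2 p3] := psi_iso.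
(* Only the restriction of psi to L1 is controlled, so psi is composed with the projection to L1
   before a generalized inverse is taken. *)
pose f := (psi \o projv L1)%VF; pose chi := (projv L1 \o f^-1)%VF.
have fL : limg f = L2 by rewrite limg_comp limg_proj p1.
have chiL Y : chi Y \in L1 by rewrite lfunE /= memv_proj.
have chiK Y : Y \in L2 -> psi (chi Y) = Y.
  move=> YL; have : f (f^-1%VF Y) = Y by rewrite limg_lfunVK // fL.
  by rewrite !lfunE.
have chiK' X : X \in L1 -> chi (psi X) = X.
  by move=> XL; apply: p2 => //; rewrite chiK // (lie_iso_in psi_iso).
exists chi => //; split.
- apply/vspaceP => X; apply/memv_imgP/idP => [[Y YL ->]//|XL].
  by exists (psi X); rewrite ?chiK' // (lie_iso_in psi_iso).
- by move=> X Y XL YL /(congr1 psi); rewrite !chiK.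
- move=> X Y XL YL; apply: p2; rewrite ?L1lie //.
  rewrite p3 // !chiK //.
  by rewrite -{1}(chiK X) // -{1}(chiK Y) // -p3 // (lie_iso_in psi_iso) ?L1lie.
Qed.

Lemma grading_transport (G : groupType) m n (L1 : {vspace 'M[R]_m})
    (L2 : {vspace 'M[R]_n}) psi (Gam : G -> {vspace 'M[R]_m}) :
  lie_iso L1 L2 psi -> is_grading L1 Gam ->
  is_grading L2 (fun g => psi @: Gam g)%VS.
Proof.
move=> psi_iso [g1 g2 g3 g4]; have [p1 p2 p3] := psi_iso; split.
- by move=> g; rewrite -p1 limgS.
- move=> Y; rewrite -p1 => /memv_imgP[X XL ->]; have [s Xs] := g2 X XL.
  by exists s; rewrite -limg_sum memv_img.
- move=> s f us fP sf g gs.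
  have /boolp.choice[h hP] : forall g, exists X, X \in Gam g /\ psi X = f g.
    by move=> k; have /memv_imgP[X XG ->] := fP k; exists X.
  have hL k : h k \in L1 by apply: (subvP (g1 k)); case: (hP k).
  have [_ <-] := hP g; rewrite (g3 s h us) ?linear0 //.
    by move=> k; case: (hP k).
  apply: p2; [by apply: rpred_sum => k _; apply: hL | exact: mem0v |].
  rewrite linear_sum linear0 -[RHS]sf.
  by apply: eq_bigr => k _; case: (hP k).
- move=> g h _ _ /memv_imgP[X XG ->] /memv_imgP[Y YG ->].
  rewrite -p3 ?(subvP (g1 g) X) ?(subvP (g1 h) Y) //.
  by rewrite memv_img // g4.
Qed.

(** An instance of [fam_eq], by which images of gradings need to be compared in one direction
    only. *)
Lemma is_grading_fam (G : groupType) n (L : {vspace 'M[R]_n}) Gam Gam' :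
  is_grading L Gam -> is_grading L Gam' ->
  (forall g : G, Gam g <= Gam' g)%VS -> forall g, Gam g = Gam' g.
Proof.
move=> [s1 c1 _ _] [s2 _ d2 _] GG g; apply/eqP; rewrite eqEsubv GG /=.
apply/subvP => X Xg; apply: (fam_eq (V := Gam') (U := L)) => //.
exact: (subvP (s2 g)).
Qed.

End LieIso.

Lemma sum_neq0 (V : nmodType) (I : finType) (F : I -> V) :
  \sum_i F i != 0 -> exists i, F i != 0.
Proof.
move=> ne; apply/existsP; apply: contraNT ne => /existsPn no.
by rewrite big1 // => i _; apply/eqP; rewrite -[_ == _]negbK no.
Qed.

Lemma mulmx_entry_neq0 (R : fieldType) m n p (A : 'M[R]_(m, n)) (B : 'M[R]_(n,
  p)) a b :
  (A *m B) a b != 0 -> exists2 c, A a c != 0 & B c b != 0.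
Proof.
rewrite mxE => /sum_neq0[c]; rewrite mulf_eq0 negb_or => /andP[h1 h2].
by exists c.
Qed.

Lemma mulmx1C_eq (R : fieldType) m n (A : 'M[R]_(n, m)) (A' : 'M[R]_(m, n)) :
  m = n -> A' *m A = 1%:M -> A *m A' = 1%:M.
Proof. by move=> mn; case: _ / mn in A A' * => /mulmx1C. Qed.

Lemma skew_form_eq (R : fieldType) n (P X : 'M[R]_n) : P \in unitmx ->
  (X \in Skew P) = (X^T *m P == - (P *m X)).
Proof.
move=> PU; rewrite mem_Skew /phi_inv -mulmxA -(can_eq (mulKmx PU)) mulKVmx //.
by rewrite mulmxN.
Qed.

Lemma so_Skew (R : fieldType) p q : so R p q = Skew (so_form R p q).
Proof.
have JJ : so_form R p q *m so_form R p q = 1%:M.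
  rewrite /so_form mulmx_block !(mulmx0, mul0mx, addr0, add0r, mulmx1).
  by rewrite mulmxN mulmx1 opprK -scalar_mx_block.
have [JU _] := mulmx1_unit JJ.
by apply/vspaceP => X; rewrite mem_so skew_form_eq // addr_eq0.
Qed.

(** * Conjugation by a similitude of forms *)

Section Conj.
Variables (R : realFieldType) (m n : nat).
Variables (P1 : 'M[R]_m) (P2 : 'M[R]_n) (A : 'M[R]_(n, m)) (A' : 'M[R]_(m, n)).
Variable c : R.
Hypotheses (P1U : P1 \in unitmx) (P2U : P2 \in unitmx) (c0 : c != 0).
Hypotheses (A'A : A' *m A = 1%:M) (AA' : A *m A' = 1%:M).
Hypothesis AE : A^T *m P2 *m A = c *: P1.

(** A rectangular A with a separate inverse A' is used because sizes such as [sizeB kappa t u] and p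
    + q are equal only propositionally. *)
Definition conj_hom : 'Hom('M[R]_m, 'M[R]_n) := linfun (mulmxr A' \o mulmx A).

Lemma conj_homE X : conj_hom X = A *m X *m A'. Proof. by rewrite lfunE. Qed.

Lemma conj_hom_skew X : X \in Skew P1 -> A *m X *m A' \in Skew P2.
Proof.
rewrite !skew_form_eq // => /eqP hX; apply/eqP.
have e1 : A^T *m P2 = c *: (P1 *m A').
  by rewrite scalemxAl -AE -!mulmxA AA' mulmx1.
have e2 : P2 *m A = c *: (A'^T *m P1).
  by rewrite scalemxAr -AE !mulmxA -trmx_mul AA' trmx1 mul1mx.
rewrite !trmx_mul -!mulmxA e1 !mulmxA e2 -!scalemxAr -!scalemxAl -scalerN.
by congr (_ *: _); rewrite !mulmxA -(mulmxA A'^T) hX mulmxN mulNmx !mulmxA.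
Qed.

End Conj.

Lemma conj_lie_iso (R : realFieldType) m n (P1 : 'M[R]_m) (P2 : 'M[R]_n)
    (A : 'M[R]_(n, m)) (A' : 'M[R]_(m, n)) c :
  P1 \in unitmx -> P2 \in unitmx -> c != 0 ->
  A' *m A = 1%:M -> A *m A' = 1%:M -> A^T *m P2 *m A = c *: P1 ->
  lie_iso (Skew P1) (Skew P2) (conj_hom A A').
Proof.
move=> P1U P2U c0 A'A AA' AE.
have AE' : A'^T *m P1 *m A' = c^-1 *: P2.
  have -> : P1 = c^-1 *: (A^T *m P2 *m A) by rewrite AE scalerA mulVf //
    scale1r.
  rewrite -scalemxAr -scalemxAl; congr (_ *: _); rewrite !mulmxA -trmx_mul AA'.
  by rewrite trmx1 mul1mx -mulmxA AA' mulmx1.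
have K X : A' *m (A *m X *m A') *m A = X.
  by rewrite !mulmxA A'A mul1mx -mulmxA A'A mulmx1.
have K' Y : A *m (A' *m Y *m A) *m A' = Y.
  by rewrite !mulmxA AA' mul1mx -mulmxA AA' mulmx1.
split.
- apply/vspaceP => Y; apply/memv_imgP/idP => [[X hX ->]|hY].
    by rewrite conj_homE (conj_hom_skew P1U P2U AA' AE).
  exists (A' *m Y *m A); last by rewrite conj_homE K'.
  exact: (conj_hom_skew P2U P1U A'A AE').
- by move=> X Y _ _; rewrite !conj_homE => e; rewrite -(K X) e K.
- move=> X Y _ _; rewrite !conj_homE /lie_bracket mulmxBr mulmxBl !mulmxA.
  by rewrite -!(mulmxA _ A' A) A'A !mulmx1.
Qed.

(** * Gradings of skew matrices defined by labels *)

Section LabelGrading.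
Variables (R : rcfType) (G : groupType).
Hypothesis Gcomm : forall x y : G, (x * y)%g = (y * x)%g.

Section One.
Variables (n : nat) (l : 'I_n -> G) (Phi : 'M[R]_n).
Hypotheses (PhiT : Phi^T = Phi) (PhiU : Phi \in unitmx) (PhiO : label_orth l
  Phi).

Definition skew_label g : {vspace 'M[R]_n} := (comp_label R l g :&: Skew
  Phi)%VS.

Lemma comp_label_mul g h X Y : X \in comp_label R l g ->
  Y \in comp_label R l h ->
  X *m Y \in comp_label R l (g * h)%g.
Proof.
move=> /comp_labelP hX /comp_labelP hY; apply/comp_labelP => a b.
case/mulmx_entry_neq0 => c /hX <- /hY <-.
by rewrite mulgA mulgKV.
Qed.

Lemma comp_label_tr g X : X \in comp_label R l g -> g != 1%g -> \tr X = 0.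
Proof.
move=> /comp_labelP hX g1; apply: big1 => a _; apply/eqP.
by apply: contraNT g1 => /hX <-; rewrite mulgV.
Qed.

Lemma comp_label_phi g X : X \in comp_label R l g ->
  phi_inv Phi X \in comp_label R l g.
Proof.
move=> /comp_labelP hX; apply/comp_labelP => a b.
case/mulmx_entry_neq0 => d /mulmx_entry_neq0[e ae]; rewrite mxE =>
  /hX <- /PhiO db.
have ae1 := label_orth_inv PhiU PhiO ae.
have -> : l b = (l d)^-1%g by apply: (mulgI (l d)); rewrite db mulgV.
have -> : l a = (l e)^-1%g by apply: (mulIg (l e)); rewrite ae1 mulVg.
by rewrite invgK Gcomm.
Qed.

Lemma skew_label_grading : is_grading (Skew Phi) skew_label.
Proof.
split.
- by move=> g; apply: capvSr.
- move=> X hX; have [s Xs] := comp_label_covers l (memvf X).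
  have [f fM XE] := mem_fam_sum (undup_uniq s) (subvP (sub_fam_sum (comp_label R
    l)
    (s2 := undup s) (fun g => etrans (mem_undup s g))) _ Xs).
  (* As [phi_inv] preserves degrees, the homogeneous terms of phi_inv X + X = 0 vanish separately,
     so every component of X is skew. *)
  have fS : {in undup s, forall g, f g \in Skew Phi}.
    move=> g gs; rewrite mem_Skew -addr_eq0; apply/eqP.
    apply: (comp_label_direct (l := l) (f := fun g => phi_inv Phi (f g) + f g)
      (undup_uniq s)) gs => [h|].
      by rewrite rpredD ?comp_label_phi.
    rewrite big_split /= -XE.
    have -> : \sum_(h <- undup s) phi_inv Phi (f h) = phi_inv Phi X.
      by rewrite XE linear_sum.
    by rewrite (skewP _ _ hX) addNr.
  exists (undup s); rewrite XE.
  elim: (undup s) fS => [|h t IH] fS; first by rewrite !big_nil mem0v.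
  rewrite !big_cons memv_add ?IH // => [|k kt]; last first.
    by apply: fS; rewrite inE kt orbT.
  by rewrite memv_cap fM fS ?mem_head.
- move=> s f us fP; apply: (comp_label_direct (l := l)) us _ => g.
  by have := fP g; rewrite memv_cap => /andP[].
- move=> g h X Y; rewrite !memv_cap => /andP[Xg XS] /andP[Yh YS].
  rewrite lie_skew // andbT; apply: rpredB; first exact: comp_label_mul.
  by rewrite Gcomm; apply: comp_label_mul.
Qed.

Lemma skew_label_cov : fam_covers skew_label (Skew Phi).
Proof. by case: skew_label_grading. Qed.

End One.

Section Two.
Variables (n1 n2 : nat) (l1 : 'I_n1 -> G) (l2 : 'I_n2 -> G).
Variables (Phi1 : 'M[R]_n1) (Phi2 : 'M[R]_n2).
Hypotheses (P1U : Phi1 \in unitmx) (P1O : label_orth l1 Phi1).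
Hypotheses (P2U : Phi2 \in unitmx) (P2O : label_orth l2 Phi2).
Variables (A : 'M[R]_(n2, n1)) (A' : 'M[R]_(n1, n2)) (c : R).
Hypotheses (c0 : c != 0) (A'A : A' *m A = 1%:M) (AA' : A *m A' = 1%:M).
Hypothesis AE : A^T *m Phi2 *m A = c *: Phi1.
Variable h : G.
Hypotheses (hh : (h * h)%g = 1%g) (AP : forall b a, A b a != 0 ->
  l2 b = (h * l1 a)%g).

(** A' equals c^-1 Phi1^-1 A^T Phi2. Both forms invert labels and h is its own inverse, so the
    support of A' obeys the same shift as that of A. *)
Lemma label_inv_supp a b : A' a b != 0 -> l2 b = (h * l1 a)%g.
Proof.
have -> : A' = c^-1 *: (invmx Phi1 *m A^T *m Phi2).
  apply: (can_inj (mulKmx P1U)); rewrite -scalemxAr !mulmxA mulmxV // mul1mx.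
  rewrite -[A^T *m Phi2]mulmx1 -AA' !mulmxA AE -scalemxAl scalerA mulVf //.
  by rewrite scale1r.
rewrite mxE mulf_eq0 negb_or => /andP[_] /mulmx_entry_neq0[d].
case/mulmx_entry_neq0 => e /(label_orth_inv P1U P1O) ae; rewrite mxE =>
  /AP de /P2O db.
have -> : l2 b = (l2 d)^-1%g by apply: (mulgI (l2 d)); rewrite db mulgV.
have -> : l1 a = (l1 e)^-1%g by apply: (mulIg (l1 e)); rewrite ae mulVg.
rewrite de invMg Gcomm; congr (_ * _)%g.
by apply: (mulgI h); rewrite mulgV hh.
Qed.

Lemma conj_comp_label g X : X \in comp_label R l1 g ->
  A *m X *m A' \in comp_label R l2 g.
Proof.
move=> /comp_labelP hX; apply/comp_labelP => a b.
case/mulmx_entry_neq0 => d /mulmx_entry_neq0[e /AP ->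
  /hX <-] /label_inv_supp ->.
by rewrite invMg (Gcomm h) (Gcomm _ h^-1%g) mulgA mulgK.
Qed.

Lemma conj_skew_label g :
  (conj_hom A A' @: skew_label l1 Phi1 g <= skew_label l2 Phi2 g)%VS.
Proof.
apply/subvP => Y /memv_imgP[X]; rewrite memv_cap => /andP[Xg XS] ->.
by rewrite conj_homE memv_cap conj_comp_label // (conj_hom_skew P1U P2U AA' AE).
Qed.
End Two.

Lemma conj_skew_label_eq n1 n2 (l1 : 'I_n1 -> G) (l2 : 'I_n2 -> G)
    (Phi1 : 'M[R]_n1) (Phi2 : 'M[R]_n2) (A : 'M[R]_(n2, n1)) (A' : 'M[R]_(n1,
      n2))
    (c : R) (h : G) :
  Phi1^T = Phi1 -> Phi1 \in unitmx -> label_orth l1 Phi1 ->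
  Phi2^T = Phi2 -> Phi2 \in unitmx -> label_orth l2 Phi2 ->
  c != 0 -> A' *m A = 1%:M -> A *m A' = 1%:M -> A^T *m Phi2 *m A = c *: Phi1 ->
  (h * h)%g = 1%g -> (forall b a, A b a != 0 -> l2 b = (h * l1 a)%g) ->
  forall g, (conj_hom A A' @: skew_label l1 Phi1 g)%VS = skew_label l2 Phi2 g.
Proof.
move=> P1T P1U P1O P2T P2U P2O c0 A'A AA' AE hh AP.
apply: (is_grading_fam (L := Skew Phi2)).
- apply: grading_transport (conj_lie_iso P1U P2U c0 A'A AA' AE) _.
  exact: skew_label_grading.
- exact: skew_label_grading.
move=> g; exact: (conj_skew_label P1U P1O P2U P2O c0 AA' AE hh AP).
Qed.
End LabelGrading.

Lemma congr_std (R : rcfType) N n (Phi : 'M[R]_N) P : N = n -> (P <= n)%N ->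
  Phi^T = Phi -> Phi *m Phi = 1%:M -> \tr Phi = (2 * P)%:R - n%:R ->
  exists A : 'M[R]_(n, N), A^T *m sgn_mx R n P *m A = Phi.
Proof.
move=> Nn; case: _ / Nn => Pn PhiT PP trP.
have [PhiU _] := mulmx1_unit PP.
have [A [Q [Qn AE]]] := sylvester PhiT PhiU.
have AU := sylvester_unit AE.
have PQ : Q = P.
  have := invol_congr_trace (A := A^T) erefl (sgn_mx_sqr R N Q) PP.
  rewrite trmxK => /(_ AE); rewrite mxtrace_sgn_mx // trP.
  move/(addIr _)/eqP; rewrite eqr_nat; lia.
exists (invmx A)^T; rewrite trmxK -PQ -AE !mulmxA mulVmx // mul1mx -mulmxA.
by rewrite -trmx_mul mulVmx // trmx1 mulmx1.
Qed.

Lemma support_order_ex (G : groupType) (kappa : {fsfun G -> nat with 0%N}) :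
  (forall x, kappa x^-1%g = kappa x) ->
  exists (m r' : nat) (t : 'I_m -> G) (u : 'I_r' -> G), support_order kappa t u.
Proof.
move=> kinv; pose s := finsupp kappa; pose T := [seq x <- s | x \in @G2 G].
have [|||U UP] := @pair_list _ (fun x : G => x^-1%g) [seq x <- s | x \notin @G2
  G].
- exact: invgK.
- by rewrite filter_uniq ?fset_uniq.
- move=> x; rewrite !mem_filter => /andP[xG xs];
    rewrite mem_finsupp kinv -mem_finsupp xs.
  have GV (y : G) : (y^-1%g \in @G2 G) = (y \in @G2 G).
    by rewrite !inE !expg2 -invMg invg_eq1.
  rewrite GV xG; split=> //; apply: contraNneq xG => xx.
  by rewrite inE expg2 -{1}xx mulVg.
have cT (X : seq G) : codom (tnth (in_tuple X)) = X.
  by rewrite codomE map_tnth_enum.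
exists (size T), (size U), (tnth (in_tuple T)), (tnth (in_tuple U)); split.
  by move=> i; have := mem_tnth i (in_tuple T); rewrite mem_filter => /andP[].
rewrite !cT.
have -> : [seq (tnth (in_tuple U) j)^-1%g | j : 'I_(size U)] = [seq x^-1%g | x
  <- U].
  by rewrite -[in RHS](cT U) codomE -map_comp.
apply: perm_trans (permEl (perm_filterC (fun x => x \in @G2 G) s)).
by rewrite perm_cat2l.
Qed.

(** * Graded isomorphisms *)

Lemma skew_iso_conj_eq (R : rcfType) m n (P1 : 'M[R]_m) (P2 : 'M[R]_n)
    (f : 'Hom('M[R]_m, 'M[R]_n)) :
  m = n -> (2 < m)%N -> odd m ->
  P1^T = P1 -> P1 \in unitmx -> P2^T = P2 -> P2 \in unitmx ->
  lie_iso (Skew P1) (Skew P2) f ->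
  exists (A : 'M[R]_(n, m)) (A' : 'M[R]_(m, n)) (c : int),
  [/\ A' *m A = 1%:M /\ A *m A' = 1%:M, c = 1 \/ c = -1,
      A^T *m P2 *m A = c%:~R *: P1 &
      forall X, X \in Skew P1 -> f X = conj_hom A A' X].
Proof.
move=> mn; case: _ / mn in P2 f * => m3 modd P1T P1U P2T P2U fiso.
have [A [c [AU c0 AE fE]]] := skew_iso_conj P1T P1U P2T P2U m3 modd fiso.
(* Dividing A by the square root of |c| leaves the conjugation unchanged and reduces c to its sign,
   the epsilon of the orbits. *)
pose k := Num.sqrt `|c|.
have k0 : k != 0 by rewrite sqrtr_eq0 -ltNge normr_gt0.
exists (k^-1 *: A), (k *: invmx A), (sgz c); split.
- split; rewrite -scalemxAl -scalemxAr scalerA ?mulVmx ?mulmxV //.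
    by rewrite mulfV ?scale1r.
  by rewrite mulVf ?scale1r.
- by case: sgzP c0 => //; rewrite ?eqxx //; auto.
- have -> : (k^-1 *: A)^T = k^-1 *: A^T by rewrite linearZ.
  rewrite -!scalemxAl -scalemxAr scalerA AE scalerA; congr (_ *: _).
  have -> : k^-1 * k^-1 = `|c|^-1.
    by rewrite -invfM -expr2 sqr_sqrtr ?normr_ge0.
  by rewrite -sgrEz; rewrite {2}[c]numEsg mulrCA mulVf ?mulr1 ?normr_eq0.
- move=> X hX; rewrite fE // conj_homE -!scalemxAl -!scalemxAr scalerA.
  by rewrite mulVf // scale1r.
Qed.

Lemma unit_bij (F : fieldType) n1 n2 (A : 'M[F]_(n2, n1)) (A' : 'M[F]_(n1,
  n2)) :
  n1 = n2 -> A' *m A = 1%:M ->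
  exists s : 'I_n1 -> 'I_n2, bijective s /\ forall a, A (s a) a != 0.
Proof.
move=> n12; case: _ / n12 in A A' * => A'A.
have AU : A^T \in unitmx by rewrite unitmx_tr; case: (mulmx1_unit A'A).
have [s sP] := unit_perm AU; exists s; split; first by exists (s^-1)%g => i;
  rewrite ?permK ?permKV.
by move=> a; have := sP a; rewrite mxE.
Qed.

Section Shift.
Variables (R : rcfType) (G : groupType).
Hypothesis Gcomm : forall x y : G, (x * y)%g = (y * x)%g.
Variables (n1 n2 : nat) (l1 : 'I_n1 -> G) (l2 : 'I_n2 -> G).
Variables (Phi1 : 'M[R]_n1) (Phi2 : 'M[R]_n2).
Hypotheses (P1T : Phi1^T = Phi1) (P1U : Phi1 \in unitmx) (P1O : label_orth l1
  Phi1).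
Hypotheses (P2T : Phi2^T = Phi2) (P2U : Phi2 \in unitmx) (P2O : label_orth l2
  Phi2).
Variables (A : 'M[R]_(n2, n1)) (A' : 'M[R]_(n1, n2)) (c : R).
Hypotheses (c0 : c != 0) (A'A : A' *m A = 1%:M) (AA' : A *m A' = 1%:M).
Hypothesis AE : A^T *m Phi2 *m A = c *: Phi1.
Hypotheses (n12 : n1 = n2) (n3 : (2 < n2)%N).
Hypothesis Ag : forall g,
  (conj_hom A A' @: skew_label l1 Phi1 g)%VS = skew_label l2 Phi2 g.

(* Components of A E A' of the wrong degree are killed by the trace pairing with
   products of two homogeneous skew elements, which are images of such products.
     *)
Lemma conj_delta_comp a a' :
  A *m delta_mx a a' *m A' \in comp_label R l2 (l1 a * (l1 a')^-1)%g.
Proof.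
set Z := A *m _ *m A'; set g := (l1 a * _)%g.
have ZY h k Y1 Y2 : Y1 \in skew_label l2 Phi2 h ->
  Y2 \in skew_label l2 Phi2 k ->
    (g * h * k)%g != 1%g -> \tr (Z *m Y1 *m Y2) = 0.
  rewrite -!Ag => /memv_imgP[X1] + -> /memv_imgP[X2] + ->.
  rewrite !memv_cap => /andP[X1h _] /andP[X2k _] ne.
  have -> : Z *m conj_hom A A' X1 *m conj_hom A A' X2 =
      A *m (delta_mx a a' *m X1 *m X2 *m A').
    by rewrite !conj_homE /Z !mulmxA -!(mulmxA _ A' A) A'A !mulmx1.
  rewrite mxtrace_mulC -(mulmxA _ A' A) A'A mulmx1.
  apply: comp_label_tr ne; apply: comp_label_mul X2k.
  by apply: comp_label_mul X1h; rewrite memvE (sumv_sup (a, a')).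
have [s Zs] := comp_label_covers l2 (memvf Z).
have [f fM ZE] := mem_fam_sum (undup_uniq s) (subvP (sub_fam_sum (comp_label R
  l2)
    (s2 := undup s) (fun g => etrans (mem_undup s g))) _ Zs).
have f0 h : h \in undup s -> h != g -> f h = 0.
  move=> hs hg; apply: (skew_annihilator P2T P2U n3) => X Y hX.
  have cov := skew_label_cov Gcomm P2U P2O.
  have trD (F : {linear 'M[R]_n2 -> 'M[R]_n2}) U V :
      \tr (F U) = 0 -> \tr (F V) = 0 -> \tr (F (U + V)) = 0.
    by move=> hU hV; rewrite !linearD /= hU hV addr0.
  move: Y; apply: (covers_ind cov) => [||k Y Yk].
  - by rewrite mulmx0 mxtrace0.
  - exact: (trD (mulmx (f h *m X))).
  move: X hX; apply: (covers_ind cov) => [||j X Xj].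
  - by rewrite mulmx0 mul0mx mxtrace0.
  - exact: (trD (mulmxr Y \o mulmx (f h))).
  have trh i : (i * j * k)%g != 1%g -> \tr (f i *m X *m Y) = 0.
    move: Xj Yk; rewrite !memv_cap => /andP[Xj _] /andP[Yk _].
    by apply: comp_label_tr; apply: comp_label_mul Yk; apply: comp_label_mul Xj.
  have [hjk|] := eqVneq (h * j * k)%g 1%g; last exact: trh.
  have other i : i != h -> (i * j * k)%g != 1%g.
    by apply: contraNneq => ijk; rewrite -hjk in ijk; move/mulIg/mulIg: ijk =>
      ->.
  have := ZY _ _ _ _ Xj Yk (other g _); rewrite eq_sym => /(_ hg).
  rewrite ZE !mulmx_suml linear_sum (bigD1_seq h) ?undup_uniq //= big1 ?addr0
    //.
  by move=> i ih; apply: trh; apply: other.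
have [gs|gs] := boolP (g \in undup s).
  suff -> : Z = f g by apply: fM.
  rewrite ZE (bigD1_seq g) ?undup_uniq //= big_seq_cond big1 ?addr0 //.
  by move=> i /andP[]; apply: f0.
rewrite ZE big_seq big1 ?mem0v // => i is_; apply: f0 => //.
by apply: contraNneq gs => <-.
Qed.

(** Through the degree of A E_(a a0) A', every nonzero entry of A is compared with one fixed nonzero
    entry of A', which gives a common shift h. Both forms pair inverse labels, so a single nonzero
    entry of A^T Phi2 A = c Phi1 forces h * h = 1. *)
Lemma label_iso_shift : exists2 h : G, (h * h)%g = 1%g &
  forall b a, A b a != 0 -> l2 b = (h * l1 a)%g.
Proof.
have n10 : (0 < n1)%N by rewrite n12; lia.
pose a0 := Ordinal n10.
have [b0 a0b0] : exists b, A' a0 b != 0.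
  have : (A' *m A) a0 a0 != 0 by rewrite A'A mxE eqxx oner_neq0.
  by case/mulmx_entry_neq0 => b; exists b.
pose h := (l2 b0 * (l1 a0)^-1)%g.
have AP b a : A b a != 0 -> l2 b = (h * l1 a)%g.
  move=> ba; have /comp_labelP/(_ b b0) := conj_delta_comp a a0.
  have -> : (A *m delta_mx a a0 *m A') b b0 = A b a * A' a0 b0.
    by rewrite mxE (bigD1 a0) //= big1 ?addr0 => [|i ia];
       rewrite mul_mx_deltaE ?eqxx ?mulr1 // eq_sym (negPf ia) mulr0 mul0r.
  rewrite mulf_neq0 // => /(_ isT) bb.
  by rewrite -[l2 b](mulgKV (l2 b0)) bb /h Gcomm -!mulgA (Gcomm _ (l1 a)).
exists h => //.
have [a1 a01] : exists a1, Phi1 a0 a1 != 0.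
  have : (Phi1 *m invmx Phi1) a0 a0 != 0 by rewrite mulmxV //
    mxE eqxx oner_neq0.
  by case/mulmx_entry_neq0 => b; exists b.
have : (A^T *m Phi2 *m A) a0 a1 != 0 by rewrite AE mxE mulf_neq0.
case/mulmx_entry_neq0 => d /mulmx_entry_neq0[e]; rewrite mxE =>
  /AP e0 /P2O ed /AP d1.
have := P1O a01; move: ed; rewrite e0 d1.
rewrite -mulgA (mulgA (l1 a0)) (Gcomm (l1 a0) h) -(mulgA h (l1 a0)) mulgA =>
  + e1.
by rewrite e1 mulg1.
Qed.

Variable h : G.
Hypothesis AP : forall b a, A b a != 0 -> l2 b = (h * l1 a)%g.

Lemma label_count_shift x : label_count l2 (h * x)%g = label_count l1 x.
Proof.
have [s [[s' sK s'K] sP]] := unit_bij n12 A'A.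
rewrite /label_count -!sum1_card (reindex s) /=; last by exists s' => i _.
by apply: eq_bigl => a; rewrite !inE (AP (sP a)) (can_eq (mulKg h)).
Qed.

Hypothesis hh : (h * h)%g = 1%g.
Hypotheses (P11 : Phi1 *m Phi1 = 1%:M) (P22 : Phi2 *m Phi2 = 1%:M) (cc : c * c =
  1).

(** A restricts to a congruence between the block of c Phi1 at x and that of Phi2 at h x. Both are
    involutions because c * c = 1, so their traces agree. *)
Lemma label_trace_shift x : (x * x)%g = 1%g ->
  \sum_(a | l2 a == (h * x)%g) Phi2 a a = c * \sum_(a | l1 a == x) Phi1 a a.
Proof.
move=> xx; rewrite -!tr_label_block -linearZ /=; apply/esym.
have hx : (h * x * (h * x))%g = 1%g.
  by rewrite -mulgA (mulgA x) (Gcomm x) -mulgA xx mulg1.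
pose J1 := label_incl R l1 x; pose J2 := label_incl R l2 (h * x)%g.
apply: (invol_congr_trace (A := J2^T *m A *m J1)).
- by rewrite label_count_shift.
- by rewrite -scalemxAl -scalemxAr scalerA cc scale1r label_blockM //
    P11 label_block1.
- by rewrite label_blockM // P22 label_block1.
have AJ : label_mask R l2 (h * x)%g *m (A *m J1) = A *m J1.
  apply: label_mask_supp => b j /mulmx_entry_neq0[a /AP -> /label_incl_supp ->].
  by [].
have AJT : (A *m J1)^T *m label_mask R l2 (h * x)%g = (A *m J1)^T.
  apply: label_mask_suppT => b j /mulmx_entry_neq0[a /AP ->
    /label_incl_supp ->].
  by [].
transitivity ((A *m J1)^T *m (J2 *m J2^T) *m Phi2 *m ((J2 *m J2^T) *m (A *m
  J1))).
  by rewrite /label_block !trmx_mul trmxK !mulmxA.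
rewrite label_incl_mask AJ AJT trmx_mul /label_block.
by rewrite scalemxAl scalemxAr -AE !mulmxA.
Qed.
End Shift.

(** * The classification *)

Lemma so_form_sgn (R : rcfType) p q : so_form R p q = sgn_mx R (p + q) p.
Proof.
apply/matrixP => i j; rewrite sgn_mxE /so_form.
case: (split_ordP i) => i' ->; case: (split_ordP j) => j' ->;
  rewrite ?block_mxEul ?block_mxEur ?block_mxEdl ?block_mxEdr !mxE.
- by rewrite eq_lshift.
- by rewrite eq_lrshift.
- by rewrite eq_rlshift.
- by rewrite eq_rshift ?mulNrn.
Qed.

(** The list u selects one label from each pair of distinct inverse labels, which provides the
    predicate [pos] of [labelled_congr]. *)
Lemma support_pos (G : groupType) (kappa : {fsfun G -> nat with 0%N}) m r'
    (t : 'I_m -> G) (u : 'I_r' -> G) x :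
  support_order kappa t u -> x \in finsupp kappa -> (x * x)%g != 1%g ->
  (x^-1%g \in codom u) = (x \notin codom u).
Proof.
case=> tG pe; rewrite -(perm_mem pe) !mem_cat => xs xx.
have := perm_uniq pe; rewrite fset_uniq !cat_uniq =>
  /and3P[_ _ /and3P[_ dis _]].
have {}dis y : y \in codom u -> y^-1%g \notin codom u.
  move=> /codomP[j ->]; apply: (hasPn dis); apply/imageP; by exists j.
case/or3P: xs => [/codomP[i xt]|xu|/imageP[j _ xu]].
- by move: (tG i) xx; rewrite xt inE expg2 => /eqP ->; rewrite eqxx.
- by rewrite xu (negPf (dis _ xu)).
- have uj : x^-1%g \in codom u by rewrite xu invgK codom_f.
  by have := dis _ uj; rewrite uj invgK => ->.
Qed.

Lemma cancel_limg (R : fieldType) m n (L : {vspace 'M[R]_m}) (U : {vspace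
  'M[R]_m})
    (psi : 'Hom('M[R]_m, 'M[R]_n)) (chi : 'Hom('M[R]_n, 'M[R]_m)) :
  {in L, cancel psi chi} -> (U <= L)%VS -> (chi @: (psi @: U))%VS = U.
Proof.
move=> can UL; apply/vspaceP => X; apply/memv_imgP/idP =>
  [[_ /memv_imgP[Y YU ->] ->]|XU].
  by rewrite can // (subvP UL).
by exists (psi X); rewrite ?memv_img // can // (subvP UL).
Qed.

Section Main.
Variables (R : rcfType) (G : groupType).
Hypothesis Gcomm : forall x y : G, (x * y)%g = (y * x)%g.

Section OneGamma.
Variables (kappa : {fsfun G -> nat with 0%N}) (sigma : G -> int).
Variables (m r' : nat) (t : 'I_m -> G) (u : 'I_r' -> G).
Hypotheses (supp : support_order kappa t u) (par : paramB kappa sigma).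
Local Notation Phi := (PhiB R kappa sigma t u).

Lemma PhiBU : Phi \in unitmx.
Proof. by case: (mulmx1_unit (PhiB_sqr R kappa sigma t u)). Qed.

Lemma skewB_lie X Y : X \in skewB R kappa sigma t u ->
  Y \in skewB R kappa sigma t u -> lie_bracket X Y \in skewB R kappa sigma t u.
Proof. by rewrite /skewB => hX hY; apply: (lie_skew PhiBU). Qed.

Lemma GammaB_skew_label g :
  GammaB R kappa sigma t u g = skew_label (@labelB G kappa m r' t u) Phi g.
Proof. by []. Qed.

Lemma GammaB_grading : is_grading (skewB R kappa sigma t u) (GammaB R kappa
  sigma t u).
Proof.
exact: (skew_label_grading Gcomm PhiBU (PhiB_orth (sigma := sigma) supp)).
Qed.

Lemma skewB_so p q : weight kappa = (p + q)%N -> (q <= p)%N ->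
  (p - q)%N = `|signature kappa sigma|%N ->
  exists psi, lie_iso (skewB R kappa sigma t u) (so R p q) psi.
Proof.
move=> wpq qp sg; have [kinv _ _ _] := par.
have Npq : sizeB kappa t u = (p + q)%N by rewrite (sizeB_weight supp kinv).
have trP : \tr Phi = (signature kappa sigma)%:~R := PhiB_trace R supp kinv par.
have PP : Phi *m Phi = 1%:M := PhiB_sqr R kappa sigma t u.
(* Phi and -Phi have the same skew matrices. As q <= p, it is -Phi that is congruent to the standard
   form when the signature is negative. *)
have [A [c [c0 AE]]] : exists (A : 'M[R]_(p + q, sizeB kappa t u)) (c : R),
    c != 0 /\ A^T *m sgn_mx R (p + q) p *m A = c *: Phi.
  have pE : (2 * p)%:R - (p + q)%:R = (`|signature kappa sigma|%N)%:R :> R.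
    by rewrite -sg natrB // natrD natrM; ring.
  have PT : Phi^T = Phi := PhiBT R kappa sigma t u.
  have [sp|sn] := lerP 0 (signature kappa sigma).
    have trE : \tr Phi = (2 * p)%:R - (p + q)%:R by rewrite trP pE natr_absz
      ger0_norm.
    have [A AE] := congr_std Npq (leq_addr q p) PT PP trE.
    by exists A, 1; rewrite oner_neq0 scale1r.
  have trE : \tr (- Phi) = (2 * p)%:R - (p + q)%:R.
    by rewrite linearN /= trP pE natr_absz ltr0_norm // rmorphN.
  have NT : (- Phi)^T = - Phi by rewrite linearN /= PT.
  have NN : (- Phi) *m (- Phi) = 1%:M by rewrite mulNmx mulmxN opprK.
  have [A AE] := congr_std Npq (leq_addr q p) NT NN trE.
  by exists A, (-1); rewrite oppr_eq0 oner_neq0 scaleN1r.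
pose A' := c^-1 *: (Phi *m A^T *m sgn_mx R (p + q) p).
have A'A : A' *m A = 1%:M.
  rewrite -scalemxAl -!mulmxA (mulmxA A^T) AE -scalemxAr PP scalerA mulVf //.
  by rewrite scale1r.
exists (conj_hom A A'); rewrite so_Skew so_form_sgn.
apply: (conj_lie_iso (c := c)) => //; first exact: PhiBU.
  by case: (mulmx1_unit (sgn_mx_sqr R (p + q) p)).
exact: mulmx1C_eq.
Qed.
End OneGamma.

Lemma so_gamma_ex p q kappa sigma : paramB kappa sigma ->
  weight kappa = (p + q)%N -> (q <= p)%N ->
  (p - q)%N = `|signature kappa sigma|%N ->
  exists Gam : G -> {vspace 'M[R]_(p + q)},
    is_GammaB kappa sigma (so R p q) Gam /\ is_grading (so R p q) Gam.
Proof.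
move=> par wpq qp sg; have [kinv _ _ _] := par.
have [m [r' [t [u supp]]]] := support_order_ex kinv.
have [psi psi_iso] := skewB_so supp par wpq qp sg.
exists (fun g => psi @: GammaB R kappa sigma t u g)%VS; split.
  by exists m, r', t, u; split=> //; exists psi.
by apply: (grading_transport psi_iso); apply: GammaB_grading.
Qed.

Lemma so_gamma_onto p q (Gam : G -> {vspace 'M[R]_(p + q)}) :
  (2 < p + q)%N -> odd (p + q) -> (q <= p)%N -> is_grading (so R p q) Gam ->
  exists kappa sigma, [/\ paramB kappa sigma, weight kappa = (p + q)%N,
    (p - q)%N = `|signature kappa sigma|%N &
    is_GammaB kappa sigma (so R p q) Gam].
Proof.
move=> n3 nodd qp; rewrite so_Skew so_form_sgn.
set n := (p + q)%N in Gam n3 nodd *; set J := sgn_mx R n p.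
have JT : J^T = J := sgn_mxT R n p.
have JJ : J *m J = 1%:M := sgn_mx_sqr R n p.
have [JU _] := mulmx1_unit JJ.
move=> gr; have [B [l [BU BG PsiO]]] := graded_label Gcomm JT JU n3 nodd gr.
set Psi := B^T *m J *m B in PsiO.
have PsiT : Psi^T = Psi by rewrite /Psi !trmx_mul trmxK JT mulmxA.
have PsiU : Psi \in unitmx by rewrite !unitmx_mul unitmx_tr BU JU.
pose kappa : {fsfun G -> nat with 0%N} :=
  [fsfun x in seq_fset tt (codom l) => label_count l x].
have kE x : kappa x = label_count l x.
  rewrite fsfunE seq_fsetE; case: ifPn => // xl; apply/esym/eqP.
  rewrite -leqn0 leqNgt; apply: contra xl => /card_gt0P[a]; rewrite inE =>
    /eqP <-.
  exact: codom_f.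
(* A permutation from a nonzero term of det Psi exchanges the labels x and x^-1, so their
   multiplicities agree. *)
have kinv x : kappa x^-1%g = kappa x.
  have [s sP] := unit_perm PsiU; rewrite !kE /label_count -!sum1_card.
  rewrite (reindex_inj (@perm_inj _ s)) /=; apply: eq_bigl => a; rewrite !inE.
  have -> : l (s a) = (l a)^-1%g by apply: (mulgI (l a));
    rewrite (PsiO _ _ (sP a)) mulgV.
  by rewrite (can_eq (@invgK G)).
have wn : weight kappa = n.
  rewrite /weight -[RHS]card_ord -sum1_card.
  rewrite [RHS](sum_by_label (V := nat) (l := l) (s :=
    finsupp kappa)) ?fset_uniq //.
    by apply: eq_bigr => x _; rewrite kE /label_count -sum1_card.
  move=> a; rewrite mem_finsupp kE -lt0n; apply/card_gt0P; exists a.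
  by rewrite inE.
have /boolp.choice[P PP] : forall x, exists P, x \in @G2 G ->
    (P <= label_count l x)%N /\ label_sig l Psi x (label_count l x) P.
  move=> x; have [xG|_] := boolP (x \in @G2 G); last by exists 0%N.
  have xx : (x * x)%g = 1%g by move: xG; rewrite inE expg2 => /eqP.
  by have [P PP] := label_sig_ex PsiT PsiU PsiO xx; exists P.
pose sigma x : int := if x \in @G2 G then (2 * P x)%:Z - (kappa x)%:Z else 0.
have par : paramB kappa sigma.
  split=> [x||x|x xG]; rewrite ?kinv ?wn // /sigma.
    by move/negPf->.
  by rewrite xG kE; have [Pk _] := PP x xG; split; lia.
have [m [r' [t [u supp]]]] := support_order_ex kinv.
pose lab := @labelB G kappa m r' t u; pose Phi := PhiB R kappa sigma t u.
have PhiT : Phi^T = Phi := PhiBT R kappa sigma t u.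
have Phi2 : Phi *m Phi = 1%:M := PhiB_sqr R kappa sigma t u.
have PhiU : Phi \in unitmx := PhiBU kappa sigma t u.
have PhiO : label_orth lab Phi := PhiB_orth (sigma := sigma) supp.
have cnt x : label_count lab x = kappa x := labelB_count supp kinv x.
have [||x xx|A AE AP] := labelled_congr (pos := fun x => x \in codom u)
  PhiT Phi2 PhiO PsiT PsiU PsiO.
- by move=> x; rewrite cnt kE.
- move=> a aa; apply: (support_pos supp) aa.
  by rewrite mem_finsupp -cnt -lt0n; apply/card_gt0P; exists a; rewrite inE.
- have xG : x \in @G2 G by rewrite inE expg2 xx.
  have [Q [Qk Qs]] := label_sig_ex PhiT PhiU PhiO xx.
  have [Pk Ps] := PP x xG.
  (* The trace of [PhiB] on label x is sigma x = 2 P x - kappa x by the choice of sigma, and it is 2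
     Q - kappa x by inertia. *)
  exists Q; split=> //; suff -> : Q = P x by rewrite cnt kE.
  have := label_sig_invol Phi2 PhiO xx Qk Qs.
  rewrite (PhiB_trace_label R supp par xG) /sigma xG cnt kE rmorphB /= =>
    /addIr.
  by move/eqP; rewrite -[(_%:Z)%:~R]/((2 * P x)%:R : R) eqr_nat; lia.
pose A' := Phi *m A^T *m Psi.
have Nn : sizeB kappa t u = n by rewrite (sizeB_weight supp kinv).
have A'A : A' *m A = 1%:M.
  transitivity (Phi *m (A^T *m Psi *m A)); first by rewrite /A' !mulmxA.
  by rewrite AE Phi2.
have AA' : A *m A' = 1%:M by apply: mulmx1C_eq A'A.
have isoA : lie_iso (Skew Phi) (Skew Psi) (conj_hom A A').
  by apply: (conj_lie_iso (c := 1)); rewrite ?oner_neq0 ?scale1r.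
have isoB : lie_iso (Skew Psi) (Skew J) (conj_hom B (invmx B)).
  by apply: (conj_lie_iso (c := 1)); rewrite ?oner_neq0 ?mulVmx ?mulmxV
    ?scale1r.
have imA : forall g, (conj_hom A A' @: skew_label lab Phi g)%VS = skew_label l
  Psi g.
  apply: (conj_skew_label_eq Gcomm PhiT PhiU PhiO PsiT PsiU PsiO (oner_neq0 R)
    A'A AA'
    _ (h := 1%g)).
  - by rewrite AE scale1r.
  - by rewrite mulg1.
  - by move=> b a /AP; rewrite mul1g.
have imB g : Gam g = (conj_hom B (invmx B) @: skew_label l Psi g)%VS.
  move: g; apply: (is_grading_fam (L := Skew J)) => // [|g].
    by apply: (grading_transport isoB); apply: skew_label_grading.
  apply/subvP => X Xg; have XJ : X \in Skew J by case: gr =>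
    /(_ g) /subvP + _ _ _; apply.
  case: (isoB) => im _ _; move: XJ; rewrite -im => /memv_imgP[Y YS XE].
  rewrite XE memv_img // memv_cap YS andbT.
  have := BG _ _ Xg; rewrite XE conj_homE !mulmxA mulVmx // mul1mx.
  by rewrite -mulmxA mulVmx // mulmx1.
exists kappa, sigma; split=> //.
  (* The congruence B A relates the involutions Phi and J, whose traces are the signature and p -
     q. *)
  have trE : \tr Phi = \tr J.
    apply: (invol_congr_trace (A := B *m A) Nn Phi2 JJ).
    by rewrite -[RHS]AE /Psi trmx_mul !mulmxA.
  move: trE; rewrite (PhiB_trace R supp kinv par) mxtrace_sgn_mx ?leq_addr // =>
    sE.
  have {}sE : signature kappa sigma = (2 * p)%:Z - n%:Z.
    by apply: (@intr_inj R); rewrite sE rmorphB.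
  rewrite sE /n; lia.
exists m, r', t, u; split=> //; exists (conj_hom B (invmx B) \o conj_hom A
  A')%VF.
split; first exact: lie_iso_comp isoA isoB.
by move=> g; rewrite limg_comp GammaB_skew_label imA -imB.
Qed.

Section TwoGammas.
Variables (p q : nat).
Hypotheses (n3 : (2 < p + q)%N) (nodd : odd (p + q)).
Variables (kappa kappa' : {fsfun G -> nat with 0%N}) (sigma sigma' : G -> int).
Hypotheses (par : paramB kappa sigma) (par' : paramB kappa' sigma').
Hypotheses (w : weight kappa = (p + q)%N) (w' : weight kappa' = (p + q)%N).
Variables (Gam Gam' : G -> {vspace 'M[R]_(p + q)}).
Hypotheses (gam : is_GammaB kappa sigma (so R p q) Gam).
Hypotheses (gam' : is_GammaB kappa' sigma' (so R p q) Gam').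

Let kinv x : kappa x^-1%g = kappa x. Proof. by case: par. Qed.
Let kinv' x : kappa' x^-1%g = kappa' x. Proof. by case: par'. Qed.

Lemma grading_iso_same_orbit :
  grading_isomorphic (so R p q) Gam Gam' -> same_orbit kappa sigma kappa'
    sigma'.
Proof.
case: gam => m [r1 [t [u [supp [psi [psi_iso GamE]]]]]].
case: gam' => m' [r2 [t' [u' [supp' [psi' [psi_iso' GamE']]]]]].
case=> f [f_iso fG].
have [chi chi_iso chiK] := lie_iso_inv (@skewB_lie kappa' sigma' m' r2 t' u')
  psi_iso'.
pose F := (chi \o (f \o psi))%VF.
have F_iso : lie_iso (skewB R kappa sigma t u) (skewB R kappa' sigma' t' u') F.
  by apply: lie_iso_comp chi_iso; apply: lie_iso_comp f_iso.
have FG g : (F @: GammaB R kappa sigma t u g = GammaB R kappa' sigma' t' u'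
  g)%VS.
  by rewrite !limg_comp -GamE fG GamE' (cancel_limg chiK) // capvSr.
have NN : sizeB kappa t u = sizeB kappa' t' u'.
  by rewrite (sizeB_weight supp kinv) (sizeB_weight supp' kinv') w w'.
have Nn : sizeB kappa t u = (p + q)%N by rewrite (sizeB_weight supp kinv).
have [||A [A' [c [[A'A AA'] c1 AE FE]]]] := skew_iso_conj_eq NN _ _
  (PhiBT R kappa sigma t u) (PhiBU _ _ _ _) (PhiBT R kappa' sigma' t' u')
  (PhiBU _ _ _ _) F_iso; rewrite ?Nn //.
have c0 : c%:~R != 0 :> R by case: c1 => ->; rewrite ?oppr_eq0 oner_neq0.
have cG g : (conj_hom A A' @: skew_label (@labelB G kappa m r1 t u)
    (PhiB R kappa sigma t u) g = skew_label (@labelB G kappa' m' r2 t' u')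
    (PhiB R kappa' sigma' t' u') g)%VS.
  rewrite -!GammaB_skew_label -FG; apply/vspaceP => Y.
  by apply/memv_imgP/memv_imgP => -[X Xg ->]; exists X => //;
     rewrite FE // (subvP (capvSr _ _) _ Xg).
have n3' : (2 < sizeB kappa' t' u')%N by rewrite -NN Nn.
have [h hh AP] := label_iso_shift Gcomm (PhiBU _ _ _ _) (PhiB_orth supp)
  (PhiBT R kappa' sigma' t' u') (PhiBU _ _ _ _) (PhiB_orth supp') c0 A'A AE NN
    n3' cG.
have hG : h \in @G2 G by rewrite inE expg2 hh.
exists h => //; exists c => //; split=> y; rewrite /translate.
  by rewrite -(labelB_count supp kinv) -(label_count_shift A'A NN AP) mulVKg
     (labelB_count supp' kinv').
have yG : (h^-1 * y \in @G2 G)%g = (y \in @G2 G).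
  rewrite !inE !expg2 -mulgA (mulgA y) (Gcomm y) !mulgA -invMg hh invg1 mul1g
    //.
have [yG2|yG2] := boolP (y \in @G2 G); last first.
  have [_ _ sN _] := par; have [_ _ sN' _] := par'.
  by rewrite sN' // sN ?mulr0 // yG.
apply: (@intr_inj R); rewrite rmorphM /=.
have xx : (h^-1 * y * (h^-1 * y))%g = 1%g by move: yG2; rewrite -yG inE expg2 =>
  /eqP.
have cc : c%:~R * c%:~R = 1 :> R by case: c1 => ->; rewrite ?mulrNN mulr1.
have := label_trace_shift Gcomm (PhiB_orth supp) (PhiB_orth supp') A'A AE NN AP
  hh
  (PhiB_sqr R kappa sigma t u) (PhiB_sqr R kappa' sigma' t' u') cc xx.
by rewrite mulVKg (PhiB_trace_label R supp' par') //
  (PhiB_trace_label R supp par) ?yG.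
Qed.

Lemma same_orbit_grading_iso :
  same_orbit kappa sigma kappa' sigma' -> grading_isomorphic (so R p q) Gam
    Gam'.
Proof.
case: gam => m [r1 [t [u [supp [psi [psi_iso GamE]]]]]].
case: gam' => m' [r2 [t' [u' [supp' [psi' [psi_iso' GamE']]]]]].
case=> g gG [eps eps1 [kE sE]].
have gg : (g * g)%g = 1%g by move: gG; rewrite inE expg2 => /eqP.
have gV : g^-1%g = g by apply: (mulgI g); rewrite mulgV gg.
pose e : R := eps%:~R; have ee : e * e = 1 by rewrite /e; case: eps1 => ->;
  rewrite ?mulrNN mulr1.
have e0 : e != 0 by apply/eqP => e0; move: ee; rewrite e0 mul0r => /eqP;
  rewrite eq_sym oner_eq0.
pose Phi := PhiB R kappa sigma t u; pose Phi' := PhiB R kappa' sigma' t' u'.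
pose lab := @labelB G kappa m r1 t u; pose lab' := @labelB G kappa' m' r2 t' u'.
(* Shifting the labels of the second model by g and scaling its form by eps gives it the
   multiplicities and signatures of the first. A congruence preserving these new labels then has
   shift g and factor eps for the original data. *)
pose l2 b := (g * lab' b)%g; pose Phi2 := e *: Phi'.
have PhiT : Phi^T = Phi := PhiBT R kappa sigma t u.
have PhiT' : Phi'^T = Phi' := PhiBT R kappa' sigma' t' u'.
have PP : Phi *m Phi = 1%:M := PhiB_sqr R kappa sigma t u.
have PP' : Phi' *m Phi' = 1%:M := PhiB_sqr R kappa' sigma' t' u'.
have PhiU : Phi \in unitmx := PhiBU kappa sigma t u.
have PhiU' : Phi' \in unitmx := PhiBU kappa' sigma' t' u'.
have PhiO : label_orth lab Phi := PhiB_orth (sigma := sigma) supp.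
have PhiO' : label_orth lab' Phi' := PhiB_orth (sigma := sigma') supp'.
have P2T : Phi2^T = Phi2 by rewrite /Phi2 linearZ /= PhiT'.
have P22 : Phi2 *m Phi2 = 1%:M.
  by rewrite /Phi2 -scalemxAl -scalemxAr scalerA ee scale1r.
have [P2U _] := mulmx1_unit P22.
have P2O : label_orth l2 Phi2.
  move=> a b; rewrite mxE mulf_eq0 negb_or => /andP[_ /PhiO' ab].
  by rewrite /l2 -mulgA (mulgA (lab' a)) (Gcomm _ g) -(mulgA g (lab' a)) ab
    mulg1.
have l2E b x : (l2 b == x) = (lab' b == (g * x)%g).
  by rewrite -(can_eq (mulKg g)) /l2 mulgA gg mul1g.
have cnt : label_count lab =1 label_count l2.
  move=> x; rewrite (labelB_count supp kinv).
  have -> : label_count l2 x = label_count lab' (g * x)%g.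
    by rewrite /label_count; apply: eq_card => b; rewrite !inE l2E.
  by rewrite (labelB_count supp' kinv') kE /translate mulKg.
have [||A AE AP] := labelled_congr (pos := fun x => x \in codom u)
  PhiT PP PhiO P2T P2U P2O cnt.
- move=> a aa; apply: (support_pos supp) aa.
  rewrite mem_finsupp -(labelB_count supp kinv) -lt0n; apply/card_gt0P.
  by exists a; rewrite inE.
- move=> x xx; have xG : x \in @G2 G by rewrite inE expg2 xx.
  have gxG : (g * x)%g \in @G2 G.
    by rewrite inE expg2 -mulgA (mulgA x) (Gcomm x) -mulgA xx mulg1 gg.
  have [P [Pk Ps]] := label_sig_ex PhiT PhiU PhiO xx.
  have [Q [Qk Qs]] := label_sig_ex P2T P2U P2O xx.
  exists P; split=> //; suff PQ : P = Q by rewrite cnt PQ.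
  have := label_sig_invol PP PhiO xx Pk Ps.
  have := label_sig_invol P22 P2O xx Qk Qs.
  rewrite (PhiB_trace_label R supp par xG) -cnt.
  rewrite (eq_bigl (fun b => lab' b == (g * x)%g)) => [|b]; last exact: l2E.
  rewrite (eq_bigr (fun b => e * Phi' b b)) => [|b _]; last by rewrite mxE.
  rewrite -mulr_sumr (PhiB_trace_label R supp' par' gxG) sE /translate mulKg.
  rewrite rmorphM /= mulrA ee mul1r => -> /addIr /eqP; rewrite eqr_nat; lia.
have AE' : A^T *m Phi' *m A = e *: Phi.
  by rewrite -AE /Phi2 -scalemxAr -scalemxAl scalerA ee scale1r.
have NN : sizeB kappa t u = sizeB kappa' t' u'.
  by rewrite (sizeB_weight supp kinv) (sizeB_weight supp' kinv') w w'.
pose A' := Phi *m A^T *m Phi2.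
have A'A : A' *m A = 1%:M.
  transitivity (Phi *m (A^T *m Phi2 *m A)); first by rewrite /A' !mulmxA.
  by rewrite AE PP.
have AA' : A *m A' = 1%:M by apply: mulmx1C_eq A'A.
have isoA : lie_iso (Skew Phi) (Skew Phi') (conj_hom A A').
  exact: (conj_lie_iso (c := e)).
have imA : forall x, (conj_hom A A' @: skew_label lab Phi x)%VS = skew_label
  lab' Phi' x.
  apply: (conj_skew_label_eq Gcomm PhiT PhiU PhiO PhiT' PhiU' PhiO' e0 A'A AA'
    AE' gg).
  by move=> b a /AP <-; rewrite /l2 mulgA gg mul1g.
have [chi chi_iso chiK] := lie_iso_inv (@skewB_lie kappa sigma m r1 t u)
  psi_iso.
exists (psi' \o (conj_hom A A' \o chi))%VF; split.
  by apply: lie_iso_comp psi_iso'; apply: lie_iso_comp isoA.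
move=> x; rewrite !limg_comp GamE GamE' (cancel_limg chiK) ?capvSr //.
by rewrite GammaB_skew_label imA.
Qed.

End TwoGammas.
End Main.

Theorem theorem38 (R : realType) (G : groupType)
    (Gcomm : forall x y : G, (x * y)%g = (y * x)%g)
    (r p q : nat) (hr : (2 <= r)%N) (hpq : (p + q = 2 * r + 1)%N)
    (hqp : (q <= p)%N) :
  let admissible (kappa : {fsfun G -> nat with 0%N}) (sigma : G -> int) :=
    [/\ paramB kappa sigma,
        r = ((weight kappa - 1) %/ 2)%N
      & (p - q)%N = `|signature kappa sigma|%N] in
  [/\ (* each such Gamma_B(kappa, sigma) is a grading on L *)
      (forall kappa sigma, admissible kappa sigma ->
         exists Gam : G -> {vspace 'M[R]_(p + q)},
           is_GammaB kappa sigma (so R p q) Gam /\ is_grading (so R p q) Gam),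
      (forall Gam : G -> {vspace 'M[R]_(p + q)},
         is_grading (so R p q) Gam ->
         exists kappa sigma, admissible kappa sigma /\
           exists Gam', is_GammaB kappa sigma (so R p q) Gam' /\
                        grading_isomorphic (so R p q) Gam Gam')
    & (forall kappa sigma kappa' sigma',
         admissible kappa sigma -> admissible kappa' sigma' ->
         forall Gam Gam' : G -> {vspace 'M[R]_(p + q)},
           is_GammaB kappa sigma (so R p q) Gam ->
           is_GammaB kappa' sigma' (so R p q) Gam' ->
           (grading_isomorphic (so R p q) Gam Gam' <->
            same_orbit kappa sigma kappa' sigma'))].
Proof.
move=> admissible.
have n3 : (2 < p + q)%N by lia.
have nodd : odd (p + q) by rewrite hpq; lia.
(* Oddness of the weight makes the halving in r exact, so the weight is 2 r + 1. *)
have wE kappa sigma : admissible kappa sigma -> weight kappa = (p + q)%N.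
  by case=> -[_ wodd _ _] rE _; lia.
split.
- move=> kappa sigma adm; have [par _ sg] := adm.
  exact: so_gamma_ex par (wE _ _ adm) hqp sg.
- move=> Gam gr; have [kappa [sigma [par wk sg gam]]] :=
    so_gamma_onto Gcomm n3 nodd hqp gr.
  exists kappa, sigma; split; first by split=> //; rewrite wk; lia.
  (* [Gam] itself is already a transported [GammaB], so the identity serves as the isomorphism. *)
  exists Gam; split=> //; exists \1%VF; split.
    by split=> [|X Y _ _|X Y _ _]; rewrite ?lim1g ?id_lfunE.
  by move=> g; rewrite lim1g.
move=> kappa sigma kappa' sigma' adm adm' Gam Gam' gam gam'.
have [par _ _] := adm; have [par' _ _] := adm'.
have w := wE _ _ adm; have w' := wE _ _ adm'.
split.
  exact: (grading_iso_same_orbit Gcomm n3 nodd par par' w w' gam gam').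
exact: (same_orbit_grading_iso Gcomm n3 nodd par par' w w' gam gam').
Qed.
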